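(* The group $(E_8^C)^{\sigma'_4,\mathfrak{so}(6,C)}=\{\alpha\in E_8^C\mid\sigma'_4\alpha=\alpha\sigma'_4,\ \mathrm{ad}(R_D)\alpha=\alpha\,\mathrm{ad}(R_D)\text{ for all }D\in\mathfrak{so}(6,C)\}$ is isomorphic to $\mathrm{Spin}(10,C)$.
   Context: Octonions and Jordan algebra. $\mathfrak C$ is the real division algebra of octonions with standard basis $e_0=1,e_1,\dots,e_7$, conjugation $x\mapsto\overline x$; $C=\mathbf R\oplus i\mathbf R$ is the field of complex numbers, and $\mathfrak C^C=\mathfrak C\otimes_{\mathbf R}C$ with $C$-linearly extended product and conjugation. $\mathfrak J^C$ is the space of $3\times3$ matrices $$X=\begin{pmatrix}\xi_1&x_3&\overline x_2\\ \overline x_3&\xi_2&x_1\\ x_2&\overline x_1&\xi_3\end{pmatrix},\quad \xi_k\in C,\ x_k\in\mathfrak C^C.$$ $E_k$ is the element with $\xi_k=1$ and all other entries $0$; $F_k(x)$ is the element with $x_k=x$ and all other entries $0$; $E$ is the unit matrix. Put $X\circ Y=\frac12(XY+YX)$, $(X,Y)=\mathrm{tr}(X\circ Y)$, $X\times Y=\frac12(2X\circ Y-\mathrm{tr}(X)Y-\mathrm{tr}(Y)X+(\mathrm{tr}(X)\mathrm{tr}(Y)-(X,Y))E)$, $\tilde T X=T\circ X$. $F_4^C$ is the group of $C$-linear automorphisms of $(\mathfrak J^C,\circ)$, with Lie algebra $\mathfrak f_4^C$ of derivations. $\mathfrak e_6^C=\{\delta+\tilde T\mid\delta\in\mathfrak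 f_4^C,\ T\in\mathfrak J^C,\ \mathrm{tr}(T)=0\}$. $E_7^C$. $\mathfrak P^C=\mathfrak J^C\oplus\mathfrak J^C\oplus C\oplus C$. For $\phi\in\mathfrak e_6^C$, $A,B\in\mathfrak J^C$, $\nu\in C$, $\varPhi(\phi,A,B,\nu)$ is the linear map of $\mathfrak P^C$ $$(X,Y,\xi,\eta)\mapsto(\phi X-\tfrac13\nu X+2B\times Y+\eta A,\ 2A\times X-{}^t\phi Y+\tfrac13\nu Y+\xi B,\ (A,Y)+\nu\xi,\ (B,X)-\nu\eta),$$ where ${}^t\phi$ is the transpose for $(\cdot,\cdot)$; these form the Lie algebra $\mathfrak e_7^C$. For $P=(X,Y,\xi,\eta)$, $Q=(Z,W,\zeta,\omega)$, $P\times Q=\varPhi(\phi,A,B,\nu)$ with $\phi=-\frac12(X\vee W+Z\vee Y)$, $A=-\frac14(2Y\times W-\xi Z-\zeta X)$, $B=\frac14(2X\times Z-\eta W-\omega Y)$, $\nu=\frac18((X,W)+(Z,Y)-3(\xi\omega+\zeta\eta))$, where $X\vee W=[\tilde X,\tilde W]+(X\circ W-\frac13(X,W)E)^{\sim}$. Also $\{P,Q\}=(X,W)-(Z,Y)+\xi\omega-\zeta\eta$. $E_7^C=\{\alpha\in\mathrm{Iso}_C(\mathfrak P^C)\mid\alpha(P\times Q)\alpha^{-1}=\alpha P\times\alpha Q\}$, and $F_4^C\subset E_7^C$ via $\alpha(X,Y,\xi,\eta)=(\alpha X,\alpha Y,\xi,\eta)$. $E_8^C$. $\mathfrak e_8^C=\mathfrak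 e_7^C\oplus\mathfrak P^C\oplus\mathfrak P^C\oplus C\oplus C\oplus C$ with bracket $[(\varPhi_1,P_1,Q_1,r_1,s_1,t_1),(\varPhi_2,P_2,Q_2,r_2,s_2,t_2)]=(\varPhi,P,Q,r,s,t)$: $\varPhi=[\varPhi_1,\varPhi_2]+P_1\times Q_2-P_2\times Q_1$; $P=\varPhi_1P_2-\varPhi_2P_1+r_1P_2-r_2P_1+s_1Q_2-s_2Q_1$; $Q=\varPhi_1Q_2-\varPhi_2Q_1-r_1Q_2+r_2Q_1+t_1P_2-t_2P_1$; $r=-\frac18\{P_1,Q_2\}+\frac18\{P_2,Q_1\}+s_1t_2-s_2t_1$; $s=\frac14\{P_1,P_2\}+2r_1s_2-2r_2s_1$; $t=-\frac14\{Q_1,Q_2\}-2r_1t_2+2r_2t_1$. $E_8^C=\{\alpha\in\mathrm{Iso}_C(\mathfrak e_8^C)\mid\alpha[R,R']=[\alpha R,\alpha R']\}$. $E_7^C\subset E_8^C$ via $\alpha(\varPhi,P,Q,r,s,t)=(\alpha\varPhi\alpha^{-1},\alpha P,\alpha Q,r,s,t)$. The element $\sigma'_4\in F_4^C$: in terms of the entries of $X$, it fixes $\xi_1,\xi_2,\xi_3$ and maps $x_1\mapsto-e_1x_1e_1$, $x_2\mapsto e_1x_2$, $x_3\mapsto-x_3e_1$. It is regarded as an element of $E_8^C$ via the inclusions $F_4^C\subset E_7^C\subset E_8^C$. Here $\mathfrak{so}(6,C)$ denotes $\{D\in\mathfrak f_4^C\mid DE_i=0\ (i=1,2,3),\ DF_1(e_k)=0\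 (k=0,1)\}$ and, for such $D$, $R_D=(\varPhi(D,0,0,0),0,0,0,0,0)\in\mathfrak e_8^C$. $\mathrm{Spin}(10,C)$ is the complex spinor group, the universal (double) covering group of $SO(10,C)$. *)

(* Defs.v *)
From HB Require Import structures.
From mathcomp Require Import all_boot all_order all_algebra.
From mathcomp Require Import complex.
From mathcomp Require Import boolp classical_sets reals topology normedtype.
From mathcomp Require Import ring.

Set Implicit Arguments.
Unset Strict Implicit.
Unset Printing Implicit Defensive.

Import Order.TTheory GRing.Theory Num.Theory.
Import VectorInternalTheory.
Import numFieldNormedType.Exports.
Local Open Scope ring_scope.

(* The algebra is developed over a field K of characteristic 0; the complex  *)
(* objects of the theorem are obtained at K := R[i] with R : realType.       *)

(** * Octonions *)

(* e_i e_j = e_k for each listed (i, j, k) and its cyclic rotations,         *)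
(* e_j e_i = - e_i e_j and e_i e_i = - e_0 for distinct i, j > 0.            *)
Definition fano : seq (nat * nat * nat) :=
  [:: (1, 2, 3); (1, 4, 5); (1, 6, 7); (2, 5, 7); (3, 4, 7); (3, 5, 6);
      (6, 4, 2)]%N.

Definition on_fano (i j k : nat) : bool :=
  [|| (i, j, k) \in fano, (j, k, i) \in fano | (k, i, j) \in fano].

Section Octonions.
Context (K : numFieldType).
Implicit Types x y : 'rV[K]_8.

(* coefficient of e_k in e_i e_j *)
Definition oct_coef (i j k : 'I_8) : K :=
  if i == 0 then (j == k)%:R
  else if j == 0 then (i == k)%:R
  else if i == j then - (k == 0)%:R
  else (on_fano i j k)%:R - (on_fano j i k)%:R.

Definition omul x y : 'rV[K]_8 :=
  \row_k \sum_i \sum_j oct_coef i j k * (x 0 i * y 0 j).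

Definition oconj x : 'rV[K]_8 := \row_k (if k == 0 then x 0 k else - x 0 k).

Definition oe (k : nat) : 'rV[K]_8 := delta_mx 0 (inord k).

Lemma omul_linear_r x : linear (omul x).
Proof.
move=> a y z; apply/rowP => k; rewrite !mxE mulr_sumr -big_split /=.
apply: eq_bigr => i _; rewrite mulr_sumr -big_split /=.
by apply: eq_bigr => j _; rewrite !mxE; ring.
Qed.

Lemma omul_linear_l y : linear (omul^~ y).
Proof.
move=> a x z; apply/rowP => k; rewrite !mxE mulr_sumr -big_split /=.
apply: eq_bigr => i _; rewrite mulr_sumr -big_split /=.
by apply: eq_bigr => j _; rewrite !mxE; ring.
Qed.

Lemma oconj_linear : linear oconj.
Proof.
move=> a x y; apply/rowP => k; rewrite !mxE; case: ifP => _ //.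
by rewrite mulrN opprD.
Qed.

End Octonions.

Lemma lfun_linE (K : numFieldType) (U V : vectType K) a (f g : 'Hom(U, V)) u :
  (a *: f + g) u = a *: f u + g u.
Proof. by rewrite add_lfunE scale_lfunE. Qed.

Lemma scale_regE (K : numFieldType) (a : K) (b : K^o) : a *: b = a * b :> K.
Proof. by []. Qed.

(** * The exceptional Jordan algebra *)

(* (xi, x) stands for the Hermitian octonion matrix of the text with         *)
(* xi_(k+1) = xi 0 k and x_(k+1) = row k x, for k : 'I_3.                    *)
Definition jordan (K : numFieldType) : Type := ('rV[K]_3 * 'M[K]_(3, 8))%type.
HB.instance Definition _ (K : numFieldType) :=
  Vector.copy (jordan K) ('rV[K]_3 * 'M[K]_(3, 8))%type.

Section JordanMatrices.
Context (K : numFieldType).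
Implicit Types X Y Z T : jordan K.

(* The indices 'I_3 are integers mod 3: the entry x_k sits in the positions  *)
(* (i, j) with j = i + 1 and {i, j, k} = {0, 1, 2}, i.e. k = - (i + j).      *)
Definition jentry X (i j : 'I_3) : 'rV[K]_8 :=
  if i == j then X.1 0 i *: oe K 0
  else if j == i + 1 then row (- (i + j)) X.2
  else oconj (row (- (i + j)) X.2).

Definition jmx X : 'M['rV[K]_8]_3 := \matrix_(i, j) jentry X i j.

Definition octmx_mul (M N : 'M['rV[K]_8]_3) : 'M['rV[K]_8]_3 :=
  \matrix_(i, j) \sum_k omul (M i k) (N k j).

(* inverse of jmx on Hermitian matrices *)
Definition of_jmx (M : 'M['rV[K]_8]_3) : jordan K :=
  (\row_k M k k 0 0, \matrix_(k < 3) M (k + 1) (k + 2)).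

End JordanMatrices.

HB.lock Definition jmul (K : numFieldType) (X Y : jordan K) : jordan K :=
  2^-1 *: of_jmx (octmx_mul (jmx X) (jmx Y) + octmx_mul (jmx Y) (jmx X)).

Section Jordan.
Context (K : numFieldType).
Implicit Types X Y Z T : jordan K.

Definition jtr X : K := \sum_k X.1 0 k.

Definition jform X Y : K := jtr (jmul X Y).

Definition jone : jordan K := (const_mx 1, 0).

Definition jE (k : 'I_3) : jordan K := (delta_mx 0 k, 0).

Definition jF (k : 'I_3) (x : 'rV[K]_8) : jordan K :=
  (0, \matrix_(i < 3) (if i == k then x else 0)).

Definition jcross X Y : jordan K :=
  2^-1 *: (2 *: jmul X Y - jtr X *: Y - jtr Y *: X
           + (jtr X * jtr Y - jform X Y) *: jone).

Definition jtilde T : 'End(jordan K) := linfun (jmul T).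

(* The transpose of phi for jform: (phi X, Y) = (X, jtrans phi Y). The       *)
(* elements jE k and jF k (oe K j) form a jform-orthogonal basis, of square  *)
(* norms 1 and 2, and the coordinates below are those of this basis.         *)
Definition jtrans_fun (phi : 'End(jordan K)) Y : jordan K :=
  (\row_k jform (phi (jE k)) Y,
   \matrix_(k, j) (2^-1 * jform (phi (jF k (delta_mx 0 j))) Y)).

Definition jtrans (phi : 'End(jordan K)) : 'End(jordan K) :=
  linfun (jtrans_fun phi).

Definition jbracket (phi psi : 'End(jordan K)) : 'End(jordan K) :=
  (phi \o psi)%VF - (psi \o phi)%VF.

Definition jvee X W : 'End(jordan K) :=
  jbracket (jtilde X) (jtilde W)
  + jtilde (jmul X W - (3^-1 * jform X W) *: jone).

Definition in_f4 (D : 'End(jordan K)) : Prop :=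
  forall X Y, D (jmul X Y) = jmul (D X) Y + jmul X (D Y).

Definition in_e6 (phi : 'End(jordan K)) : Prop :=
  exists delta T, [/\ in_f4 delta, jtr T = 0 & phi = delta + jtilde T].

Lemma jmulC X Y : jmul X Y = jmul Y X.
Proof. by rewrite jmul.unlock addrC. Qed.

Lemma jentry_linear i j : linear (fun X => jentry X i j).
Proof.
move=> a X Y; rewrite /jentry; case: ifP => _.
  by rewrite !mxE /= scalerDl scalerA.
have rowE k : row k (a *: X + Y).2 = a *: row k X.2 + row k Y.2.
  by apply/rowP => l; rewrite !mxE.
by case: ifP => _; rewrite rowE // oconj_linear.
Qed.

Lemma jmul_linear X : linear (jmul X).
Proof.
move=> a Y Z; rewrite jmul.unlock scalerA mulrC -scalerA -scalerDr; congr (_ *: _).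
have mE : forall i j, (octmx_mul (jmx X) (jmx (a *: Y + Z))
      + octmx_mul (jmx (a *: Y + Z)) (jmx X)) i j =
    a *: (octmx_mul (jmx X) (jmx Y) + octmx_mul (jmx Y) (jmx X)) i j
      + (octmx_mul (jmx X) (jmx Z) + octmx_mul (jmx Z) (jmx X)) i j.
  move=> i j; rewrite !mxE -!big_split /= scaler_sumr -big_split /=.
  apply: eq_bigr => k _; rewrite !mxE !jentry_linear omul_linear_r.
  by rewrite omul_linear_l scalerDr addrACA.
move: mE; set M := (_ + _); set N := (_ + _); set L := (_ + _) => mE.
by congr pair; apply/matrixP => k l; rewrite mxE mE !mxE.
Qed.
HB.instance Definition _ X :=
  GRing.isLinear.Build K (jordan K) (jordan K) *:%R (jmul X) (jmul_linear X).

Lemma jtildeE T X : jtilde T X = jmul T X.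
Proof. exact: (lfunE (jmul T)). Qed.

Lemma jtr_linear : linear (jtr : jordan K -> K^o).
Proof.
move=> a X Y; rewrite /jtr scaler_sumr -big_split /=.
by apply: eq_bigr => k _; rewrite !mxE.
Qed.

Lemma jform_linear X : linear (jform X : jordan K -> K^o).
Proof. by move=> a Y Z; rewrite /jform jmul_linear jtr_linear. Qed.

Lemma jformC X Y : jform X Y = jform Y X.
Proof. by rewrite /jform jmulC. Qed.

Lemma coord_pair_linear (V : lmodType K) (f : 'I_3 -> V -> K)
    (g : 'I_3 -> 'I_8 -> V -> K) :
    (forall k, linear (f k : V -> K^o)) ->
    (forall k j, linear (g k j : V -> K^o)) ->
  linear (fun v => (\row_k f k v, \matrix_(k, j) g k j v) : jordan K).
Proof.
move=> fL gL a u v; congr pair; apply/matrixP => k l; rewrite !mxE.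
  exact: fL.
exact: gL.
Qed.

Lemma jtrans_fun_linear phi : linear (jtrans_fun phi).
Proof.
apply: coord_pair_linear => [k|k j]; first exact: jform_linear.
move=> a Y Z; rewrite jform_linear.
move: (jform _ Y) (jform _ Z) => y z; rewrite /GRing.scale /=; ring.
Qed.
HB.instance Definition _ phi :=
  GRing.isLinear.Build K (jordan K) (jordan K) *:%R (jtrans_fun phi)
    (jtrans_fun_linear phi).

Lemma jtransE phi Y : jtrans phi Y = jtrans_fun phi Y.
Proof. exact: (lfunE (jtrans_fun phi)). Qed.

Lemma jcrossC X Y : jcross X Y = jcross Y X.
Proof.
rewrite /jcross jmulC jformC [jtr X * _]mulrC; congr (_ *: (_ + _)).
by rewrite addrAC.
Qed.

Lemma jcross_linear X : linear (jcross X).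
Proof.
move=> a Y Z; rewrite /jcross jmul_linear jtr_linear jform_linear.
move: (jmul X Y) (jmul X Z) (jtr X) (jtr Y) (jtr Z) (jform X Y) (jform X Z).
move: jone => e u v p q r m n; rewrite /GRing.scale /=.
congr pair; apply/matrixP => k l; rewrite !mxE; ring.
Qed.

Lemma jtrans_linear : linear jtrans.
Proof.
move=> a phi psi; apply/lfunP => Y.
rewrite [RHS]lfun_linE !jtransE.
have := @coord_pair_linear 'End(jordan K) (fun k F => jform (F (jE k)) Y)
  (fun k j F => 2^-1 * jform (F (jF k (delta_mx 0 j))) Y).
apply => [k b F G|k j b F G]; rewrite lfun_linE.
  by rewrite !(jformC _ Y) jform_linear.
rewrite !(jformC _ Y) jform_linear.
move: (jform Y _) (jform Y _) => y z; rewrite /GRing.scale /=; ring.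
Qed.

Lemma jtilde_linear : linear jtilde.
Proof.
move=> a S T; apply/lfunP => Y.
rewrite [RHS]lfun_linE !jtildeE.
by rewrite ![jmul _ Y]jmulC jmul_linear.
Qed.

Lemma in_e6_linear a phi psi : in_e6 phi -> in_e6 psi -> in_e6 (a *: phi + psi).
Proof.
move=> [D [S [hD hS ->]]] [D' [T [hD' hT ->]]].
exists (a *: D + D'), (a *: S + T); split.
- move=> X Y; rewrite !lfun_linE hD hD'.
  rewrite ![jmul (_ + _) Y]jmulC !jmul_linear.
  rewrite ![jmul Y _]jmulC scalerDr -!addrA; congr (_ + _).
  by rewrite addrCA.
- by rewrite jtr_linear hS hT /GRing.scale /= mulr0 addr0.
- by rewrite jtilde_linear scalerDr addrACA.
Qed.

Lemma in_e6_0 : in_e6 0.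
Proof.
exists 0, 0; split.
- by move=> X Y; rewrite !lfunE /= linear0 jmulC linear0 addr0.
- by rewrite /jtr big1 // => k _; rewrite mxE.
- have := jtilde_linear (-1) 0 0.
  by rewrite scaler0 !addr0 scaleN1r addNr => ->; rewrite addr0.
Qed.

End Jordan.

(** * Subspaces given by a linear condition *)

Section SubspaceOf.
Context (K : numFieldType) (V : vectType K).

(* the subspace with underlying set S, if S is one (see mem_subspace_of) *)
Definition subspace_of (S : set V) : {vspace V} :=
  xget 0%VS (fun U : {vspace V} => forall v, v \in U <-> S v).

Lemma mem_subspace_of (S : set V) :
  S 0 -> (forall a u v, S u -> S v -> S (a *: u + v)) ->
  forall v, v \in subspace_of S <-> S v.
Proof.
move=> S0 SL.
pose p n := `[< exists U : {vspace V}, \dim U = n /\ forall v, v \in U -> S v >].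
have ex_p : exists n, p n.
  exists 0%N; apply/asboolP; exists 0%VS; split; first exact: dimv0.
  by move=> v; rewrite memv0 => /eqP->.
have le_p n : p n -> (n <= \dim {:V})%N.
  by move=> /asboolP[U [<- _]]; apply: dimvS; apply: subvf.
case: (ex_maxnP ex_p le_p) => m /asboolP[U [dU US]] maxm.
suff h : forall v, v \in U <-> S v.
  exact: (@xgetPex _ 0%VS (fun U : {vspace V} => forall v, v \in U <-> S v)
    (ex_intro _ U h)).
move=> v; split; first exact: US.
move=> Sv; have : p (\dim (U + <[v]>)).
  apply/asboolP; exists (U + <[v]>)%VS; split => // w.
  move=> /memv_addP[u uU [x /vlineP[c ->] ->]].
  by rewrite addrC; apply: SL => //; apply: US.
move=> /maxm; rewrite -dU => le_dim.
have /eqP-> : (U == U + <[v]>)%VS by rewrite eqEdim addvSl.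
by apply: (subvP (addvSr U _)); apply: memv_line.
Qed.

End SubspaceOf.

(** * The Freudenthal space and e_7 *)

Definition freudenthal (K : numFieldType) : Type :=
  (jordan K * jordan K * K^o * K^o)%type.
HB.instance Definition _ (K : numFieldType) :=
  Vector.copy (freudenthal K) (jordan K * jordan K * K^o * K^o)%type.

Section E7.
Context (K : numFieldType).
Implicit Types (X Y A B : jordan K) (phi : 'End(jordan K)) (nu : K).
Implicit Types p q : freudenthal K.

Definition Phi_fun phi A B nu p : freudenthal K :=
  let: (X, Y, xi, eta) := p in
  (phi X - (3^-1 * nu) *: X + 2 *: jcross B Y + eta *: A,
   2 *: jcross A X - jtrans phi Y + (3^-1 * nu) *: Y + xi *: B,
   jform A Y + nu * xi,
   jform B X - nu * eta).

Definition Phi phi A B nu : 'End(freudenthal K) := linfun (Phi_fun phi A B nu).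

Definition in_e7 (F : 'End(freudenthal K)) : Prop :=
  exists phi A B nu, in_e6 phi /\ F = Phi phi A B nu.

Definition e7 : {vspace 'End(freudenthal K)} := subspace_of in_e7.

Definition fcross p q : 'End(freudenthal K) :=
  let: (X, Y, xi, eta) := p in
  let: (Z, W, zeta, omega) := q in
  Phi (- 2^-1 *: (jvee X W + jvee Z Y))
      (- 4^-1 *: (2 *: jcross Y W - xi *: Z - zeta *: X))
      (4^-1 *: (2 *: jcross X Z - eta *: W - omega *: Y))
      (8^-1 * (jform X W + jform Z Y - 3 * (xi * omega + zeta * eta))).

Definition fskew p q : K :=
  let: (X, Y, xi, eta) := p in
  let: (Z, W, zeta, omega) := q in
  jform X W - jform Z Y + xi * omega - zeta * eta.

Definition F4_to_E7_fun phi p : freudenthal K :=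
  let: (X, Y, xi, eta) := p in (phi X, phi Y, xi, eta).

Definition F4_to_E7 phi : 'End(freudenthal K) := linfun (F4_to_E7_fun phi).

Lemma Phi_fun_linear phi A B nu : linear (Phi_fun phi A B nu).
Proof.
move=> a [[[X Y] x] y] [[[X' Y'] x'] y'] /=.
rewrite !linearP !jcross_linear !jform_linear /=.
move: (phi X) (phi X') (jcross B Y) (jcross B Y') (jcross A X) (jcross A X').
move: (jtrans phi Y) (jtrans phi Y') (jform A Y) (jform A Y') (jform B X).
move: (jform B X') => f1 f2 f3 f4 t1 t2 c1 c2 c3 c4 p1 p2.
congr (_, _, _, _); rewrite /GRing.scale /=.
- by congr pair; apply/matrixP => k l; rewrite !mxE; ring.
- by congr pair; apply/matrixP => k l; rewrite !mxE; ring.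
- by rewrite scale_regE; ring.
- by rewrite scale_regE; ring.
Qed.
HB.instance Definition _ phi A B nu :=
  GRing.isLinear.Build K (freudenthal K) (freudenthal K) *:%R
    (Phi_fun phi A B nu) (Phi_fun_linear phi A B nu).

Lemma PhiE phi A B nu p : Phi phi A B nu p = Phi_fun phi A B nu p.
Proof. exact: (lfunE (Phi_fun phi A B nu)). Qed.

Lemma F4_to_E7_fun_linear phi : linear (F4_to_E7_fun phi).
Proof.
by move=> a [[[X Y] x] y] [[[X' Y'] x'] y'] /=; rewrite !linearP.
Qed.
HB.instance Definition _ phi :=
  GRing.isLinear.Build K (freudenthal K) (freudenthal K) *:%R
    (F4_to_E7_fun phi) (F4_to_E7_fun_linear phi).

Lemma F4_to_E7E phi p : F4_to_E7 phi p = F4_to_E7_fun phi p.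
Proof. exact: (lfunE (F4_to_E7_fun phi)). Qed.

Lemma Phi_linear a phi psi A A' B B' nu nu' :
  Phi (a *: phi + psi) (a *: A + A') (a *: B + B') (a * nu + nu') =
  a *: Phi phi A B nu + Phi psi A' B' nu'.
Proof.
have cl (U U' Z : jordan K) :
    jcross (a *: U + U') Z = a *: jcross U Z + jcross U' Z.
  by rewrite !(jcrossC _ Z) jcross_linear.
have fl (U U' Z : jordan K) :
    jform (a *: U + U') Z = a * jform U Z + jform U' Z.
  by rewrite !(jformC _ Z) jform_linear.
apply/lfunP => -[[[X Y] x] y]; rewrite [RHS]lfun_linE !PhiE /=.
rewrite jtrans_linear !lfun_linE !cl !fl.
move: (phi X) (psi X) (jcross B Y) (jcross B' Y) (jcross A X) (jcross A' X).
move: (jtrans phi Y) (jtrans psi Y) (jform A Y) (jform A' Y) (jform B X).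
move: (jform B' X) => f1 f2 f3 f4 t1 t2 c1 c2 c3 c4 p1 p2.
congr (_, _, _, _); rewrite /GRing.scale /=.
- by congr pair; apply/matrixP => k l; rewrite !mxE; ring.
- by congr pair; apply/matrixP => k l; rewrite !mxE; ring.
- by rewrite scale_regE; ring.
- by rewrite scale_regE; ring.
Qed.

Lemma mem_e7 F : F \in e7 <-> in_e7 F.
Proof.
apply: mem_subspace_of => [|a G H].
  exists 0, 0, 0, 0; split; first exact: in_e6_0.
  apply/lfunP => -[[[X Y] x] y]; rewrite PhiE lfunE /=.
  have c0 (Z : jordan K) : jcross 0 Z = 0.
    have := jcross_linear Z (-1) 0 0.
    by rewrite scaler0 addr0 scaleN1r addNr jcrossC.
  have f0 (Z : jordan K) : jform 0 Z = 0.
    have := jform_linear Z (-1) 0 0.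
    by rewrite scaler0 addr0 scaleN1r addNr jformC.
  have t0 : jtrans (0 : 'End(jordan K)) = 0.
    by have := jtrans_linear (-1) (0 : 'End(jordan K)) 0;
       rewrite scaler0 addr0 scaleN1r addNr.
  rewrite !c0 !f0 t0 !lfunE /= !mulr0 !mul0r !scaler0 !scale0r.
  by rewrite !subr0 !addr0.
move=> [phi [A [B [nu [hphi ->]]]]] [psi [A' [B' [nu' [hpsi ->]]]]].
exists (a *: phi + psi), (a *: A + A'), (a *: B + B'), (a * nu + nu').
by split; [apply: in_e6_linear|rewrite Phi_linear].
Qed.

End E7.

(** * The Lie algebra e_8 and its automorphism group *)

Definition e8 (K : numFieldType) : Type :=
  (subvs_of (e7 K) * freudenthal K * freudenthal K * K^o * K^o * K^o)%type.
HB.instance Definition _ (K : numFieldType) :=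
  Vector.copy (e8 K)
    (subvs_of (e7 K) * freudenthal K * freudenthal K * K^o * K^o * K^o)%type.

Section E8.
Context (K : numFieldType).
Implicit Types R : e8 K.

(* vsproj (e7 K) is the inverse of the inclusion vsval of e7 in the space    *)
(* of endomorphisms; here it is only applied to elements of e7.              *)
Definition e8_bracket R1 R2 : e8 K :=
  let: (F1, P1, Q1, r1, s1, t1) := R1 in
  let: (F2, P2, Q2, r2, s2, t2) := R2 in
  (vsproj (e7 K) ((vsval F1 \o vsval F2)%VF - (vsval F2 \o vsval F1)%VF
                  + fcross P1 Q2 - fcross P2 Q1),
   vsval F1 P2 - vsval F2 P1 + r1 *: P2 - r2 *: P1 + s1 *: Q2 - s2 *: Q1,
   vsval F1 Q2 - vsval F2 Q1 - r1 *: Q2 + r2 *: Q1 + t1 *: P2 - t2 *: P1,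
   - 8^-1 * fskew P1 Q2 + 8^-1 * fskew P2 Q1 + s1 * t2 - s2 * t1,
   4^-1 * fskew P1 P2 + 2 * r1 * s2 - 2 * r2 * s1,
   - 4^-1 * fskew Q1 Q2 - 2 * r1 * t2 + 2 * r2 * t1).

Definition in_E8 (alpha : 'End(e8 K)) : Prop :=
  bijective alpha /\
  forall R R', alpha (e8_bracket R R') = e8_bracket (alpha R) (alpha R').

Definition E7_to_E8 (alpha : 'End(freudenthal K)) R : e8 K :=
  let: (F, P, Q, r, s, t) := R in
  (vsproj (e7 K) (alpha \o vsval F \o alpha^-1)%VF, alpha P, alpha Q, r, s, t).

Definition sigma4_fun (X : jordan K) : jordan K :=
  let x1 := row 0 X.2 in
  let x2 := row 1 X.2 in
  let x3 := row 2 X.2 in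
  let e1 := oe K 1 in
  (X.1, \matrix_(k < 3)
          [:: - omul (omul e1 x1) e1; omul e1 x2; - omul x3 e1]`_k).

Definition sigma4_F4 : 'End(jordan K) := linfun sigma4_fun.

Lemma sigma4_fun_linear : linear sigma4_fun.
Proof.
move=> a X Y; rewrite /sigma4_fun.
have rowE k : row k (a *: X + Y).2 = a *: row k X.2 + row k Y.2.
  by apply/rowP => l; rewrite !mxE.
rewrite !rowE !omul_linear_r !omul_linear_l !opprD -!scalerN.
congr pair; apply/matrixP => k l; rewrite !mxE.
by case: k => [[|[|[|k]]]] //= _; rewrite !mxE.
Qed.
HB.instance Definition _ :=
  GRing.isLinear.Build K (jordan K) (jordan K) *:%R sigma4_fun
    sigma4_fun_linear.

Lemma sigma4_F4E X : sigma4_F4 X = sigma4_fun X.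
Proof. exact: (lfunE sigma4_fun). Qed.

Definition sigma4 : e8 K -> e8 K := E7_to_E8 (F4_to_E7 sigma4_F4).

Definition in_so6 (D : 'End(jordan K)) : Prop :=
  [/\ in_f4 D, forall i : 'I_3, D (jE K i) = 0,
      D (jF 0 (oe K 0)) = 0 & D (jF 0 (oe K 1)) = 0].

Definition R_of (D : 'End(jordan K)) : e8 K :=
  (vsproj (e7 K) (Phi D 0 0 0), 0, 0, 0, 0, 0).

Definition E8_sigma4_so6 (alpha : 'End(e8 K)) : Prop :=
  [/\ in_E8 alpha,
      sigma4 \o alpha =1 alpha \o sigma4
    & forall D, in_so6 D ->
        e8_bracket (R_of D) \o alpha =1 alpha \o e8_bracket (R_of D)].

End E8.

(** * The complex spinor group *)

(* The Clifford algebra of the quadratic form sum_i z_i^2 on K^n. The basis  *)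
(* element indexed by A is the increasing product of the generators e_i,     *)
(* i in A, where e_i^2 = 1 and e_i e_j = - e_j e_i for distinct i, j.        *)
Definition clifford (K : numFieldType) (n : nat) : Type :=
  {ffun {set 'I_n} -> K^o}.
HB.instance Definition _ (K : numFieldType) (n : nat) :=
  Vector.copy (clifford K n) {ffun {set 'I_n} -> K^o}.

Section Spin.
Context (K : numFieldType) (n : nat).
Implicit Types (x y : clifford K n) (v w : 'rV[K]_n).

(* parity of the number of transpositions sorting e_A e_B *)
Definition cliff_inv (A B : {set 'I_n}) : nat :=
  \sum_(i in A) \sum_(j in B) (j < i)%N.

Definition cliff_mul x y : clifford K n :=
  [ffun C : {set 'I_n} =>
     \sum_(A : {set 'I_n}) \sum_(B : {set 'I_n} | (A :\: B) :|: (B :\: A) == C)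
       (-1) ^+ cliff_inv A B * (x A * y B)].

Definition cliff_one : clifford K n :=
  [ffun C : {set 'I_n} => (C == finset.set0)%:R].

(* e_(i_1) ... e_(i_m) |-> e_(i_m) ... e_(i_1) *)
Definition cliff_rev x : clifford K n :=
  [ffun C : {set 'I_n} => (-1) ^+ 'C(#|C|, 2) * x C].

Definition cliff_vec v : clifford K n :=
  [ffun C : {set 'I_n} => \sum_i v 0 i *+ (C == [set i]%SET)].

(* Spin(n, K) with its vector action v |-> x v x^-1 on K^n, x^-1 = rev x; for *)
(* algebraically closed K this action is the double covering onto SO(n, K).  *)
Definition Spin x : Prop :=
  [/\ forall C : {set 'I_n}, odd #|C| -> x C = 0,
      cliff_mul x (cliff_rev x) = cliff_one
    & forall v, exists w,
        cliff_mul (cliff_mul x (cliff_vec v)) (cliff_rev x) = cliff_vec w].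

End Spin.

(** * Isomorphism of linear groups *)

Local Open Scope classical_set_scope.

(* continuity on A for the usual topologies of the finite-dimensional spaces *)
Definition continuous_on (K : numFieldType) (U V : vectType K)
    (A : set U) (f : U -> V) : Prop :=
  {within [set u : 'rV[K]_(dim U) | A (r2v u)],
    continuous (fun u : 'rV[K]_(dim U) => v2r (f (r2v u)) : 'rV[K]_(dim V))}.

(* G and H, with the multiplications mulG and mulH, are isomorphic as        *)
(* topological groups (hence as Lie groups, for closed linear groups).       *)
Definition topgroup_isog (K : numFieldType) (U V : vectType K)
    (mulG : U -> U -> U) (mulH : V -> V -> V) (G : set U) (H : set V) : Prop :=
  exists (f : U -> V) (g : V -> U),
    [/\ forall a, G a -> H (f a) /\ g (f a) = a,
        forall b, H b -> G (g b) /\ f (g b) = b,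
        forall a b, G a -> G b -> f (mulG a b) = mulH (f a) (f b),
        continuous_on G f & continuous_on H g].

(* Main.v *)
(* The square tau of sigma'_4 is an involution of e8 whose (-1)-eigenspace W is a        *)
(* 128-dimensional half-spin representation of the even part so(16). The elements of e8  *)
(* that are anti-invariant under sigma'_4, tau-invariant and killed by a subalgebra so(5) *)
(* of so(6) form a 10-dimensional space, with a basis v_0, ..., v_9 acting on W by        *)
(* Clifford generators, and the v_i together with so(5) act irreducibly on W.             *)
(* An automorphism alpha in the group stabilizes W and the span of the v_i, so alpha      *)
(* conjugates the Clifford generators by an orthogonal matrix. Multiplying alpha by a     *)
(* product of rotors (and of a reflection, in the odd case) makes its action on W         *)
(* commute with the v_i and with so(5), hence scalar by Schur; an element s0 of so(6) that             *)
(* anticommutes with the v_i excludes the odd case, and the scalar is 1 or -1 because     *)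
(* alpha preserves brackets. So alpha acts on W as an element of Spin(10), and it is      *)
(* determined by this action since a Casimir identity z = sum_t [a_t, [b_t, z]], with     *)
(* a_t, b_t in W, recovers the even part from W. Conversely the rotors are realized in    *)
(* E8 by exponentials of the derivations [ad v_i, ad v_j] / 2. The identities on e8 and   *)
(* W that this uses are checked on a basis of e8 with integral structure constants.       *)

From Stdlib Require Import BinPos BinInt FMapPositive.
Require Import Defs.
From HB Require Import structures.
From mathcomp Require Import all_boot all_order all_algebra.
From mathcomp Require Import complex.
From mathcomp Require Import boolp classical_sets reals topology normedtype.
From mathcomp Require Import ring lra zify ssrZ.

Set Implicit Arguments.
Unset Strict Implicit.
Unset Printing Implicit Defensive.

Import Order.TTheory GRing.Theory Num.Theory.
Import VectorInternalTheory.
Import numFieldNormedType.Exports.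
Local Open Scope ring_scope.

(** * Sparse integral vectors *)

(** Write tau for the square of sigma'_4. It grades e8 as so(16) + W, and so(6) consists of the
    rotations of a summand of C^16 = C^6 + C^10. On so(16) = Lambda^2(C^6 + C^10), sigma'_4 is 1 on
    so(6) + so(10) and -1 on C^6 tensor C^10, and W contains no vector killed by so(6). So the Lie
    algebra of the group is so(10). The work lies in identifying the whole group, with its
    components and its centre, and this is done through its action on W.

    Let f be the vector of C^6 given by F_1(e_2), and so(5) its stabiliser in so(6). The ten
    elements v_i = f ^ u_i, for an orthonormal basis u_i of C^10, act on W as Clifford generators
    and commute there with so(5). Together they generate End W, as 128 = 32 * 4: the spinors of C^10
    times those of C^5. The span of the v_i is the image of an operator built from the bracket,
    sigma'_4 and so(5), so the group preserves it ([aut_cliff_v]). Hence every member of the group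
    conjugates the generators on W by an orthogonal matrix.

    [clifford_group] says that an invertible matrix with this property, commuting with so(5) and
    with one more element s0 = f ^ g of so(6), is a scalar times a product of rotors a + b g_i g_j,
    where a^2 + b^2 = 1. It is applied twice: to the automorphisms ([aut_word]) and to the elements
    of Spin(10) ([spin_is_word]). In both cases the scalar is a sign, which is itself a rotor.
    Conversely each rotor comes from an automorphism, the exponential of a derivation made from ad
    v_i and ad v_j ([rotor_graded], [word_graded]). So both groups have the same image in GL(W), the
    products of rotors.

    Both maps to GL(W) are injective. The Clifford representation is faithful ([cl_repK]), and an
    automorphism is determined by its restriction to W because the Casimir identity writes the even
    part as brackets of odd elements ([aut_ofE]). The resulting bijection is linear in one direction
    and quadratic in the other, hence a homeomorphism ([spin_isog]).

    What is special to e8 is a finite list of identities. After clearing denominators, all structure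
    constants with respect to a spanning family of 248 elements are integers. The identities are
    evaluated on sparse integer vectors and carried back to e8 by [ev_eq] and [ev_bind2]. *)

Section SparseVectors.

(* Coordinate vectors as lists of pairs (index, coefficient). Denominators are cleared in *)
(* all tables: mJ, crossC, fcrC, brL compute 2 X o Y, 4 X x Y, 48 P x Q and 48 [x, y].    *)
Definition sv : Type := seq (positive * Z).

(** Insertion keeps the indices increasing and drops zero coefficients, so the difference of two
    equal sorted lists cancels to the literal [[::]] on which [eqsv] decides. *)
Fixpoint addk (k : positive) (c : Z) (l : sv) : sv :=
  match l with
  | [::] => if Z.eqb c 0 then [::] else [:: (k, c)]
  | (k', c') :: l' =>
    match Pos.compare k k' with
    | Lt => if Z.eqb c 0 then l else (k, c) :: l
    | Eq => let s := Z.add c c' in if Z.eqb s 0 then l' else (k, s) :: l'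
    | Gt => (k', c') :: addk k c l'
    end
  end.

Definition axpy (a : Z) (l r : sv) : sv :=
  foldr (fun kc s => addk kc.1 (Z.mul a kc.2) s) r l.

Definition bind (f : positive -> sv) (l : sv) : sv :=
  foldr (fun kc s => axpy kc.2 (f kc.1) s) [::] l.

Definition bind2 (f : positive -> positive -> sv) (x y : sv) : sv :=
  bind (fun p => bind (f p) y) x.

Definition eqsv (l r : sv) : bool := if axpy (Zneg 1) l r is [::] then true else false.

Definition upto (n : nat) : seq positive := [seq Pos.of_nat i | i <- iota 1 n].

Lemma all_upto n (P : pred positive) :
  all P (upto n) -> forall p, (Pos.to_nat p <= n)%N -> P p.
Proof.
rewrite all_map => /allP h p hp.
have := h (Pos.to_nat p); rewrite mem_iota /= Pos2Nat.id; apply.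
by have := Pos2Nat.is_pos p; lia.
Qed.

Lemma all_upto2 n m (P : positive -> pred positive) :
  all (fun p => all (P p) (upto m)) (upto n) ->
  forall p q, (Pos.to_nat p <= n)%N -> (Pos.to_nat q <= m)%N -> P p q.
Proof.
move=> h p q hp hq; exact: (all_upto (all_upto h hp) hq).
Qed.

(** Structure constants are kept in tries over binary indices, normalised once where a table is
    defined; the later finite checks only look them up. *)
Definition tab (A : Type) (f : positive -> A) (n : nat) : PositiveMap.t A :=
  foldr (fun p t => PositiveMap.add p (f p) t) (PositiveMap.empty A) (upto n).

Lemma find_tab (A : Type) (f : positive -> A) n p :
  PositiveMap.find p (tab f n) = if (Pos.to_nat p <= n)%N then Some (f p) else None.
Proof.
rewrite /tab /upto.
have -> : (Pos.to_nat p <= n)%N = (Pos.to_nat p \in iota 1 n).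
  by rewrite mem_iota; have := Pos2Nat.is_pos p; lia.
have : forall i, i \in iota 1 n -> (0 < i)%N by move=> i; rewrite mem_iota => /andP[].
elim: (iota 1 n) => [|i l IH] hl /=; first by rewrite PositiveMap.gempty.
have i0 : (0 < i)%N by apply: hl; rewrite mem_head.
have [e|ne] := eqVneq (Pos.to_nat p) i.
  by rewrite in_cons -e eqxx /= Pos2Nat.id PositiveMap.gss.
rewrite in_cons (negPf ne) /= PositiveMap.gso.
  by apply: IH => j hj; apply: hl; rewrite in_cons hj orbT.
by move=> e; move: ne; rewrite e Nat2Pos.id ?eqxx // => i00; rewrite i00 in i0.
Qed.

Definition look (T : PositiveMap.t sv) (p : positive) : sv :=
  if PositiveMap.find p T is Some l then l else [::].

Definition look2 (T : PositiveMap.t (PositiveMap.t sv)) (p q : positive) : sv :=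
  if PositiveMap.find p T is Some r then look r q else [::].

Definition tab2 (f : positive -> positive -> sv) (n m : nat) :=
  tab (fun p => tab (f p) m) n.

Lemma look_tab f n p : look (tab f n) p = if (Pos.to_nat p <= n)%N then f p else [::].
Proof. by rewrite /look find_tab; case: ifP. Qed.

Lemma look2_tab f n m p q : look2 (tab2 f n m) p q =
  if (Pos.to_nat p <= n)%N && (Pos.to_nat q <= m)%N then f p q else [::].
Proof.
by rewrite /look2 find_tab; case: ifP => //= _; rewrite look_tab.
Qed.

Variable K : numFieldType.

Definition zK (z : Z) : K := (int_of_Z z)%:~R.

Lemma zKD a b : zK (Z.add a b) = zK a + zK b.
Proof. by rewrite /zK (rmorphD int_of_Z) rmorphD. Qed.
Lemma zKM a b : zK (Z.mul a b) = zK a * zK b.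
Proof. by rewrite /zK (rmorphM int_of_Z) rmorphM. Qed.
Lemma zK0 : zK 0 = 0. Proof. by []. Qed.
Lemma zK1 : zK 1 = 1. Proof. by []. Qed.
Lemma zKN1 : zK (Zneg 1) = -1. Proof. by []. Qed.
Lemma zK_eq0 a : (zK a == 0) = Z.eqb a 0.
Proof. by rewrite /zK intr_eq0; case: Z.eqb_spec; lia. Qed.

Section Eval.
Variables (V : lmodType K) (b : positive -> V).

Definition ev (l : sv) : V := foldr (fun kc v => zK kc.2 *: b kc.1 + v) 0 l.

Lemma ev_nil : ev [::] = 0. Proof. by []. Qed.
Lemma ev1 k : ev [:: (k, Zpos 1)] = b k.
Proof. by rewrite /ev /= addr0 zK1 scale1r. Qed.

Lemma ev_addk k c l : ev (addk k c l) = zK c *: b k + ev l.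
Proof.
elim: l => [|[k' c'] l IH] /=.
  by case: Z.eqb_spec => [->|_] //=; rewrite zK0 scale0r addr0.
case: Pos.compare_spec => [->|_|_] /=.
- case: Z.eqb_spec => [e|_] /=.
    by rewrite addrA -scalerDl -zKD e zK0 scale0r add0r.
  by rewrite zKD scalerDl addrA.
- by case: Z.eqb_spec => [->|_] //=; rewrite zK0 scale0r add0r.
- by rewrite IH addrCA.
Qed.

Lemma ev_axpy a l r : ev (axpy a l r) = zK a *: ev l + ev r.
Proof.
elim: l => [|[k c] l IH] /=; first by rewrite scaler0 add0r.
by rewrite ev_addk IH zKM scalerDr scalerA addrA.
Qed.

(** The passage from computation to algebra. The test is used in this direction only, so neither
    sortedness of the lists nor independence of [b] has to be established. *)
Lemma ev_eq l r : eqsv l r -> ev l = ev r.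
Proof.
rewrite /eqsv; case E: (axpy _ l r) => [|//] _.
have := ev_axpy (Zneg 1) l r; rewrite E ev_nil zKN1 scaleN1r => /esym/eqP.
by rewrite addrC subr_eq0 => /eqP.
Qed.

End Eval.

(** A linear map known on the family [b] through a table is computed on all combinations by [bind].
    With its bilinear form [ev_bind2], this carries each table over to the operation that it
    describes. *)
Lemma ev_bind (U V : lmodType K) (b : positive -> U) (b' : positive -> V)
    (F : U -> V) (f : positive -> sv) l :
  linear F -> (forall p, F (b p) = ev b' (f p)) ->
  F (ev b l) = ev b' (bind f l).
Proof.
move=> lF hF; elim: l => [|[k c] l IH] /=.
  have := lF (-1) 0 0; rewrite scaler0 addr0 => e.
  by rewrite e scaleN1r addNr.
by rewrite lF IH hF ev_axpy.
Qed.

Lemma ev_bind2 (U1 U2 V : lmodType K) (b1 : positive -> U1) (b2 : positive -> U2)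
    (b' : positive -> V) (F : U1 -> U2 -> V) f x y :
  (forall u, linear (F u)) -> (forall u, linear (F^~ u)) ->
  (forall p q, F (b1 p) (b2 q) = ev b' (f p q)) ->
  F (ev b1 x) (ev b2 y) = ev b' (bind2 f x y).
Proof.
move=> l1 l2 h; rewrite /bind2.
apply: (@ev_bind _ _ _ _ (F^~ (ev b2 y))) => [a u v|p]; first exact: l2.
by apply: ev_bind => [a u v|q]; [exact: l1|exact: h].
Qed.

End SparseVectors.

(** * The Jordan algebra and its derivations *)

Section OctonionTables.

(** Each line of [fano] satisfies i xor j = k, so the product of two octonion units is, up to the
    sign [osgn], the unit whose index is the xor. *)
Definition oxor (i j : nat) : nat := Nat.lxor i j.

Definition zb (b : bool) : Z := if b then Zpos 1 else Z0.

Definition octZ (i j k : nat) : Z :=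
  if (i == 0)%N then zb (j == k)
  else if (j == 0)%N then zb (i == k)
  else if (i == j)%N then Z.opp (zb (k == 0)%N)
  else Z.sub (zb (on_fano i j k)) (zb (on_fano j i k)).

Definition osgn (i j : nat) : Z := octZ i j (oxor i j).

Definition csgn (i : nat) : Z := if (i == 0)%N then Zpos 1 else Zneg 1.

Lemma octZ_check :
  all (fun i => all (fun j => (oxor i j < 8)%N &&
    all (fun k => Z.eqb (octZ i j k) (if k == oxor i j then osgn i j else Z0))
    (iota 0 8)) (iota 0 8)) (iota 0 8).
Proof. by vm_compute. Qed.

Lemma octZ_osgn i j : (i < 8)%N -> (j < 8)%N -> (oxor i j < 8)%N /\
  forall k, (k < 8)%N -> octZ i j k = if k == oxor i j then osgn i j else Z0.
Proof.
move=> hi hj; have /allP/(_ i) := octZ_check; rewrite mem_iota => /(_ hi).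
move=> /allP/(_ j); rewrite mem_iota => /(_ hj) /andP[hx /allP hk]; split=> // k k8.
by have := hk k; rewrite mem_iota => /(_ k8) /Z.eqb_spec.
Qed.

Variable K : numFieldType.
Local Notation zK := (zK K).

Lemma oct_coefE (i j k : 'I_8) : oct_coef K i j k = zK (octZ i j k).
Proof.
rewrite /oct_coef /octZ -!(inj_eq val_inj) /=.
case: ifP => _; first by case: eqP.
case: ifP => _; first by case: eqP.
case: ifP => _; first by case: eqP; rewrite ?oppr0.
by case: (on_fano i j k); case: (on_fano j i k); rewrite /= ?subr0 ?sub0r ?subrr.
Qed.

Lemma omul_oe i j : (i < 8)%N -> (j < 8)%N ->
  omul (oe K i) (oe K j) = zK (osgn i j) *: oe K (oxor i j).
Proof.
move=> hi hj; have [hx hk] := octZ_osgn hi hj.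
apply/rowP => k; rewrite !mxE (bigD1 (inord i)) //= [X in _ + X]big1 ?addr0.
  rewrite (bigD1 (inord j)) //= [X in _ + X]big1 ?addr0.
    rewrite !mxE !eqxx mulr1 mulr1 oct_coefE !inordK // hk //.
    rewrite -(inj_eq val_inj) /= inordK //.
    by case: ifP => _; rewrite ?mulr1 ?mulr0.
  by move=> l ne; rewrite !mxE (negPf ne) /= mulr0 mulr0.
move=> l ne; rewrite big1 // => m _.
by rewrite !mxE (negPf ne) /= mul0r mulr0.
Qed.

Lemma oconj_oe i : (i < 8)%N -> oconj (oe K i) = zK (csgn i) *: oe K i.
Proof.
move=> hi; apply/rowP => k; rewrite !mxE /= /csgn.
rewrite -!(inj_eq val_inj) /= inordK //.
case: eqP => [->|/eqP ne].
  by case: eqP => [<-|/eqP]; rewrite ?mul1r // eq_sym => /negPf->; rewrite mulr0.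
by case: (boolP (_ == i)) => [/eqP<-|_]; rewrite ?(negPf ne) ?mulr0 ?oppr0 // mulr1.
Qed.

Lemma inord0 : inord 0 = 0 :> 'I_8.
Proof. by apply: val_inj; rewrite /= inordK. Qed.

Lemma omul_oe0 x : omul (oe K 0) x = x.
Proof.
apply/rowP => k; rewrite !mxE /oe inord0 (bigD1 0) //= [X in _ + X]big1 ?addr0.
  rewrite (bigD1 k) //= [X in _ + X]big1 ?addr0.
    by rewrite !mxE /oct_coef !eqxx /= !mul1r.
  by move=> l ne; rewrite /oct_coef eqxx (negPf ne) mul0r.
by move=> l ne; rewrite big1 // => m _; rewrite !mxE (negPf ne) /= mul0r mulr0.
Qed.

Lemma omul_x_oe0 x : omul x (oe K 0) = x.
Proof.
apply/rowP => k; rewrite !mxE /oe inord0 (bigD1 k) //= [X in _ + X]big1 ?addr0.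
  rewrite (bigD1 0) //= [X in _ + X]big1 ?addr0.
    rewrite !mxE /oct_coef !eqxx /= mulr1.
    by case: eqP => [->|_]; rewrite ?eqxx mul1r.
  by move=> l ne; rewrite !mxE (negPf ne) /= mulr0 mulr0.
move=> l ne; rewrite (bigD1 0) //= [X in _ + X]big1 ?addr0.
  rewrite /oct_coef eqxx (negPf ne); case: eqP => [e|_]; last by rewrite mul0r.
  by move: ne; rewrite e eq_sym => /negPf->; rewrite mul0r.
by move=> m nm; rewrite !mxE (negPf nm) /= mulr0 mulr0.
Qed.

End OctonionTables.

Section JordanTables.
Variable K : numFieldType.
Local Notation zK := (zK K).
Local Notation jordan := (jordan K).
Implicit Types X Y : jordan.

Lemma I3_ind (P : 'I_3 -> Prop) : P 0 -> P 1 -> P (1 + 1) -> forall k, P k.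
Proof.
move=> h0 h1 h2 [[|[|[|//]]] hk].
- by rewrite (_ : Ordinal hk = 0) //; apply: val_inj.
- by rewrite (_ : Ordinal hk = 1) //; apply: val_inj.
- by rewrite (_ : Ordinal hk = 1 + 1) //; apply: val_inj.
Qed.

Lemma jentry_diag X k : jentry X k k = X.1 0 k *: oe K 0.
Proof. by rewrite /jentry eqxx. Qed.

Lemma jentry_up X k : jentry X k (k + 1) = row (k + 1 + 1) X.2.
Proof.
rewrite /jentry eqxx.
have -> : (k == k + 1) = false by elim/I3_ind: k.
by congr (row _ _); elim/I3_ind: k; apply: val_inj.
Qed.

Lemma jentry_dn X k : jentry X (k + 1) k = oconj (row (k + 1 + 1) X.2).
Proof.
rewrite /jentry.
have -> : (k + 1 == k) = false by elim/I3_ind: k.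
have -> : (k == k + 1 + 1) = false by elim/I3_ind: k.
by congr (oconj (row _ _)); elim/I3_ind: k; apply: val_inj.
Qed.

Lemma I3K (k : 'I_3) : k + 1 + 1 + 1 = k.
Proof. by elim/I3_ind: k; apply: val_inj. Qed.

(** The sum starts at an arbitrary [k] because entries are described relative to a position, by
    [jentry_diag], [jentry_up] and [jentry_dn]. *)
Lemma sum_I3 (V : nmodType) (F : 'I_3 -> V) k :
  \sum_l F l = F k + F (k + 1) + F (k + 1 + 1).
Proof.
have E : \sum_l F l = F 0 + F 1 + F (1 + 1).
  rewrite !big_ord_recl big_ord0 addr0 addrA.
  by congr (F _ + F _ + F _); apply: val_inj.
elim/I3_ind: k; rewrite E ?add0r //.
  by rewrite [RHS]addrC addrA; congr (F _ + _ + _); apply: val_inj.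
by rewrite -[RHS]addrA [RHS]addrC; congr (F _ + F _ + _); apply: val_inj.
Qed.

(** The entry x_k sits at position (k + 1, k + 2). Of the three terms of the matrix product there,
    one multiplies two off-diagonal entries, and in the other two a factor is a diagonal scalar. *)
Lemma jmul_off X Y k l : (2 *: jmul X Y).2 k l =
  (omul (oconj (row (k + 1 + 1) X.2)) (oconj (row (k + 1) Y.2))
   + omul (oconj (row (k + 1 + 1) Y.2)) (oconj (row (k + 1) X.2))) 0 l
  + (X.1 0 (k + 1) + X.1 0 (k + 1 + 1)) * Y.2 k l
  + (Y.1 0 (k + 1) + Y.1 0 (k + 1 + 1)) * X.2 k l.
Proof.
rewrite jmul.unlock scalerA divff ?pnatr_eq0 // scale1r /of_jmx mxE.
have -> : k + 2 = k + 1 + 1 :> 'I_3 by elim/I3_ind: k; apply: val_inj.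
have omulZl (x y : 'rV[K]_8) a : omul (a *: x) y = a *: omul x y.
  by have := omul_linear_l y a x 0; rewrite !addr0 => ->;
     rewrite (_ : omul 0 y = 0) ?addr0 //;
     have := omul_linear_l y (-1) 0 0; rewrite scaler0 addr0 scaleN1r addNr.
have omulZr (x y : 'rV[K]_8) a : omul x (a *: y) = a *: omul x y.
  by have := omul_linear_r x a y 0; rewrite !addr0 => ->;
     rewrite (_ : omul x 0 = 0) ?addr0 //;
     have := omul_linear_r x (-1) 0 0; rewrite scaler0 addr0 scaleN1r addNr.
have E X' Y' : octmx_mul (jmx X') (jmx Y') (k + 1) (k + 1 + 1) =
  omul (oconj (row (k + 1 + 1) X'.2)) (oconj (row (k + 1) Y'.2))
  + X'.1 0 (k + 1) *: row k Y'.2 + Y'.1 0 (k + 1 + 1) *: row k X'.2.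
  rewrite mxE (sum_I3 _ k) !mxE; congr (_ + _ + _).
  - rewrite jentry_dn -[X in jentry _ X _]I3K jentry_dn I3K.
    by [].
  - by rewrite jentry_diag jentry_up I3K omulZl omul_oe0.
  - by rewrite jentry_diag jentry_up I3K omulZr omul_x_oe0.
rewrite mxE [in LHS]mxE !E !mxE.
set p := \sum_i _; set q := \sum_i _.
ring.
Qed.

Lemma jmul_diag X Y k : (2 *: jmul X Y).1 0 k =
  2 * (X.1 0 k * Y.1 0 k)
  + (omul (row (k + 1 + 1) X.2) (oconj (row (k + 1 + 1) Y.2))
   + omul (row (k + 1 + 1) Y.2) (oconj (row (k + 1 + 1) X.2))) 0 0
  + (omul (oconj (row (k + 1) X.2)) (row (k + 1) Y.2)
   + omul (oconj (row (k + 1) Y.2)) (row (k + 1) X.2)) 0 0.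
Proof.
rewrite jmul.unlock scalerA divff ?pnatr_eq0 // scale1r /of_jmx mxE.
have omulZl (x y : 'rV[K]_8) a : omul (a *: x) y = a *: omul x y.
  by have := omul_linear_l y a x 0; rewrite !addr0 => ->;
     rewrite (_ : omul 0 y = 0) ?addr0 //;
     have := omul_linear_l y (-1) 0 0; rewrite scaler0 addr0 scaleN1r addNr.
have E X' Y' : octmx_mul (jmx X') (jmx Y') k k =
  (X'.1 0 k * Y'.1 0 k) *: oe K 0
  + omul (row (k + 1 + 1) X'.2) (oconj (row (k + 1 + 1) Y'.2))
  + omul (oconj (row (k + 1) X'.2)) (row (k + 1) Y'.2).
  rewrite mxE (sum_I3 _ k) !mxE; congr (_ + _ + _).
  - by rewrite !jentry_diag omulZl omul_oe0 scalerA.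
  - by rewrite jentry_dn jentry_up.
  - rewrite -[X in jentry _ X (k + 1 + 1)]I3K jentry_dn I3K.
    by rewrite -[X in jentry _ (k + 1 + 1) X]I3K jentry_up I3K.
have DE (A B : 'rV[K]_8) : (A + B) 0 0 = A 0 0 + B 0 0 by rewrite mxE.
have ZE a : (a *: oe K 0) 0 0 = a by rewrite mxE /oe inord0 mxE !eqxx mulr1.
rewrite mxE !E !DE !ZE; ring.
Qed.

End JordanTables.

Section JordanBasis.
Variable K : numFieldType.
Local Notation zK := (zK K).
Local Notation jordan := (jordan K).
Local Notation oe := (oe K).
Implicit Types X Y : jordan.

Lemma linear_0 (U V : lmodType K) (f : U -> V) : linear f -> f 0 = 0.
Proof.
by move=> lf; have := lf (-1) 0 0; rewrite scaler0 addr0 scaleN1r addNr.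
Qed.

Lemma linear_Z (U V : lmodType K) (f : U -> V) a x : linear f -> f (a *: x) = a *: f x.
Proof. by move=> lf; have := lf a x 0; rewrite !addr0 (linear_0 lf) addr0. Qed.

Lemma linear_D (U V : lmodType K) (f : U -> V) x y : linear f -> f (x + y) = f x + f y.
Proof. by move=> lf; have := lf 1 x y; rewrite !scale1r. Qed.

Lemma omul0l (x : 'rV[K]_8) : omul 0 x = 0.
Proof. exact: (linear_0 (omul_linear_l x)). Qed.
Lemma omul0r (x : 'rV[K]_8) : omul x 0 = 0.
Proof. exact: (linear_0 (omul_linear_r x)). Qed.
Lemma oconj0 : oconj (0 : 'rV[K]_8) = 0.
Proof. exact: (linear_0 (@oconj_linear K)). Qed.

Lemma jordan_eq X Y :
  (forall k, X.1 0 k = Y.1 0 k) -> (forall k l, X.2 k l = Y.2 k l) -> X = Y.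
Proof.
case: X Y => [x1 x2] [y1 y2] /= h1 h2; congr pair; last exact/matrixP.
by apply/rowP.
Qed.

Lemma row_jE i k : row k (jE K i).2 = 0.
Proof. by apply/rowP => l; rewrite !mxE. Qed.

Lemma row_jF i (x : 'rV[K]_8) k : row k (jF i x).2 = if k == i then x else 0.
Proof. by apply/rowP => l; rewrite !mxE; case: ifP => // _; rewrite mxE. Qed.

Lemma jF_1 i (x : 'rV[K]_8) k : (jF i x).1 0 k = 0.
Proof. by rewrite mxE. Qed.

Lemma jF_2 i (x : 'rV[K]_8) k l : (jF i x).2 k l = if k == i then x 0 l else 0.
Proof. by rewrite mxE; case: ifP => // _; rewrite mxE. Qed.

Lemma jE_1 i k : (jE K i).1 0 k = (k == i)%:R.
Proof. by rewrite mxE eqxx. Qed.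

Lemma jE_2 i k l : (jE K i).2 k l = 0.
Proof. by rewrite mxE. Qed.

Lemma jZ_1 a X k : (a *: X).1 0 k = a * X.1 0 k. Proof. by rewrite mxE. Qed.
Lemma jZ_2 a X k l : (a *: X).2 k l = a * X.2 k l. Proof. by rewrite mxE. Qed.
Lemma jD_1 X Y k : (X + Y).1 0 k = X.1 0 k + Y.1 0 k. Proof. by rewrite mxE. Qed.
Lemma jD_2 X Y k l : (X + Y).2 k l = X.2 k l + Y.2 k l. Proof. by rewrite mxE. Qed.
Lemma j0_1 k : (0 : jordan).1 0 k = 0. Proof. by rewrite mxE. Qed.
Lemma j0_2 k l : (0 : jordan).2 k l = 0. Proof. by rewrite mxE. Qed.
Lemma rV0 (l : 'I_8) : (0 : 'rV[K]_8) 0 l = 0. Proof. by rewrite mxE. Qed.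
Lemma rVZ a (x : 'rV[K]_8) l : (a *: x) 0 l = a * x 0 l. Proof. by rewrite mxE. Qed.
Lemma rVD (x y : 'rV[K]_8) l : (x + y) 0 l = x 0 l + y 0 l. Proof. by rewrite mxE. Qed.

Definition jcoord := (jE_1, jE_2, jF_1, jF_2, row_jE, row_jF, jZ_1, jZ_2, jD_1, jD_2,
  j0_1, j0_2, omul0l, omul0r, oconj0, rV0, rVD).

Definition jcoordE := (jE_1, jE_2, row_jE, jZ_1, jZ_2, jD_1, jD_2, j0_1, j0_2,
  omul0l, omul0r, oconj0, rV0, rVD).

Lemma jmul_EE i j :
  2 *: jmul (jE K i) (jE K j) = if i == j then 2 *: jE K i else 0.
Proof.
apply: jordan_eq => [k|k l]; rewrite ?jmul_diag ?jmul_off; case: eqP => [->|ne];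
  rewrite !jcoordE ?oconj0 ?omul0l ?rV0 ?addr0 ?mulr0 ?mul0r ?addr0 //.
  by case: (k == j); rewrite ?mulr1 ?mulr0.
case: eqP => [->|_]; last by rewrite mul0r mulr0.
by rewrite (introF eqP ne) mulr0 mulr0.
Qed.

Lemma jmul_EF i k (x : 'rV[K]_8) :
  2 *: jmul (jE K i) (jF k x) = if i == k then 0 else jF k x.
Proof.
apply: jordan_eq => [m|m l]; rewrite ?jmul_diag ?jmul_off; case: eqP => ne;
  rewrite !jcoord ?oconj0 ?omul0l ?omul0r ?rV0 ?addr0 ?mulr0 ?mul0r ?addr0 //.
  case: (eqVneq m k) => [->|_]; last by rewrite mulr0 addr0.
  by rewrite ne; elim/I3_ind: k {ne} => /=; rewrite addr0 mul0r addr0.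
case: (eqVneq m k) => [->|_]; last by rewrite mulr0 addr0.
by move: ne; elim/I3_ind: i => ne; elim/I3_ind: k ne => ne;
 rewrite /= ?addr0 ?add0r ?mul1r //; case: ne.
Qed.

Lemma jmul_FF_same k i j : (i < 8)%N -> (j < 8)%N ->
  2 *: jmul (jF k (oe i)) (jF k (oe j)) =
  if i == j then 2 *: jE K (k + 1) + 2 *: jE K (k + 1 + 1) else 0.
Proof.
move=> hi hj.
have c2 : (omul (oe i) (oconj (oe j)) + omul (oe j) (oconj (oe i))) 0 0 = 2 *+ (i == j)
   /\ (omul (oconj (oe i)) (oe j) + omul (oconj (oe j)) (oe i)) 0 0 = 2 *+ (i == j).
  rewrite !oconj_oe // !(linear_Z _ _ (omul_linear_l _)) !(linear_Z _ _ (omul_linear_r _)).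
  rewrite !omul_oe // !mxE -!(inj_eq val_inj) /= !inordK; last first.
  - by have [] := octZ_osgn hi hj.
  - by have [] := octZ_osgn hj hi.
  rewrite !mulrA -!zKM.
  have : all (fun i => all (fun j =>
      (Z.eqb (Z.add (Z.mul (Z.mul (csgn j) (osgn i j)) (zb (0 == oxor i j)%N))
       (Z.mul (Z.mul (csgn i) (osgn j i)) (zb (0 == oxor j i)%N))) (Z.mul (Zpos 2) (zb (i == j)))) &&
      (Z.eqb (Z.add (Z.mul (Z.mul (csgn i) (osgn i j)) (zb (0 == oxor i j)%N))
       (Z.mul (Z.mul (csgn j) (osgn j i)) (zb (0 == oxor j i)%N))) (Z.mul (Zpos 2) (zb (i == j)))))
      (iota 0 8)) (iota 0 8) by vm_compute.
  move=> /allP/(_ i); rewrite mem_iota => /(_ hi) /allP/(_ j).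
  rewrite mem_iota => /(_ hj) /andP[/Z.eqb_spec h1 /Z.eqb_spec h2].
  have zbE (b : bool) : b%:R = zK (zb b) by case: b.
  split; rewrite !zbE -!zKM -zKD ?h1 ?h2 zKM -zbE.
    by case: (i == j); rewrite ?mulr1 ?mulr0.
  by case: (i == j); rewrite ?mulr1 ?mulr0.
case: c2 => c1 c2; rewrite rVD in c1; rewrite rVD in c2.
apply: jordan_eq => [m|m l]; rewrite ?jmul_diag ?jmul_off.
  rewrite !jcoord ?mulr0 ?add0r.
  elim/I3_ind: m; elim/I3_ind: k; rewrite /= ?oconj0 ?omul0l ?addr0 ?rV0 ?addr0 ?add0r ?c1 ?c2;
  by case: (i == j); rewrite ?jcoordE /= ?mulr0 ?mulr1 ?addr0 ?add0r.
rewrite !jcoord.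
have -> : (if i == j then 2 *: jE K (k + 1) + 2 *: jE K (k + 1 + 1) else 0).2 m l = 0.
  by case: ifP => _; rewrite !jcoord ?mulr0 ?addr0.
rewrite !addr0 !mul0r !addr0.
by elim/I3_ind: m; elim/I3_ind: k; rewrite /= ?(oconj0, omul0l, omul0r, rV0, addr0).
Qed.

Lemma jmul_FF_next k i j : (i < 8)%N -> (j < 8)%N ->
  2 *: jmul (jF k (oe i)) (jF (k + 1) (oe j)) =
  zK (Z.mul (Z.mul (csgn j) (csgn i)) (osgn j i)) *: jF (k + 1 + 1) (oe (oxor j i)).
Proof.
move=> hi hj.
have e : omul (oconj (oe j)) (oconj (oe i)) =
    zK (Z.mul (Z.mul (csgn j) (csgn i)) (osgn j i)) *: oe (oxor j i).
  rewrite !oconj_oe // !(linear_Z _ _ (omul_linear_l _)) !(linear_Z _ _ (omul_linear_r _)).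
  by rewrite omul_oe // !zKM !scalerA.
apply: jordan_eq => [m|m l]; rewrite ?jmul_diag ?jmul_off.
  rewrite !jcoord ?mulr0 ?add0r.
  by elim/I3_ind: m; elim/I3_ind: k; rewrite /= ?(oconj0, omul0l, omul0r, rV0, addr0).
rewrite !jcoord !addr0 !mul0r !addr0.
by elim/I3_ind: m; elim/I3_ind: k;
  rewrite /= ?e ?(oconj0, omul0l, omul0r, rV0, addr0, add0r, mulr0, rVZ).
Qed.

(** The value 0 beyond the range lets the product table hold for all indices, as in [jmul_bJ], with
    no side condition to carry. *)
Definition bJn (n : nat) : jordan :=
  if (n < 3)%N then jE K (inord n)
  else if (n < 27)%N then jF (inord ((n - 3) %/ 8)%N) (oe ((n - 3) %% 8)%N) else 0.

Definition bJ (p : positive) : jordan := bJn (Pos.to_nat p).-1.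

End JordanBasis.

Local Open Scope nat_scope.

(* Basis of J: E_1, E_2, E_3 have indices 1, 2, 3 and F_(k+1)(e_j) has index 4 + 8k + j. *)
Definition keyF (k j : nat) : positive := Pos.of_nat (4 + 8 * (k %% 3) + j).

Definition mulN (a b : nat) : sv :=
  if (a < 3) then
    if (b < 3) then
      if a == b then [:: (Pos.of_nat a.+1, Zpos 2)] else [::]
    else if a == (b - 3) %/ 8 then [::] else [:: (Pos.of_nat b.+1, Zpos 1)]
  else if (b < 3) then
    if b == (a - 3) %/ 8 then [::] else [:: (Pos.of_nat a.+1, Zpos 1)]
  else
    let k := (a - 3) %/ 8 in let i := (a - 3) %% 8 in
    let l := (b - 3) %/ 8 in let j := (b - 3) %% 8 in
    if k == l then
      if i == j then [:: (Pos.of_nat ((k + 1) %% 3).+1, Zpos 2);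
                         (Pos.of_nat ((k + 2) %% 3).+1, Zpos 2)] else [::]
    else if (k + 1) %% 3 == l then
      [:: (keyF (k + 2) (oxor j i), Z.mul (Z.mul (csgn j) (csgn i)) (osgn j i))]
    else [:: (keyF (k + 1) (oxor i j), Z.mul (Z.mul (csgn i) (csgn j)) (osgn i j))].

Local Open Scope ring_scope.

Definition TJ := Eval vm_compute in
  tab2 (fun p q => mulN (Pos.to_nat p).-1 (Pos.to_nat q).-1) 27 27.

Lemma TJE : TJ = tab2 (fun p q => mulN (Pos.to_nat p).-1 (Pos.to_nat q).-1) 27 27.
Proof. by vm_compute. Qed.

Definition mJ : positive -> positive -> sv := look2 TJ.

Section JordanTable.
Variable K : numFieldType.
Local Notation bJ := (bJ K).
Local Notation bJn := (bJn K).

Lemma bJ_succ n : bJ (Pos.of_nat n.+1) = bJn n.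
Proof. by rewrite /bJ Nat2Pos.id. Qed.

Lemma bJ_out p : (27 < Pos.to_nat p)%N -> bJ p = 0.
Proof. by move=> h; rewrite /bJ /bJn !ifF //; lia. Qed.

Lemma bJ_keyF k j : (j < 8)%N -> bJ (keyF k j) = jF (inord (k %% 3)%N) (oe K j).
Proof.
move=> hj; have hk := ltn_pmod k (isT : 0 < 3)%N.
have -> : keyF k j = Pos.of_nat ((k %% 3 * 8 + j) + 3).+1.
  by rewrite /keyF; congr Pos.of_nat; lia.
move: (k %% 3)%N hk => m hm; rewrite bJ_succ /bJn.
rewrite ifF; last lia.
rewrite ifT; last lia.
by rewrite addnK divnMDl // divn_small // addn0 modnMDl modn_small.
Qed.

Lemma inordS3 k : (k < 3)%N -> inord ((k + 1) %% 3)%N = inord k + 1 :> 'I_3.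
Proof. by case: k => [|[|[|//]]] _; apply: val_inj; rewrite /= !inordK. Qed.

Lemma bJn_E n : (n < 3)%N -> bJn n = jE K (inord n).
Proof. by rewrite /bJn => ->. Qed.

Lemma bJn_F n : (2 < n)%N -> (n < 27)%N ->
  bJn n = jF (inord ((n - 3) %/ 8)%N) (oe K ((n - 3) %% 8)%N).
Proof. by rewrite /bJn ltnNge => /negPf h ->; rewrite -ltnS in h; rewrite h. Qed.

Lemma jmul_bJn a b : (a < 27)%N -> (b < 27)%N ->
  2 *: jmul (bJn a) (bJn b) = ev bJ (mulN a b).
Proof.
move=> ha hb; rewrite /mulN.
have [a3|a3] := ltnP a 3; have [b3|b3] := ltnP b 3.
- rewrite !bJn_E // jmul_EE -(inj_eq val_inj) /= !inordK //.
  by case: ifP => _ //=; rewrite bJ_succ bJn_E // addr0.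
- rewrite (bJn_E a3) (bJn_F b3 hb) jmul_EF -(inj_eq val_inj) /=.
  rewrite !inordK //; last by rewrite ltn_divLR //; lia.
  by case: ifP => _ //=; rewrite addr0 scale1r bJ_succ bJn_F.
- rewrite jmulC (bJn_E b3) (bJn_F a3 ha) jmul_EF -(inj_eq val_inj) /=.
  rewrite !inordK //; last by rewrite ltn_divLR //; lia.
  by case: ifP => _ //=; rewrite addr0 scale1r bJ_succ bJn_F.
have hk : ((a - 3) %/ 8 < 3)%N by rewrite ltn_divLR //; lia.
have hl : ((b - 3) %/ 8 < 3)%N by rewrite ltn_divLR //; lia.
have hi := ltn_pmod (a - 3) (isT : 0 < 8)%N.
have hj := ltn_pmod (b - 3) (isT : 0 < 8)%N.
rewrite !bJn_F //.
move: ((a - 3) %/ 8)%N ((b - 3) %/ 8)%N ((a - 3) %% 8)%N ((b - 3) %% 8)%N hk hl hi hj.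
move=> k l i j hk hl hi hj {a b a3 b3 ha hb}.
have hE m : (m < 3)%N -> bJ (Pos.of_nat m.+1) = jE K (inord m).
  by move=> hm; rewrite bJ_succ bJn_E.
have h21 m : ((m + 2) %% 3 = (((m + 1) %% 3) + 1) %% 3)%N.
  by rewrite modnDml -addnA.
case: eqP => [<-|ne].
  rewrite jmul_FF_same //; case: ifP => _ //=.
  rewrite !hE ?ltn_pmod // h21 !inordS3 ?ltn_pmod // addr0.
  by congr (_ *: _ + _ *: _).
have hx := octZ_osgn hi hj; have hx' := octZ_osgn hj hi.
case: eqP => [e|ne2].
  rewrite -e inordS3 // jmul_FF_next //= bJ_keyF ?h21; last by case: hx'.
  by rewrite inordS3 ?ltn_pmod // inordS3 // addr0.
have e : k = ((l + 1) %% 3)%N.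
  by move: ne ne2 hk hl; case: k => [|[|[|//]]]; case: l => [|[|[|//]]].
have e' : ((k + 1) %% 3 = ((l + 1) %% 3 + 1) %% 3)%N by rewrite e.
rewrite jmulC e inordS3 // jmul_FF_next //= bJ_keyF; last by case: hx.
by rewrite -?e e' inordS3 ?ltn_pmod // inordS3 // addr0.
Qed.

Lemma jmul_bJ p q : 2 *: jmul (bJ p) (bJ q) = ev bJ (mJ p q).
Proof.
rewrite /mJ TJE look2_tab.
have [hp|hp] := leqP; last first.
  by rewrite bJ_out // jmulC (linear_0 (jmul_linear _)) scaler0.
have [hq|hq] /= := leqP; last by rewrite [bJ q]bJ_out // (linear_0 (jmul_linear _)) scaler0.
have := Pos2Nat.is_pos p; have := Pos2Nat.is_pos q => q0 p0.
by rewrite -jmul_bJn //; lia.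
Qed.

End JordanTable.

Arguments axpy : simpl never.

(** * Fraction-free Gaussian elimination on sparse vectors *)

Section Elimination.

(** The leading entry c of [v] is cancelled against a row with leading entry r by passing to r v - c
    row, so coefficients stay integral. Exhausted fuel leaves a vector unreduced, which can make a
    check fail but never wrongly succeed. *)
Fixpoint reduce (fuel : nat) (M : PositiveMap.t sv) (v : sv) : sv :=
  match fuel, v with
  | S f, (p, c) :: _ =>
    match PositiveMap.find p M with
    | Some (((q, r) :: _) as row) =>
      if Z.eqb r Z0 then v
      else reduce f M (axpy (Z.opp c) row (axpy r v [::]))
    | _ => v
    end
  | _, _ => v
  end.

Definition insert (fuel : nat) (M : PositiveMap.t sv) (v : sv) : PositiveMap.t sv :=
  match reduce fuel M v with
  | [::] => M
  | ((p, _) :: _) as w => PositiveMap.add p w M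
  end.

Definition echelon (fuel : nat) (rows : seq sv) : PositiveMap.t sv :=
  foldl (insert fuel) (PositiveMap.empty sv) rows.

Variables (K : numFieldType) (V : lmodType K) (b : positive -> V) (P : V -> Prop).
Hypotheses (P0 : P 0) (PL : forall a u v, P u -> P v -> P (a *: u + v)).

Let okM (M : PositiveMap.t sv) :=
  forall p row, PositiveMap.find p M = Some row -> P (ev b row).

Lemma reduce_sound fuel M v : okM M ->
  (P (ev b v) -> P (ev b (reduce fuel M v))) /\
  (P (ev b (reduce fuel M v)) -> P (ev b v)).
Proof.
move=> hM; elim: fuel v => [|f IH] [|[p c] v] //=.
case E: (PositiveMap.find p M) => [[|[q r] row]|] //.
case: Z.eqb_spec => // r0.
have := IH (axpy (Z.opp c) ((q, r) :: row) (axpy r ((p, c) :: v) [::])).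
rewrite !ev_axpy ev_nil addr0; set w := ev b ((p, c) :: v) => -[h1 h2].
have hr := hM _ _ E; split => [hw|h].
  apply: h1; apply: PL => //.
  by have := PL (zK K r) hw P0; rewrite addr0.
have := PL (zK K c) hr (h2 h).
rewrite addrA -scalerDl -zKD Z.add_opp_diag_r zK0 scale0r add0r.
move=> /(PL (zK K r)^-1)/(_ P0); rewrite addr0 scalerA mulVf ?scale1r //.
by rewrite zK_eq0; apply/Z.eqb_spec.
Qed.

(** Membership in the span of the rows, phrased for an arbitrary subspace [P] containing them. Each
    reduction step is reversible over K, since the pivot r is invertible there; this is
    [reduce_sound]. *)
Lemma echelon_sound fuel rows v :
  (forall row, List.In row rows -> P (ev b row)) ->
  reduce fuel (echelon fuel rows) v = [::] -> P (ev b v).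
Proof.
move=> hrows hv.
suff hM : okM (echelon fuel rows).
  by apply/(reduce_sound fuel v hM).2; rewrite hv.
have : okM (PositiveMap.empty sv) by move=> p row; rewrite PositiveMap.gempty.
rewrite /echelon; elim: rows (PositiveMap.empty sv) hrows {hv} => //= r rows IH M hr hM.
apply: IH => [row h|]; first by apply: hr; right.
rewrite /insert; case E: (reduce fuel M r) => [//|[p c] w] q row.
have hP : P (ev b ((p, c) :: w)).
  by rewrite -E; apply/(reduce_sound fuel r hM).1; apply: hr; left.
have [->|ne] := Pos.eq_dec q p.
  by rewrite PositiveMap.gss => -[<-].
by rewrite PositiveMap.gso //; apply: hM.
Qed.

End Elimination.

(** Spanning is given the form of an induction principle, ready to be applied to any property stable
    under linear combinations. *)
Definition spans (K : numFieldType) (V : lmodType K) (b : positive -> V) : Prop :=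
  forall P : V -> Prop, P 0 -> (forall a u v, P u -> P v -> P (a *: u + v)) ->
  (forall p, P (b p)) -> forall v, P v.

Lemma spans_ext (K : numFieldType) (U V : lmodType K) (b : positive -> U)
    (f g : U -> V) :
  spans b -> linear f -> linear g -> (forall p, f (b p) = g (b p)) -> f =1 g.
Proof.
move=> sb lf lg h; apply: (sb (fun v => f v = g v)) => //.
  by rewrite !linear_0.
by move=> a u v eu ew; rewrite lf lg eu ew.
Qed.

Lemma closed_sum (K : numFieldType) (V : lmodType K) (P : V -> Prop) (I : Type)
    (r : seq I) (Q : pred I) (F : I -> V) :
  P 0 -> (forall a u v, P u -> P v -> P (a *: u + v)) ->
  (forall i, Q i -> P (F i)) -> P (\sum_(i <- r | Q i) F i).
Proof.
move=> P0 PL h; elim/big_rec: _ => // i x hi hx.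
by rewrite -[F i]scale1r; apply: PL => //; apply: h.
Qed.

Section JordanCoordinates.
Variable K : numFieldType.
Local Notation bJ := (bJ K).
Local Notation bJn := (bJn K).
Local Notation jordan := (jordan K).
Implicit Types X Y : jordan.

Lemma jordan_sum X : X = \sum_k X.1 0 k *: jE K k +
  \sum_k \sum_j X.2 k j *: jF k (oe K (j : 'I_8)).
Proof.
have s1 (I : finType) (F : I -> jordan) k l :
   ((\sum_i F i).1 0 k = \sum_i (F i).1 0 k) /\ ((\sum_i F i).2 k l = \sum_i (F i).2 k l).
  split.
    by apply: (big_morph (fun X : jordan => X.1 0 k)) => [u v|]; rewrite mxE.
  by apply: (big_morph (fun X : jordan => X.2 k l)) => [u v|]; rewrite mxE.
apply: jordan_eq => [k|k l].
  rewrite jD_1 !(s1 _ _ k 0).1 (bigD1 k) // jZ_1 jE_1 eqxx mulr1 !big1.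
  - by rewrite /= !addr0.
  - move=> i _; rewrite (s1 _ _ k 0).1 big1 // => j _.
    by rewrite jZ_1 jF_1 mulr0.
  - by move=> i /andP[_ ne]; rewrite jZ_1 jE_1 eq_sym (negPf ne) mulr0.
rewrite jD_2 !(s1 _ _ k l).2 big1 ?add0r; last first.
  by move=> i _; rewrite jZ_2 jE_2 mulr0.
rewrite (bigD1 k) // (s1 _ _ k l).2 (bigD1 l) // jZ_2 jF_2 eqxx.
rewrite /oe inord_val mxE !eqxx mulr1 !big1.
- by rewrite /= !addr0.
- move=> i /andP[_ ne]; rewrite (s1 _ _ k l).2 big1 // => j _.
  by rewrite jZ_2 jF_2 eq_sym (negPf ne) mulr0.
move=> j /andP[_ ne]; rewrite jZ_2 jF_2 eqxx inord_val mxE (eq_sym l) (negPf ne).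
by rewrite andbF mulr0.
Qed.

Lemma bJ_E (k : 'I_3) : jE K k = bJ (Pos.of_nat k.+1).
Proof. by rewrite bJ_succ bJn_E // inord_val. Qed.

Lemma bJ_F (k : 'I_3) (j : 'I_8) : jF k (oe K j) = bJ (keyF k j).
Proof. by rewrite bJ_keyF // modn_small // inord_val. Qed.

Lemma spans_bJ : spans bJ.
Proof.
move=> P P0 PL Pb X; rewrite (jordan_sum X) -[X in _ + X]addr0 addrA addr0.
have PD u v : P u -> P v -> P (u + v).
  by move=> hu hv; rewrite -[u]scale1r; apply: PL.
have PZ a u : P u -> P (a *: u) by move=> hu; rewrite -[_ *: _]addr0; apply: PL.
apply: PD; apply: closed_sum => // k _; first by apply: PZ; rewrite bJ_E.
by apply: closed_sum => // j _; apply: PZ; rewrite bJ_F.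
Qed.

Definition cJn (n : nat) X : K :=
  if (n < 3)%N then X.1 0 (inord n)
  else if (n < 27)%N then X.2 (inord ((n - 3) %/ 8)%N) (inord ((n - 3) %% 8)%N) else 0.

Definition cJ (p : positive) X : K := cJn (Pos.to_nat p).-1 X.

Lemma cJ_linear p : linear (cJ p : jordan -> K^o).
Proof.
by move=> a X Y; rewrite /cJ /cJn; case: ifP => _; [|case: ifP => _]; rewrite ?mxE //
  scaler0 addr0.
Qed.

Lemma cJn_bJn m n : (m < 27)%N -> (n < 27)%N -> cJn m (bJn n) = (m == n)%:R.
Proof.
move=> hm hn; rewrite /cJn hm; have [m3|m3] := ltnP m 3; have [n3|n3] := ltnP n 3.
- by rewrite bJn_E // jE_1 -(inj_eq val_inj) /= !inordK.
- by rewrite bJn_F // jF_1; case: eqP => // e; lia.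
- by rewrite bJn_E // jE_2; case: eqP => // e; lia.
rewrite bJn_F // jF_2 -(inj_eq val_inj) /= !inordK ?ltn_divLR //; try lia.
rewrite mxE eqxx -(inj_eq val_inj) /= !inordK ?ltn_pmod //.
have := divn_eq (m - 3) 8; have := divn_eq (n - 3) 8.
case: eqP => [e|ne]; last by case: eqP => // e; case: ne; rewrite e.
case: eqP => [e'|ne]; last by case: eqP => // e'; case: ne; rewrite e'.
by rewrite e e' => <- e2; rewrite (_ : m = n) ?eqxx //; lia.
Qed.

Lemma cJ_bJ p q : (Pos.to_nat p <= 27)%N -> (Pos.to_nat q <= 27)%N ->
  cJ p (bJ q) = (Pos.eqb p q)%:R.
Proof.
move=> hp hq; have := Pos2Nat.is_pos p; have := Pos2Nat.is_pos q => q0 p0.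
rewrite /cJ /bJ cJn_bJn; [congr (_%:R)|lia|lia].
case: Pos.eqb_spec => [->|ne]; first by rewrite eqxx.
by case: eqP => // e; case: ne; lia.
Qed.

Lemma jordan_coord X : X = \sum_(p <- upto 27) cJ p X *: bJ p.
Proof.
move: X; apply: (spans_ext spans_bJ) => [a X Y|a X Y|q] //.
  rewrite scaler_sumr -big_split /=; apply: eq_bigr => p _.
  by rewrite cJ_linear scalerDl scalerA.
have [hq|hq] := leqP (Pos.to_nat q) 27; last first.
  rewrite bJ_out // big1 // => p _.
  by rewrite (linear_0 (cJ_linear p)) scale0r.
rewrite /upto big_map -{1}[q]Pos2Nat.id; set n := Pos.to_nat q in hq *.
have n0 : (0 < n)%N by have := Pos2Nat.is_pos q; lia.
have toK i : (0 < i)%N -> Pos.to_nat (Pos.of_nat i) = i.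
  by move=> i0; rewrite Nat2Pos.id //; lia.
have nin : n \in iota 1 27 by rewrite mem_iota; lia.
rewrite (bigD1_seq n) ?iota_uniq // big1_seq.
  have -> : Pos.of_nat n = q by rewrite /n Pos2Nat.id.
  by rewrite cJ_bJ // Pos.eqb_refl scale1r; apply: esym; exact: addr0.
move=> i /andP[ne]; rewrite mem_iota => hi.
rewrite cJ_bJ ?Pos2Nat.id ?toK //; try lia.
case: Pos.eqb_spec => [e|_]; last by rewrite scale0r.
by move: ne; rewrite /n -e toK ?eqxx //; lia.
Qed.

Definition coef (k : positive) (l : sv) : Z :=
  foldr (fun kc s => if Pos.eqb k kc.1 then Z.add kc.2 s else s) Z0 l.

Lemma cJ_ev k l : (Pos.to_nat k <= 27)%N ->
  all (fun kc => Pos.leb kc.1 27) l -> cJ k (ev bJ l) = zK K (coef k l).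
Proof.
move=> hk; elim: l => [|[q c] l IH] /=; first by rewrite (linear_0 (cJ_linear k)).
move=> /andP[/Pos.leb_spec0 hq /IH e]; rewrite cJ_linear e /GRing.scale /=.
rewrite cJ_bJ //; last lia.
case: Pos.eqb_spec => _; first by rewrite mulr1 zKD.
by rewrite mulr0 add0r.
Qed.

End JordanCoordinates.

Definition mC (x y : sv) : sv := bind2 mJ x y.

Definition trC (x : sv) : Z :=
  foldr (fun kc s => if Pos.leb kc.1 3 then Z.add kc.2 s else s) Z0 x.

Definition formC (x y : sv) : Z := trC (mC x y).

Definition oneC : sv := [:: (1%positive, Zpos 1); (2%positive, Zpos 1); (3%positive, Zpos 1)].

Definition crossC (x y : sv) : sv :=
  axpy (Zpos 2) (mC x y) (axpy (Z.mul (Zneg 2) (trC x)) y (axpy (Z.mul (Zneg 2) (trC y)) x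
    (axpy (Z.sub (Z.mul (Zpos 2) (Z.mul (trC x) (trC y))) (formC x y)) oneC [::]))).

Lemma zKN (K : numFieldType) a : zK K (Z.opp a) = - zK K a.
Proof. by rewrite /zK (rmorphN int_of_Z) rmorphN. Qed.

Section JordanSparse.
Variable K : numFieldType.
Local Notation zK := (zK K).
Local Notation bJ := (bJ K).
Local Notation jordan := (jordan K).

Lemma jmul_linear_l (Y : jordan) : linear (fun X => jmul X Y).
Proof. by move=> a X Z; rewrite !(jmulC _ Y) jmul_linear. Qed.

Lemma jmul_ev x y : 2 *: jmul (ev bJ x) (ev bJ y) = ev bJ (mC x y).
Proof.
apply: (ev_bind2 (F := fun X Y : jordan => 2 *: jmul X Y)) => [u a X Y|u a X Y|p q].
- by rewrite jmul_linear scalerDr !scalerA mulrC.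
- by rewrite jmul_linear_l scalerDr !scalerA mulrC.
- exact: jmul_bJ.
Qed.

Lemma jtr_bJ p : jtr (bJ p) = (Pos.leb p 3)%:R.
Proof.
rewrite /jtr /bJ; case: Pos.leb_spec0 => hp.
  have hp' : ((Pos.to_nat p).-1 < 3)%N by lia.
  rewrite bJn_E // (bigD1 (inord (Pos.to_nat p).-1)) //= mxE !eqxx big1 ?addr0 //.
  by move=> i ne; rewrite mxE (negPf ne) andbF.
rewrite /bJn ifF; last lia.
by case: ifP => _; rewrite big1 // => i _; rewrite mxE.
Qed.

Lemma jtr_ev x : jtr (ev bJ x) = zK (trC x).
Proof.
elim: x => [|[k c] x IH] /=; first exact: (linear_0 (@jtr_linear K)).
rewrite jtr_linear jtr_bJ IH /GRing.scale /=; case: ifP => _.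
  by rewrite mulr1 zKD.
by rewrite mulr0 add0r.
Qed.

Lemma jform_ev x y : 2 * jform (ev bJ x) (ev bJ y) = zK (formC x y).
Proof.
rewrite /jform -jtr_ev -jmul_ev (linear_Z _ _ (@jtr_linear K)).
by rewrite /GRing.scale.
Qed.

Lemma jone_ev : jone K = ev bJ oneC.
Proof.
rewrite /oneC /= /bJ !bJn_E // !zK1 !scale1r addr0; apply: jordan_eq => [k|k l].
  rewrite !jD_1 !jE_1 mxE -!(inj_eq val_inj) /= !inordK //.
  by elim/I3_ind: k; rewrite /= ?addr0 ?add0r.
by rewrite !jD_2 !jE_2 !addr0.
Qed.

Lemma jcross_ev x y : 4 *: jcross (ev bJ x) (ev bJ y) = ev bJ (crossC x y).
Proof.
rewrite /crossC !ev_axpy ev_nil addr0 -jmul_ev -jone_ev !zKM.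
rewrite /Z.sub zKD !zKM zKN -jform_ev -!jtr_ev.
have -> : zK (Zneg 2) = -2 by [].
have -> : zK (Zpos 2) = 2 by [].
rewrite /jcross; move: (jmul _ _) (jform _ _) (jtr _) (jtr _) => m f t1 t2.
apply: jordan_eq => [k|k l]; rewrite !(jZ_1, jZ_2, jD_1, jD_2) ?mxE; by field.
Qed.

Lemma jform_linear_l (Y : jordan) : linear ((fun X => jform X Y) : jordan -> K^o).
Proof. by move=> a X Z; rewrite !(jformC _ Y) jform_linear. Qed.

End JordanSparse.

(* f4 has the basis 4 [b_p~, b_q~], (p, q) in dpairs, and a derivation D is determined by   *)
(* the coordinates of D b_p on b_q for these 52 pairs (see eqn_rows_full).                 *)
Definition dpairs : seq (positive * positive) := Eval vm_compute in
  [seq (1%positive, keyF 1 j) | j <- iota 0 8] ++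
  [seq (1%positive, keyF 2 j) | j <- iota 0 8] ++
  [seq (2%positive, keyF 0 j) | j <- iota 0 8] ++
  [seq (keyF 0 i, keyF 0 j) | i <- iota 0 8, j <- iota i.+1 (7 - i)].

Definition dpair (k : positive) : positive * positive :=
  nth (28%positive, 28%positive) dpairs (Pos.to_nat k).-1.

Definition dcol (a b j : positive) : sv :=
  axpy (Zneg 1) (bind (mJ b) (mJ a j)) (bind (mJ a) (mJ b j)).

Definition TD := Eval vm_compute in tab2 (fun k => dcol (dpair k).1 (dpair k).2) 52 27.

Lemma TDE : TD = tab2 (fun k => dcol (dpair k).1 (dpair k).2) 52 27.
Proof. by vm_compute. Qed.

Definition dC : positive -> positive -> sv := look2 TD.

Lemma dC_derivation : all (fun k => all (fun p => all (fun q =>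
  eqsv (bind (dC k) (mJ p q))
       (axpy (Zpos 1) (bind (mJ^~ q) (dC k p)) (bind (mJ p) (dC k q))))
  (upto 27)) (upto 27)) (upto 52).
Proof. by vm_compute. Qed.

Definition var (c r : positive) : positive := Pos.add (Pos.mul 27 c) r.

(* The coordinate of index k of the equation D (b_i o b_j) = D b_i o b_j + b_i o D b_j, in   *)
(* the unknown matrix of D, whose entry (c, r) has index var c r.                          *)
Definition eqn (i j k : positive) : sv :=
  axpy (Zpos 1) [seq (var lc.1 k, lc.2) | lc <- mJ i j]
    (axpy (Zneg 1) [seq (var i p, coef k (mJ p j)) | p <- upto 27]
      (axpy (Zneg 1) [seq (var j p, coef k (mJ i p)) | p <- upto 27] [::])).

(** A selection of products whose Leibniz rules already determine a derivation from its pivots: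
    those with E_1 and E_2, the square of E_3, those within F_1 and between F_1 and F_2, and those
    of F_2(e_0) with F_2. *)
Definition eqn_pairs : seq (positive * positive) := Eval vm_compute in
  [seq (1%positive, j) | j <- upto 27] ++ [seq (2%positive, j) | j <- upto 27] ++
  (3%positive, 3%positive) ::
  [seq (Pos.of_nat i, Pos.of_nat j) | i <- iota 4 9, j <- iota i (20 - i)].

Definition eqn_rows : seq sv :=
  [seq [:: (var pq.1 pq.2, Zpos 1)] | pq <- dpairs] ++
  flatten [seq [seq eqn pq.1 pq.2 k | k <- upto 27] | pq <- eqn_pairs].

(** The bound dim f4 <= 52, by elimination in the 729 entries of the matrix of a derivation: the
    Leibniz equations together with the vanishing of the 52 pivots force every entry to vanish. *)
Lemma eqn_rows_full :
  let M := echelon 100 eqn_rows in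
  all (fun c => all (fun r => nilp (reduce 100 M [:: (var c r, Zpos 1)])) (upto 27))
    (upto 27).
Proof. by vm_compute. Qed.

Lemma linear_lincomb (K : numFieldType) (U V : lmodType K) (I : Type) (r : seq I)
    (c : I -> K) (v : I -> U) (f : U -> V) :
  linear f -> f (\sum_(i <- r) c i *: v i) = \sum_(i <- r) c i *: f (v i).
Proof.
move=> lf; elim: r => [|i r IH]; first by rewrite !big_nil (linear_0 lf).
by rewrite !big_cons lf IH.
Qed.

Lemma all_In (T : Type) (P : pred T) (x : T) s : all P s -> List.In x s -> P x.
Proof. by elim: s => //= y s IH /andP[h /IH h'] [<-|]. Qed.

Lemma In_nth (T : Type) (d x : T) s : List.In x s ->
  exists2 i, (i < size s)%N & nth d s i = x.
Proof.
elim: s => //= y s IH [<-|/IH[i hi <-]]; first by exists 0%N.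
by exists i.+1.
Qed.

Lemma In_upto n k : List.In k (upto n) -> (Pos.to_nat k <= n)%N.
Proof.
rewrite /upto => h.
have : forall i, i \in iota 1 n -> (Pos.to_nat (Pos.of_nat i) <= n)%N.
  by move=> i; rewrite mem_iota => hi; rewrite Nat2Pos.id //; lia.
elim: (iota 1 n) h => //= i l IH [<- h|h h']; first by apply: h; rewrite mem_head.
by apply: IH => // j hj; apply: h'; rewrite in_cons hj orbT.
Qed.

Lemma eq_big_upto (V : nmodType) n (F G : positive -> V) :
  (forall p, (Pos.to_nat p <= n)%N -> F p = G p) ->
  \sum_(p <- upto n) F p = \sum_(p <- upto n) G p.
Proof.
move=> h; have : forall p, List.In p (upto n) -> F p = G p by move=> p /In_upto/h.
by elim: (upto n) => [|p l IH] h'; rewrite ?big_nil // !big_cons h' ?IH //=;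
  [move=> q hq; apply: h'; right|left].
Qed.

Lemma In_cat (T : Type) (x : T) (s t : seq T) :
  List.In x (s ++ t) -> List.In x s \/ List.In x t.
Proof.
elim: s => [|y s IH] /=; first by right.
by case=> [<-|/IH[h|h]]; [left; left|left; right|right].
Qed.

Lemma In_map (S T : Type) (f : S -> T) (y : T) (s : seq S) :
  List.In y (map f s) -> exists x, f x = y /\ List.In x s.
Proof.
elim: s => //= x s IH [<-|/IH[x' [h1 h2]]]; first by exists x; split=> //; left.
by exists x'; split=> //; right.
Qed.

Lemma In_flatten (T : Type) (x : T) (ss : seq (seq T)) :
  List.In x (flatten ss) -> exists s, List.In s ss /\ List.In x s.
Proof.
elim: ss => //= s ss IH h; case: (In_cat h) => [{}h|/IH[s' [h1 h2]]].
  by exists s; split=> //; left.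
by exists s'; split=> //; right.
Qed.

Lemma sum_upto_delta (V : nmodType) n k (x : V) : (Pos.to_nat k <= n)%N ->
  \sum_(p <- upto n) (if Pos.eqb k p then x else 0) = x.
Proof.
move=> hk; have k0 := Pos2Nat.is_pos k.
have kin : Pos.to_nat k \in iota 1 n by rewrite mem_iota; lia.
rewrite /upto big_map (bigD1_seq (Pos.to_nat k)) ?iota_uniq //=.
rewrite Pos2Nat.id Pos.eqb_refl big1_seq ?addr0 // => i /andP[ne].
rewrite mem_iota => hi; case: Pos.eqb_spec => // e.
by move: ne; rewrite e Nat2Pos.id ?eqxx //; lia.
Qed.

(** * The derivation algebra f4 and its basis *)

Section Derivations.
Variable K : numFieldType.
Local Notation zK := (zK K).
Local Notation bJ := (bJ K).
Local Notation jordan := (jordan K).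
Implicit Types (D : 'End(jordan)) (X Y : jordan).

Definition dK (k : positive) : 'End(jordan) :=
  if Pos.leb k 52 then
    4 *: jbracket (jtilde (bJ (dpair k).1)) (jtilde (bJ (dpair k).2))
  else 0.

Lemma jbracketE (f g : 'End(jordan)) X : jbracket f g X = f (g X) - g (f X).
Proof.
by rewrite /jbracket add_lfunE opp_lfunE !comp_lfunE.
Qed.

Lemma End_linear (U V : vectType K) (f : 'Hom(U, V)) : linear f.
Proof. by move=> a u v; rewrite linearP. Qed.

Lemma jmul_bind a l : 2 *: jmul (bJ a) (ev bJ l) = ev bJ (bind (mJ a) l).
Proof.
apply: (ev_bind (F := fun X : jordan => 2 *: jmul (bJ a) X)) => [c X Y|p].
  by rewrite jmul_linear scalerDr !scalerA mulrC.
exact: jmul_bJ.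
Qed.

Lemma jmul_bind_r l q : 2 *: jmul (ev bJ l) (bJ q) = ev bJ (bind (mJ^~ q) l).
Proof.
apply: (ev_bind (F := fun X : jordan => 2 *: jmul X (bJ q))) => [c X Y|p].
  by rewrite jmul_linear_l scalerDr !scalerA mulrC.
exact: jmul_bJ.
Qed.

Lemma jmulZr a X Y : jmul X (a *: Y) = a *: jmul X Y.
Proof. exact: (linear_Z _ _ (jmul_linear X)). Qed.

Lemma jmulZl a X Y : jmul (a *: X) Y = a *: jmul X Y.
Proof. by rewrite jmulC jmulZr jmulC. Qed.

Lemma jmul0r X : jmul X 0 = 0.
Proof. exact: (linear_0 (jmul_linear X)). Qed.

Lemma jmul0l X : jmul 0 X = 0.
Proof. by rewrite jmulC jmul0r. Qed.

Lemma dcol_ev a b j :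
  (4 *: jbracket (jtilde (bJ a)) (jtilde (bJ b))) (bJ j) = ev bJ (dcol a b j).
Proof.
rewrite /dcol ev_axpy zKN1 scaleN1r scale_lfunE jbracketE !jtildeE.
rewrite [RHS]addrC scalerBr -!jmul_bind -!jmul_bJ !jmulZr !scalerA.
by congr (_ *: _ - _ *: _); ring.
Qed.

Lemma dK_bJ k j : dK k (bJ j) = ev bJ (dC k j).
Proof.
rewrite /dC TDE look2_tab /dK.
case: Pos.leb_spec0 => hk; last first.
  by rewrite ifF ?lfunE //; apply/negP => /andP[h _]; lia.
have -> : (Pos.to_nat k <= 52)%N by lia.
have [hj|hj] /= := leqP; first exact: dcol_ev.
by rewrite [bJ j]bJ_out // linear0.
Qed.

Lemma dK_ev k l : dK k (ev bJ l) = ev bJ (bind (dC k) l).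
Proof. by apply: ev_bind => [|p]; [exact: End_linear|exact: dK_bJ]. Qed.

Lemma in_f4_ext D :
  (forall p q, D (jmul (bJ p) (bJ q)) = jmul (D (bJ p)) (bJ q) + jmul (bJ p) (D (bJ q))) ->
  in_f4 D.
Proof.
move=> h X Y; move: X; apply: (spans_ext (@spans_bJ K)) => [a u v|a u v|p].
- by rewrite jmul_linear_l linearP.
- by rewrite linearP !jmul_linear_l scalerDr addrACA.
move: Y; apply: (spans_ext (@spans_bJ K)) => [a u v|a u v|q]; last exact: h.
- by rewrite jmul_linear linearP.
- by rewrite !linearP scalerDr addrACA.
Qed.

Lemma half_inj (V : lmodType K) (u v : V) : 2 *: u = 2 *: v -> u = v.
Proof. by move/(congr1 ( *:%R 2^-1)); rewrite !scalerA mulVf ?pnatr_eq0 // !scale1r. Qed.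

Lemma in_f4_0 : in_f4 (0 : 'End(jordan)).
Proof. by move=> X Y; rewrite !lfunE /= jmul0l jmul0r addr0. Qed.

Lemma in_f4_linear a D D' : in_f4 D -> in_f4 D' -> in_f4 (a *: D + D').
Proof.
move=> h h' X Y; rewrite !lfun_linE h h' jmul_linear_l jmul_linear.
by rewrite scalerDr addrACA.
Qed.

Lemma in_f4_dK k : in_f4 (dK k).
Proof.
case hk : (Pos.leb k 52); last by rewrite /dK hk; exact: in_f4_0.
apply: in_f4_ext => p q.
have [hp|hp] := leqP (Pos.to_nat p) 27; last first.
  by rewrite [bJ p]bJ_out // !(jmul0l, linear0) addr0.
have [hq|hq] := leqP (Pos.to_nat q) 27; last first.
  by rewrite [bJ q]bJ_out // !linear0 addr0.
apply: half_inj.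
have -> : 2 *: dK k (jmul (bJ p) (bJ q)) = dK k (2 *: jmul (bJ p) (bJ q)).
  by rewrite linearZ.
rewrite jmul_bJ dK_ev !dK_bJ scalerDr jmul_bind.
rewrite jmul_bind_r; have hk' : (Pos.to_nat k <= 52)%N by move/Pos.leb_spec0: hk; lia.
have := all_upto2 (all_upto dC_derivation hk') hp hq.
by move=> /(ev_eq bJ)->; rewrite ev_axpy zK1 scale1r.
Qed.

(** The values taken by the unknowns of [eqn] when the derivation is [D]. Rows r run from 1 to 27 in
    27 c + r, hence the predecessor before division and the successor after it. *)
Definition dvar D (v : positive) : K^o :=
  let n := (Pos.to_nat v).-1 in
  cJ (Pos.of_nat (n %% 27).+1) (D (bJ (Pos.of_nat (n %/ 27)))).

Lemma dvar_var D c r : (Pos.to_nat r <= 27)%N -> dvar D (var c r) = cJ r (D (bJ c)).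
Proof.
move=> hr; rewrite /dvar /var.
have r0 := Pos2Nat.is_pos r.
have -> : (Pos.to_nat (27 * c + r)).-1 = (Pos.to_nat c * 27 + (Pos.to_nat r).-1)%N by lia.
rewrite modnMDl divnMDl // modn_small ?divn_small ?addn0 ?prednK //; try lia.
by rewrite !Pos2Nat.id.
Qed.

Lemma mJ_keys : all (fun p => all (fun q => all (fun kc => Pos.leb kc.1 27) (mJ p q))
  (upto 27)) (upto 27).
Proof. by vm_compute. Qed.

Lemma ev_map_var (V : lmodType K) (b : positive -> V) (T : Type) (s : seq T) f g :
  ev b [seq (f x, g x) | x <- s] = \sum_(x <- s) zK (g x) *: b (f x).
Proof. by elim: s => [|x s IH] /=; rewrite ?big_nil // big_cons IH. Qed.

Lemma eqn_sound D i j k : in_f4 D -> (Pos.to_nat i <= 27)%N -> (Pos.to_nat j <= 27)%N ->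
  (Pos.to_nat k <= 27)%N -> ev (dvar D) (eqn i j k) = 0.
Proof.
move=> hD hi hj hk; rewrite /eqn !ev_axpy ev_nil addr0 zK1 scale1r zKN1 !scaleN1r.
have -> : ev (dvar D) [seq (var lc.1 k, lc.2) | lc <- mJ i j] =
    cJ k (2 *: D (jmul (bJ i) (bJ j))).
  have -> : 2 *: D (jmul (bJ i) (bJ j)) = D (2 *: jmul (bJ i) (bJ j)).
    by rewrite linearZ.
  rewrite jmul_bJ; elim: (mJ i j) => [|[l c] s IH] /=.
    by rewrite linear0 (linear_0 (cJ_linear k)).
  by rewrite linearP cJ_linear IH dvar_var.
have s1 (F : jordan -> jordan) X : linear F ->
    \sum_(p <- upto 27) cJ p X * cJ k (F (bJ p)) = cJ k (F X).
  move=> lF; rewrite [in RHS](jordan_coord X) (linear_lincomb _ _ _ lF).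
  by rewrite (linear_lincomb _ _ _ (cJ_linear k)).
rewrite hD scalerDr (linear_D _ _ (cJ_linear k)) !ev_map_var.
have -> : \sum_(p <- upto 27) zK (coef k (mJ p j)) *: dvar D (var i p) =
    cJ k (2 *: jmul (D (bJ i)) (bJ j)).
  rewrite -(s1 (fun X => 2 *: jmul X (bJ j)) (D (bJ i))); last first.
    by move=> c u v; rewrite jmul_linear_l scalerDr !scalerA mulrC.
  apply: eq_big_upto => p hp; rewrite dvar_var // jmul_bJ cJ_ev //; first exact: mulrC.
  exact: (all_upto2 mJ_keys hp hj).
have -> : \sum_(p <- upto 27) zK (coef k (mJ i p)) *: dvar D (var j p) =
    cJ k (2 *: jmul (bJ i) (D (bJ j))).
  rewrite -(s1 (fun X => 2 *: jmul (bJ i) X) (D (bJ j))); last first.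
    by move=> c u v; rewrite jmul_linear scalerDr !scalerA mulrC.
  apply: eq_big_upto => p hp; rewrite dvar_var // jmul_bJ cJ_ev //; first exact: mulrC.
  exact: (all_upto2 mJ_keys hi hp).
by rewrite addrC [- _ - _]addrC addrA addrAC -addrA -opprD addrC subrr.
Qed.

Lemma eqn_pairs_small :
  all (fun pq => Pos.leb pq.1 27 && Pos.leb pq.2 27) eqn_pairs.
Proof. by vm_compute. Qed.

Lemma dpairs_small :
  all (fun pq => Pos.leb pq.1 27 && Pos.leb pq.2 27) dpairs.
Proof. by vm_compute. Qed.

(** Every row of [eqn_rows] evaluates to 0 at the entries of [D], the first 52 by assumption and the
    others by the Leibniz rule, and by [eqn_rows_full] every entry lies in the span of these
    rows. *)
Lemma in_f4_eq0 D : in_f4 D ->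
  (forall k, (Pos.to_nat k <= 52)%N -> cJ (dpair k).2 (D (bJ (dpair k).1)) = 0) -> D = 0.
Proof.
move=> hD h0.
have h c r : (Pos.to_nat c <= 27)%N -> (Pos.to_nat r <= 27)%N -> cJ r (D (bJ c)) = 0.
  move=> hc hr; rewrite -dvar_var // -(ev1 (dvar D)).
  apply: (@echelon_sound K K^o (dvar D) (fun x => x = 0) _ _ 100 eqn_rows) => //.
  - by move=> a u v -> ->; rewrite scaler0 addr0.
  - move=> row h; case: (In_cat h) => {h}.
      move=> h; have [pq [<- pqin]] := In_map h.
      have [i hi e] := In_nth (28%positive, 28%positive) pqin.
      have /andP[/Pos.leb_spec0 h1 /Pos.leb_spec0 h2] := all_In dpairs_small pqin.
      rewrite ev1 dvar_var; last lia.
      have hi' : (i < 52)%N := hi.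
      have := h0 (Pos.of_nat i.+1).
      by rewrite /dpair Nat2Pos.id // [_.-1]/= e; apply; lia.
    move=> h; have [l [h1 h2]] := In_flatten h.
    have [pq [e pqin]] := In_map h1; rewrite -e in h2.
    have [k [<- hk']] := In_map h2; have hk := In_upto hk'.
    have /andP[/Pos.leb_spec0 h3 /Pos.leb_spec0 h4] := all_In eqn_pairs_small pqin.
    by apply: eqn_sound => //; lia.
  - have := all_upto2 eqn_rows_full hc hr.
    by case: (reduce _ _ _).
apply/lfunP => X; rewrite lfunE /=; move: X.
apply: (spans_ext (@spans_bJ K)) => [|a u v|c]; first exact: End_linear.
  by rewrite scaler0 addr0.
have [hc|hc] := leqP (Pos.to_nat c) 27; last by rewrite bJ_out // linear0.
rewrite (jordan_coord (D _)); apply: etrans (eq_big_upto _) _ => [p hp|].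
  by rewrite h // scale0r; exact: erefl.
by rewrite big1 // => p _; rewrite scale0r.
Qed.

Lemma dpair_check : all (fun k => all (fun l =>
   Z.eqb (coef (dpair k).2 (dC l (dpair k).1))
     (if Pos.eqb k l then (if Pos.leb k 24 then Zneg 1 else Zneg 4) else Z0) &&
   all (fun kc => Pos.leb kc.1 27) (dC l (dpair k).1) && Pos.leb (dpair k).2 27)
   (upto 52)) (upto 52).
Proof. by vm_compute. Qed.

(** The pivot coordinates are dual to the [dK] up to the scalars of [dpair_check], so they supply
    the coefficients, and the difference vanishes by [in_f4_eq0]. The first clause is what later
    cuts so(6) out of f4. *)
Lemma f4_span D : in_f4 D -> exists c : positive -> K,
  (forall k, D (bJ (dpair k).1) = 0 -> c k = 0) /\
  D = \sum_(k <- upto 52) c k *: dK k.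
Proof.
move=> hD.
(* The diagonal of the pivot matrix: -1 for the 24 brackets involving E_1 or E_2, and -4 for the 28
   brackets inside F_1. *)
pose piv (k : positive) : K := zK (if Pos.leb k 24 then Zneg 1 else Zneg 4).
pose c k := (piv k)^-1 * cJ (dpair k).2 (D (bJ (dpair k).1)).
exists c; split=> [k h|].
  by rewrite /c h (linear_0 (cJ_linear _)) mulr0.
apply/eqP; rewrite -subr_eq0; apply/eqP.
have hS : in_f4 (\sum_(k <- upto 52) c k *: dK k).
  apply: closed_sum => [|a u v|k _]; [exact: in_f4_0|exact: in_f4_linear|].
  by rewrite -[_ *: _]addr0; apply: in_f4_linear; [exact: in_f4_dK|exact: in_f4_0].
apply: in_f4_eq0 => [|k hk].
  by rewrite -scaleN1r addrC; apply: in_f4_linear.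
have sumE X : (\sum_(l <- upto 52) c l *: dK l) X = \sum_(l <- upto 52) c l *: dK l X.
  rewrite (sum_lfunE _ _ _ X); apply: eq_bigr => l _; exact: scale_lfunE.
rewrite add_lfunE opp_lfunE sumE -scaleN1r addrC cJ_linear.
rewrite (linear_lincomb _ _ _ (cJ_linear _)).
have e l : (Pos.to_nat l <= 52)%N -> c l *: cJ (dpair k).2 (dK l (bJ (dpair k).1)) =
    if Pos.eqb k l then cJ (dpair k).2 (D (bJ (dpair k).1)) else 0 :> K^o.
  move=> hl; have /andP[/andP[/Z.eqb_spec e1 e2] /Pos.leb_spec0 e3] :=
    all_upto2 dpair_check hk hl.
  rewrite dK_bJ cJ_ev //; last lia.
  rewrite e1 /c; case: Pos.eqb_spec => [<-|_]; last by rewrite zK0 scaler0.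
  rewrite /GRing.scale /= mulrAC mulVf ?mul1r // /piv zK_eq0.
  by case: ifP.
rewrite (eq_big_upto e) /GRing.scale /= mulN1r.
suff -> : \sum_(p <- upto 52) (if Pos.eqb k p then cJ (dpair k).2 (D (bJ (dpair k).1))
   else 0) = cJ (dpair k).2 (D (bJ (dpair k).1)) by rewrite addNr.
exact: sum_upto_delta.
Qed.

End Derivations.

(** * The Lie algebra e7 *)

Definition shift (d n : positive) (l : sv) : sv :=
  foldr (fun kc s => if Pos.leb kc.1 n then addk (Pos.add kc.1 d) kc.2 s else s) [::] l.

Definition cut (n : positive) (l : sv) : sv :=
  foldr (fun kc s => if Pos.leb kc.1 n then addk kc.1 kc.2 s else s) [::] l.

Lemma ev_shift (K : numFieldType) (V W : lmodType K) (b : positive -> V)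
    (b' : positive -> W) (f : V -> W) d n l :
  linear f -> (forall p, Pos.leb p n -> b' (Pos.add p d) = f (b p)) ->
  (forall p, ~~ Pos.leb p n -> b p = 0) ->
  ev b' (shift d n l) = f (ev b l).
Proof.
move=> lf h h0; elim: l => [|[k c] l IH] /=; first by rewrite (linear_0 lf).
rewrite lf; case: ifP => hk; first by rewrite ev_addk h // IH.
by rewrite IH (h0 k) ?hk // (linear_0 lf) scaler0 add0r.
Qed.

Lemma ev_cut (K : numFieldType) (V W : lmodType K) (b : positive -> V)
    (b' : positive -> W) (f : V -> W) n l :
  linear f -> (forall p, Pos.leb p n -> b' p = f (b p)) ->
  (forall p, ~~ Pos.leb p n -> b p = 0) ->
  ev b' (cut n l) = f (ev b l).
Proof.
move=> lf h h0; elim: l => [|[k c] l IH] /=; first by rewrite (linear_0 lf).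
rewrite lf; case: ifP => hk; first by rewrite ev_addk h // IH.
by rewrite IH (h0 k) ?hk // (linear_0 lf) scaler0 add0r.
Qed.

Lemma form_check : all (fun q => all (fun p =>
  Z.eqb (trC (mJ q p)) (if Pos.eqb q p then (if Pos.leb q 3 then Zpos 2 else Zpos 4) else Z0))
  (upto 27)) (upto 27).
Proof. by vm_compute. Qed.

Lemma form_assoc : all (fun t => all (fun p => all (fun q =>
  Z.eqb (trC (bind (mJ^~ q) (mJ t p))) (trC (bind (mJ p) (mJ t q))))
  (upto 27)) (upto 27)) (upto 27).
Proof. by vm_compute. Qed.

Section Transpose.
Variable K : numFieldType.
Local Notation zK := (zK K).
Local Notation bJ := (bJ K).
Local Notation dK := (dK K).
Local Notation jordan := (jordan K).
Implicit Types (X Y Z T : jordan) (phi psi : 'End(jordan)).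

Lemma jform_bJ q Z : (Pos.to_nat q <= 27)%N ->
  jform (bJ q) Z = (if Pos.leb q 3 then 1 else 2) * cJ q Z.
Proof.
move=> hq; move: Z; apply: (spans_ext (V := K^o) (@spans_bJ K)) => [|a u v|p].
- exact: jform_linear.
- by rewrite cJ_linear /GRing.scale /=; ring.
have [hp|hp] := leqP (Pos.to_nat p) 27; last first.
  by rewrite [bJ p]bJ_out // (linear_0 (jform_linear _)) (linear_0 (cJ_linear _)) mulr0.
apply: (@half_inj K K^o); rewrite cJ_bJ // /GRing.scale /= /jform.
have -> : 2 * jtr (jmul (bJ q) (bJ p)) = jtr (2 *: jmul (bJ q) (bJ p)).
  by rewrite (linear_Z _ _ (@jtr_linear K)).
rewrite jmul_bJ jtr_ev; have /Z.eqb_spec -> := all_upto2 form_check hq hp.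
by case: Pos.eqb_spec => _; case: (Pos.leb q 3);
  rewrite /= ?mulr0 ?mulr1 // -natrM.
Qed.

Lemma jform_assoc T X Y : jform (jmul T X) Y = jform X (jmul T Y).
Proof.
move: T; apply: (spans_ext (V := K^o) (@spans_bJ K)) => [a u v|a u v|t].
- by rewrite jmul_linear_l jform_linear_l.
- by rewrite jmul_linear_l jform_linear.
move: X; apply: (spans_ext (V := K^o) (@spans_bJ K)) => [a u v|a u v|p].
- by rewrite jmul_linear jform_linear_l.
- by rewrite jform_linear_l.
move: Y; apply: (spans_ext (V := K^o) (@spans_bJ K)) => [a u v|a u v|q].
- by rewrite jform_linear.
- by rewrite jmul_linear jform_linear.
have [ht|ht] := leqP (Pos.to_nat t) 27; last first.
  by rewrite [bJ t]bJ_out // !jmul0l jformC !(linear_0 (jform_linear _)).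
have [hp|hp] := leqP (Pos.to_nat p) 27; last first.
  by rewrite [bJ p]bJ_out // jmul0r !(linear_0 (jform_linear_l _)).
have [hq|hq] := leqP (Pos.to_nat q) 27; last first.
  by rewrite [bJ q]bJ_out // jmul0r !(linear_0 (jform_linear _)).
apply: (@half_inj K K^o); apply: (@half_inj K K^o); rewrite /jform.
rewrite -![in LHS](linear_Z _ _ (@jtr_linear K)) -![in RHS](linear_Z _ _ (@jtr_linear K)).
have -> : 2 *: (2 *: jmul (jmul (bJ t) (bJ p)) (bJ q)) = ev bJ (bind (mJ^~ q) (mJ t p)).
  by rewrite -jmul_bind_r -jmul_bJ jmulZl.
have -> : 2 *: (2 *: jmul (bJ p) (jmul (bJ t) (bJ q))) = ev bJ (bind (mJ p) (mJ t q)).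
  by rewrite -jmul_bind -jmul_bJ jmulZr.
by rewrite !jtr_ev; have /Z.eqb_spec -> := all_upto2 (all_upto form_assoc ht) hp hq.
Qed.

(** [jtrans] is given by coordinates in a form-orthogonal basis, and there the adjunction relation
    prescribes each coordinate of the value. *)
Lemma jtrans_adjoint phi psi :
  (forall X Y, jform (phi X) Y = jform X (psi Y)) -> jtrans phi = psi.
Proof.
move=> h; apply/lfunP => Y; rewrite jtransE /jtrans_fun; apply: jordan_eq => [k|k l].
  rewrite mxE h bJ_E jform_bJ; last by rewrite Nat2Pos.id //; have := ltn_ord k; lia.
  have -> : Pos.leb (Pos.of_nat k.+1) 3.
    by apply/Pos.leb_spec0; have := ltn_ord k; lia.
  rewrite mul1r /cJ Nat2Pos.id //= /cJn ltn_ord inord_val.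
  by [].
have e : keyF k l = Pos.of_nat (3 + 8 * k + l).+1.
  by rewrite /keyF modn_small.
have hk := ltn_ord k; have hl := ltn_ord l.
rewrite mxE h; have -> : delta_mx 0 l = oe K l by rewrite /oe inord_val.
rewrite bJ_F e jform_bJ; last by rewrite Nat2Pos.id //; lia.
have -> : Pos.leb (Pos.of_nat (3 + 8 * k + l).+1) 3 = false.
  by apply/Pos.leb_spec0; lia.
rewrite mulrA mulVf ?pnatr_eq0 // mul1r /cJ Nat2Pos.id // succnK /cJn.
have [-> -> ->] : [/\ (3 + 8 * k + l < 3)%N = false, (3 + 8 * k + l < 27)%N
    & (3 + 8 * k + l - 3 = k * 8 + l)%N].
  by move: (nat_of_ord k) (nat_of_ord l) hk hl => m n hm hn; split; lia.
by rewrite divnMDl // divn_small // addn0 modnMDl modn_small // !inord_val.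
Qed.

Lemma jtrans_jtilde T : jtrans (jtilde T) = jtilde T.
Proof. by apply: jtrans_adjoint => X Y; rewrite !jtildeE jform_assoc. Qed.

(** Multiplications are symmetric for the trace form by [jform_assoc], and a commutator of symmetric
    operators is skew. *)
Lemma jtrans_dK k : jtrans (dK k) = - dK k.
Proof.
apply: jtrans_adjoint => X Y; rewrite /dK; case: ifP => _; last first.
  rewrite opp_lfunE !lfunE /= oppr0.
  by rewrite (linear_0 (jform_linear_l _)) (linear_0 (jform_linear _)).
rewrite opp_lfunE !scale_lfunE !jbracketE !jtildeE -scalerN opprB.
rewrite (linear_Z _ _ (jform_linear_l _)) (linear_Z _ _ (jform_linear _)).
rewrite !(linear_D _ _ (jform_linear_l _)) !(linear_D _ _ (jform_linear _)).
have jNl U V : jform (- U) V = - jform U V.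
  by rewrite -scaleN1r (linear_Z _ _ (jform_linear_l _)) scaleN1r.
have jNr U V : jform U (- V) = - jform U V by rewrite jformC jNl jformC.
by rewrite jNl jNr !jform_assoc.
Qed.

End Transpose.

(* The basis of e7, up to scalars: indices 1-52 are Phi(D), 53-78 Phi(T~) with tr T = 0,  *)
(* 79-105 Phi(A), 106-132 Phi(B) and 133 Phi(nu).                                         *)
Definition tC (k : positive) : sv :=
  if Pos.eqb k 53 then [:: (1%positive, Zpos 1); (2%positive, Zneg 1)]
  else if Pos.eqb k 54 then [:: (2%positive, Zpos 1); (3%positive, Zneg 1)]
  else if Pos.leb 55 k && Pos.leb k 78 then [:: (Pos.sub k 51, Zpos 1)] else [::].

Definition aC (k : positive) : sv :=
  if Pos.leb 79 k && Pos.leb k 105 then [:: (Pos.sub k 78, Zpos 1)] else [::].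

Definition bC (k : positive) : sv :=
  if Pos.leb 106 k && Pos.leb k 132 then [:: (Pos.sub k 105, Zpos 1)] else [::].

Definition nC (k : positive) : Z := if Pos.eqb k 133 then Zpos 1 else Z0.

Definition flatF (X Y : sv) (x y : Z) : sv :=
  axpy (Zpos 1) (cut 27 X) (axpy (Zpos 1) (shift 27 27 Y)
    (addk 55 x (addk 56 y [::]))).

Definition phiC (k : positive) (X Y : sv) (x y : Z) : sv :=
  flatF
    (axpy (Zpos 1) (bind (dC k) X) (axpy (Zpos 1) (mC (tC k) X)
      (axpy (Z.opp (nC k)) X (axpy (Zpos 1) (crossC (bC k) Y)
        (axpy (Z.mul (Zpos 2) y) (aC k) [::])))))
    (axpy (Zpos 1) (crossC (aC k) X) (axpy (Zpos 1) (bind (dC k) Y)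
      (axpy (Zneg 1) (mC (tC k) Y) (axpy (nC k) Y
        (axpy (Z.mul (Zpos 2) x) (bC k) [::])))))
    (Z.add (formC (aC k) Y) (Z.mul (Z.mul (Zpos 3) (nC k)) x))
    (Z.sub (formC (bC k) X) (Z.mul (Z.mul (Zpos 3) (nC k)) y)).

Definition pcol (k j : positive) : sv :=
  if Pos.leb j 27 then phiC k [:: (j, Zpos 1)] [::] Z0 Z0
  else if Pos.leb j 54 then phiC k [::] [:: (Pos.sub j 27, Zpos 1)] Z0 Z0
  else if Pos.eqb j 55 then phiC k [::] [::] (Zpos 1) Z0
  else if Pos.eqb j 56 then phiC k [::] [::] Z0 (Zpos 1) else [::].

Definition TP := Eval vm_compute in tab2 pcol 133 56.

Lemma TPE : TP = tab2 pcol 133 56.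
Proof. by vm_compute. Qed.

Definition pC : positive -> positive -> sv := look2 TP.

Definition shape (k : positive) (t a b : sv) (n : Z) : bool :=
  [&& Pos.leb k 133, eqsv (tC k) t, eqsv (aC k) a, eqsv (bC k) b & Z.eqb (nC k) n].

(** Coordinates of the trace-free element 3 b_p - tr(b_p) E on E_1 - E_2, E_2 - E_3 and the
    F_k(e_j); this is verified in [shape_T]. *)
Definition tcoef (p : positive) : sv :=
  if Pos.eqb p 1 then [:: (53, Zpos 2); (54, Zpos 1)]%positive
  else if Pos.eqb p 2 then [:: (53, Zneg 1); (54, Zpos 1)]%positive
  else if Pos.eqb p 3 then [:: (53, Zneg 1); (54, Zneg 2)]%positive
  else [:: (Pos.add p 51, Zpos 3)].

Lemma shape_f4 : all (fun k => shape k [::] [::] [::] Z0) (upto 52).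
Proof. by vm_compute. Qed.

Lemma shape_A : all (fun p => shape (Pos.add p 78) [::] [:: (p, Zpos 1)] [::] Z0
  && ~~ Pos.leb (Pos.add p 78) 52) (upto 27).
Proof. by vm_compute. Qed.

Lemma shape_B : all (fun p => shape (Pos.add p 105) [::] [::] [:: (p, Zpos 1)] Z0
  && ~~ Pos.leb (Pos.add p 105) 52) (upto 27).
Proof. by vm_compute. Qed.

Lemma shape_T : all (fun p =>
  eqsv (axpy (Zpos 3) [:: (p, Zpos 1)] (axpy (Z.opp (trC [:: (p, Zpos 1)])) oneC [::]))
    (bind tC (tcoef p)) &&
  all (fun kc => shape kc.1 (tC kc.1) [::] [::] Z0 && ~~ Pos.leb kc.1 52) (tcoef p))
  (upto 27).
Proof. by vm_compute. Qed.

Section E7Basis.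
Variable K : numFieldType.
Local Notation zK := (zK K).
Local Notation bJ := (bJ K).
Local Notation dK := (dK K).
Local Notation jordan := (jordan K).
Local Notation freudenthal := (freudenthal K).
Local Notation e7 := (e7 K).
Implicit Types (X Y Z T A B : jordan) (phi psi : 'End(jordan)).
Implicit Types F G : 'End(freudenthal).

Definition bF (j : positive) : freudenthal :=
  if Pos.leb j 27 then (bJ j, 0, 0, 0)
  else if Pos.leb j 54 then (0, bJ (Pos.sub j 27), 0, 0)
  else if Pos.eqb j 55 then (0, 0, 1, 0)
  else if Pos.eqb j 56 then (0, 0, 0, 1) else 0.

Lemma bF_out j : (56 < Pos.to_nat j)%N -> bF j = 0.
Proof.
move=> h; rewrite /bF.
case: Pos.leb_spec0 => [?|_]; first lia.
case: Pos.leb_spec0 => [?|_]; first lia.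
case: Pos.eqb_spec => [?|_]; first lia.
by case: Pos.eqb_spec => [?|_]; first lia.
Qed.

Definition inX X : freudenthal := (X, 0, 0, 0).
Definition inY Y : freudenthal := (0, Y, 0, 0).

Lemma pair4_linear a (X X' Y Y' : jordan) (x x' y y' : K^o) :
  (a *: X + X', a *: Y + Y', a *: x + x', a *: y + y') =
  a *: ((X, Y, x, y) : freudenthal) + (X', Y', x', y').
Proof. by []. Qed.

Lemma inX_linear : linear inX.
Proof. by move=> a X Y; rewrite /inX -pair4_linear !scaler0 !addr0. Qed.
Lemma inY_linear : linear inY.
Proof. by move=> a X Y; rewrite /inY -pair4_linear !scaler0 !addr0. Qed.

Lemma bF_X j : Pos.leb j 27 -> bF j = inX (bJ j).
Proof. by rewrite /bF => ->. Qed.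

Lemma bF_Y j : Pos.leb j 27 -> bF (Pos.add j 27) = inY (bJ j).
Proof.
move=> /Pos.leb_spec0 h; rewrite /bF.
case: Pos.leb_spec0 => [?|_]; first lia.
case: Pos.leb_spec0 => [_|?]; last lia.
by rewrite Pos.add_sub.
Qed.

Lemma bJ_out' j : ~~ Pos.leb j 27 -> bJ j = 0.
Proof. by move=> /Pos.leb_spec0 h; rewrite bJ_out //; lia. Qed.

Lemma frD X Y (x y : K^o) X' Y' (x' y' : K^o) :
  ((X, Y, x, y) : freudenthal) + (X', Y', x', y') = (X + X', Y + Y', x + x', y + y').
Proof. by []. Qed.

Lemma frZ a X Y (x y : K^o) :
  a *: ((X, Y, x, y) : freudenthal) = (a *: X, a *: Y, a *: x, a *: y).
Proof. by []. Qed.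

Lemma pair4E X Y (x y : K^o) :
  ((X, Y, x, y) : freudenthal) = inX X + (inY Y + (x *: bF 55 + y *: bF 56)).
Proof.
rewrite (_ : bF 55 = (0, 0, 1, 0)) // (_ : bF 56 = (0, 0, 0, 1)) // /inX /inY.
rewrite !frZ !frD !scaler0 !addr0 !add0r /GRing.scale /=.
by rewrite !mulr1.
Qed.

Lemma flatF_ev (X Y : sv) (x y : Z) :
  ev bF (flatF X Y x y) = (ev bJ X, ev bJ Y, zK x, zK y).
Proof.
rewrite /flatF !ev_axpy !ev_addk ev_nil addr0 !scale1r.
rewrite (ev_cut _ inX_linear bF_X bJ_out') (ev_shift _ inY_linear bF_Y bJ_out').
by rewrite [RHS]pair4E.
Qed.

Lemma spans_bF : spans bF.
Proof.
move=> P P0 PL Pb [[[X Y] x] y].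
have PD u v : P u -> P v -> P (u + v).
  by move=> hu hv; rewrite -[u]scale1r; apply: PL.
have PZ a u : P u -> P (a *: u) by move=> hu; rewrite -[_ *: _]addr0; apply: PL.
rewrite pair4E; apply: (PD); [|apply: (PD); [|by apply: (PD); apply: (PZ)]].
  apply: (@spans_bJ K (fun X => P (inX X))) => [|a u v hu hv|p].
  - by rewrite (linear_0 inX_linear).
  - by rewrite inX_linear; apply: PL.
  case hp : (Pos.leb p 27); last by rewrite bJ_out' ?hp // (linear_0 inX_linear).
  by rewrite -bF_X.
apply: (@spans_bJ K (fun X => P (inY X))) => [|a u v hu hv|p].
- by rewrite (linear_0 inY_linear).
- by rewrite inY_linear; apply: PL.
case hp : (Pos.leb p 27); last by rewrite bJ_out' ?hp // (linear_0 inY_linear).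
by rewrite -bF_Y.
Qed.

Lemma End_eq (U V : vectType K) (b : positive -> U) (f g : 'Hom(U, V)) :
  spans b -> (forall k, f (b k) = g (b k)) -> f = g.
Proof.
by move=> sb h; apply/lfunP; apply: (spans_ext sb) => //; exact: End_linear.
Qed.

(** Here and in [PK] the factors 2 and 3 absorb the denominators of [jmul], of [jcross] and of the
    nu / 3 in [Phi], which makes the 56 by 56 matrices integral. *)
Definition phiK k : 'End(jordan) := dK k + jtilde (2 *: ev bJ (tC k)).
Definition PK k : 'End(freudenthal) :=
  if Pos.leb k 133 then
    Phi (phiK k) (2 *: ev bJ (aC k)) (2 *: ev bJ (bC k)) (zK (Z.mul (Zpos 3) (nC k)))
  else 0.

Lemma jcross_linear_l Y : linear (fun X => jcross X Y).
Proof. by move=> a X Z; rewrite !(jcrossC _ Y) jcross_linear. Qed.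

Lemma phiK_ev k (X : sv) : phiK k (ev bJ X) =
  ev bJ (axpy (Zpos 1) (bind (dC k) X) (mC (tC k) X)).
Proof.
rewrite /phiK add_lfunE dK_ev jtildeE jmulZl jmul_ev ev_axpy zK1 scale1r.
by [].
Qed.

Lemma jtrans_phiK k (X : sv) : jtrans (phiK k) (ev bJ X) =
  ev bJ (axpy (Zneg 1) (bind (dC k) X) (mC (tC k) X)).
Proof.
rewrite /phiK -[dK k]scale1r jtrans_linear jtrans_dK jtrans_jtilde.
rewrite lfun_linE opp_lfunE dK_ev jtildeE jmulZl jmul_ev ev_axpy zKN1 scaleN1r.
by rewrite scale1r.
Qed.

Lemma PK_ev k (X Y : sv) (x y : Z) : Pos.leb k 133 -> PK k (ev bJ X, ev bJ Y, zK x, zK y) = ev bF (phiC k X Y x y).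
Proof.
move=> hk; rewrite /phiC flatF_ev /PK hk PhiE /Phi_fun.
have c4 A B : 2 *: jcross (2 *: A) B = 4 *: jcross A B.
  by rewrite (linear_Z _ _ (jcross_linear_l _)) scalerA -natrM.
have f2 A B : jform (2 *: A) B = 2 * jform A B :> K.
  exact: (linear_Z _ _ (jform_linear_l _)).
have hn : 3^-1 * zK (Z.mul 3 (nC k)) = zK (nC k).
  by rewrite zKM mulrA mulVf ?mul1r // pnatr_eq0.
rewrite phiK_ev jtrans_phiK !c4 !jcross_ev !f2 !jform_ev hn.
rewrite ![zK _ *: (2 *: _)]scalerA ![zK _ * 2]mulrC.
rewrite !ev_axpy ev_nil !addr0 zK1 zKN1 !scale1r !scaleN1r !zKM !zKN scaleNr.
congr (_, _, _, _).
- by rewrite -!addrA.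
- by rewrite opprD opprK -!addrA.
- by rewrite zKD !zKM.
- by rewrite /Z.sub zKD zKN !zKM.
Qed.

Lemma PK_bF k j : PK k (bF j) = ev bF (pC k j).
Proof.
rewrite /pC TPE look2_tab; case hk : (Pos.leb k 133); last first.
  rewrite /PK hk lfunE ifF //; apply/negP => /andP[h _].
  by move: hk => /Pos.leb_spec0; lia.
have -> /= : (Pos.to_nat k <= 133)%N by move: hk => /Pos.leb_spec0; lia.
have [hj|hj] /= := leqP; last by rewrite bF_out // linear0.
rewrite /bF /pcol.
have z0 : (0 : K^o) = zK Z0 by [].
have z1 : (1 : K^o) = zK (Zpos 1) by [].
have e0 : (0 : jordan) = ev bJ [::] by [].
case: ifP => h1; first by rewrite -(ev1 bJ j) {1}e0 z0 PK_ev.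
case: ifP => h2; first by rewrite -(ev1 bJ (Pos.sub j 27)) {1}e0 z0 PK_ev.
case: ifP => h3; first by rewrite !e0 z0 z1 PK_ev.
case: ifP => h4; first by rewrite !e0 z0 z1 PK_ev.
by rewrite linear0.
Qed.

Lemma PK_bind k l : PK k (ev bF l) = ev bF (bind (pC k) l).
Proof. by apply: ev_bind => [|p]; [exact: End_linear|exact: PK_bF]. Qed.

Lemma tC_trace : all (fun k => Z.eqb (trC (tC k)) Z0) (upto 133).
Proof. by vm_compute. Qed.

Lemma in_e7_PK k : PK k \in e7.
Proof.
rewrite /PK; case hk : (Pos.leb k 133); last exact: mem0v.
apply/mem_e7.
exists (phiK k), (2 *: ev bJ (aC k)), (2 *: ev bJ (bC k)), (zK (Z.mul (Zpos 3) (nC k))).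
split=> //; exists (dK k), (2 *: ev bJ (tC k)); split=> //; first exact: in_f4_dK.
have hk' : (Pos.to_nat k <= 133)%N by move: hk => /Pos.leb_spec0; lia.
rewrite (linear_Z _ _ (@jtr_linear K)) jtr_ev.
by have /Z.eqb_spec -> := all_upto tC_trace hk'; rewrite zK0 /GRing.scale /= mulr0.
Qed.

Lemma Phi_D phi psi A A' B B' (n n' : K) :
  Phi (phi + psi) (A + A') (B + B') (n + n') = Phi phi A B n + Phi psi A' B' n'.
Proof. by have := Phi_linear 1 phi psi A A' B B' n n'; rewrite !scale1r mul1r. Qed.

Lemma Phi0 : Phi (0 : 'End(jordan)) 0 0 0 = 0.
Proof.
have := Phi_D 0 0 0 0 0 0 0 0; rewrite !addr0 => e.
by apply: (addrI (Phi 0 0 0 0)); rewrite -e addr0.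
Qed.

Lemma Phi_Z a phi A B (n : K) : Phi (a *: phi) (a *: A) (a *: B) (a * n) = a *: Phi phi A B n.
Proof. by have := Phi_linear a phi 0 A 0 B 0 n 0; rewrite !addr0 Phi0 addr0. Qed.

Lemma jtilde_D T T' : jtilde (T + T') = jtilde T + jtilde T'.
Proof. exact: (linear_D _ _ (@jtilde_linear K)). Qed.
Lemma jtilde_Z a T : jtilde (a *: T) = a *: jtilde T.
Proof. exact: (linear_Z _ _ (@jtilde_linear K)). Qed.

Lemma PK_shape k t a b n : shape k t a b n ->
  PK k = Phi (dK k + jtilde (2 *: ev bJ t)) (2 *: ev bJ a) (2 *: ev bJ b) (3 * zK n).
Proof.
case/and5P => hk /(ev_eq bJ) ht /(ev_eq bJ) ha /(ev_eq bJ) hb /Z.eqb_spec hn.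
by rewrite /PK /phiK hk ht ha hb hn zKM.
Qed.

Lemma jtilde0 : jtilde (0 : jordan) = 0.
Proof. by rewrite (linear_0 (@jtilde_linear K)). Qed.

Lemma dK_out k : ~~ Pos.leb k 52 -> dK k = 0.
Proof. by rewrite /dK => /negPf->. Qed.

Section Closed.
Variable P : 'End(freudenthal) -> Prop.
Hypotheses (P0 : P 0) (PL : forall a u v, P u -> P v -> P (a *: u + v)).
Hypothesis Pk : forall k, P (PK k).

Let PD u v : P u -> P v -> P (u + v).
Proof. by move=> hu hv; rewrite -[u]scale1r; apply: PL. Qed.
Let PZ a u : P u -> P (a *: u).
Proof. by move=> hu; rewrite -[_ *: _]addr0; apply: PL. Qed.

Let PK_half F k : PK k = 2 *: F -> P F.
Proof.
move=> e; have -> : F = 2^-1 *: PK k by rewrite e scalerA mulVf ?pnatr_eq0 // scale1r.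
exact: PZ.
Qed.

Lemma closed_Phi_f4 D : in_f4 D -> P (Phi D 0 0 0).
Proof.
move=> /f4_span[c [_ ->]]; apply: (closed_sum (P := fun D => P (Phi D 0 0 0))) => [|a u v hu hv|k _].
- by rewrite Phi0.
- by have := Phi_linear a u v 0 0 0 0 0 0; rewrite !scaler0 !addr0 mulr0 => ->; apply: PL.
have := Phi_Z (c k) (dK k) 0 0 0; rewrite !scaler0 mulr0 => ->; apply: PZ.
case hk : (Pos.leb k 52); last by rewrite /dK hk Phi0.
suff -> : Phi (dK k) 0 0 0 = PK k by [].
have hk' : (Pos.to_nat k <= 52)%N by move: hk => /Pos.leb_spec0; lia.
rewrite (PK_shape (all_upto shape_f4 hk')) !ev_nil scaler0 jtilde0 addr0.
by rewrite zK0 mulr0.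
Qed.

Lemma closed_Phi_A A : P (Phi 0 A 0 0).
Proof.
apply: (@spans_bJ K (fun A => P (Phi 0 A 0 0))) => [|a u v hu hv|p].
- by rewrite Phi0.
- by have := Phi_linear a 0 0 u v 0 0 0 0; rewrite !scaler0 !addr0 mulr0 => ->; apply: PL.
case hp : (Pos.leb p 27); last by rewrite bJ_out' ?hp // Phi0.
have hp' : (Pos.to_nat p <= 27)%N by move: hp => /Pos.leb_spec0; lia.
have /andP[h1 h2] := all_upto shape_A hp'.
apply: (@PK_half _ (Pos.add p 78)); rewrite (PK_shape h1) (dK_out h2) !ev_nil ev1.
by rewrite -Phi_Z !scaler0 jtilde0 addr0 zK0 !mulr0.
Qed.

Lemma closed_Phi_B B : P (Phi 0 0 B 0).
Proof.
apply: (@spans_bJ K (fun B => P (Phi 0 0 B 0))) => [|a u v hu hv|p].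
- by rewrite Phi0.
- by have := Phi_linear a 0 0 0 0 u v 0 0; rewrite !scaler0 !addr0 mulr0 => ->; apply: PL.
case hp : (Pos.leb p 27); last by rewrite bJ_out' ?hp // Phi0.
have hp' : (Pos.to_nat p <= 27)%N by move: hp => /Pos.leb_spec0; lia.
have /andP[h1 h2] := all_upto shape_B hp'.
apply: (@PK_half _ (Pos.add p 105)); rewrite (PK_shape h1) (dK_out h2) !ev_nil ev1.
by rewrite -Phi_Z !scaler0 jtilde0 addr0 zK0 !mulr0.
Qed.

Lemma closed_Phi_n n : P (Phi 0 0 0 n).
Proof.
have -> : Phi 0 0 0 n = (n / 3) *: PK 133.
  have h : shape 133 [::] [::] [::] (Zpos 1) by vm_compute.
  rewrite (PK_shape h) -Phi_Z dK_out // !ev_nil !scaler0 jtilde0 addr0 !scaler0.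
  by rewrite zK1 mulr1 -mulrA mulVf ?mulr1 // pnatr_eq0.
exact: PZ.
Qed.

(** Projecting to trace zero makes the statement linear in an unrestricted [T], so that it can be
    tested on the basis of the Jordan algebra. *)
Lemma closed_Phi_T T : P (Phi (jtilde (T - (3^-1 * jtr T) *: jone K)) 0 0 0).
Proof.
have PhiT (U U' : jordan) (a : K) : Phi (jtilde (a *: U + U')) 0 0 0 =
    a *: Phi (jtilde U) 0 0 0 + Phi (jtilde U') 0 0 0.
  rewrite jtilde_linear; have := Phi_linear a (jtilde U) (jtilde U') 0 0 0 0 0 0.
  by rewrite !scaler0 !addr0 mulr0.
have PhiT0 : Phi (jtilde (0 : jordan)) 0 0 0 = 0 by rewrite jtilde0 Phi0.
apply: (@spans_bJ K (fun T => P (Phi (jtilde (T - (3^-1 * jtr T) *: jone K)) 0 0 0)))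
  => [|a u v hu hv|p].
- by rewrite (linear_0 (@jtr_linear K)) mulr0 scale0r subr0 PhiT0.
- suff : a *: u + v - (3^-1 * jtr (a *: u + v)) *: jone K =
    a *: (u - (3^-1 * jtr u) *: jone K) + (v - (3^-1 * jtr v) *: jone K).
    by move=> ->; rewrite PhiT; exact: (PL a hu hv).
  rewrite jtr_linear {1}/GRing.scale /= mulrDr scalerDl opprD addrACA scalerBr scalerA.
  by rewrite mulrCA.
case hp : (Pos.leb p 27); last first.
  by rewrite bJ_out' ?hp // (linear_0 (@jtr_linear K)) mulr0 scale0r subr0 PhiT0.
have hp' : (Pos.to_nat p <= 27)%N by move: hp => /Pos.leb_spec0; lia.
have /andP[/(ev_eq bJ) e ha] := all_upto shape_T hp'.
have {e} e : 3 *: (bJ p - (3^-1 * jtr (bJ p)) *: jone K) = ev bJ (bind tC (tcoef p)).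
  rewrite -e !ev_axpy ev_nil addr0 ev1 jone_ev scalerBr scalerA mulrA divff ?pnatr_eq0 //.
  by rewrite mul1r zKN -jtr_ev ev1 scaleNr.
have -> : bJ p - (3^-1 * jtr (bJ p)) *: jone K =
    6^-1 *: (2 *: ev bJ (bind tC (tcoef p))) + 0.
  rewrite -e !scalerA addr0 (_ : 6^-1 * 2 * 3 = 1) ?scale1r //.
  by rewrite -mulrA -natrM mulVf // pnatr_eq0.
rewrite PhiT PhiT0 addr0; apply: PZ.
elim: (tcoef p) ha => [|[k c] l IH] /=; first by rewrite scaler0 PhiT0.
move=> /andP[/andP[h1 h2] /IH h3]; rewrite /bind /= ev_axpy scalerDr scalerA mulrC -scalerA.
rewrite PhiT; apply: (PL _ _ h3).
have := Pk k; rewrite (PK_shape h1) (dK_out h2) !ev_nil scaler0 zK0 mulr0 add0r.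
by [].
Qed.

(** The [PK k] span e7: an element [Phi] is the sum of its f4, T, A, B and nu parts, and each part
    is covered by its own range of indices. *)
Lemma closed_e7 F : in_e7 F -> P F.
Proof.
move=> [phi [A [B [n [[D [T [hD hT ->]]] ->]]]]].
have := Phi_D D (jtilde T) 0 A 0 B 0 n; rewrite !add0r => ->.
apply: (PD); first exact: closed_Phi_f4.
have := Phi_D (jtilde T) 0 0 A 0 B 0 n; rewrite !add0r addr0 => ->.
apply: (PD).
  by have := closed_Phi_T T; rewrite hT mulr0 scale0r subr0.
have := Phi_D 0 0 A 0 0 B 0 n; rewrite !add0r !addr0 => ->; apply: (PD).
  exact: closed_Phi_A.
have := Phi_D 0 0 0 0 B 0 0 n; rewrite !add0r !addr0 => ->; apply: (PD).
  exact: closed_Phi_B.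
exact: closed_Phi_n.
Qed.

End Closed.
End E7Basis.

(** * Structure constants of e7 *)

Definition ccol (k l j : positive) : sv :=
  axpy (Zpos 1) (bind (pC k) (pC l j)) (axpy (Zneg 1) (bind (pC l) (pC k j)) [::]).

(** For trace-free [x] the diagonal is c1, c2, - c1 - c2, that is c1 (E_1 - E_2) + (c1 + c2) (E_2 -
    E_3). *)
Definition tvec (x : sv) : sv :=
  let c1 := coef 1 x in let c2 := coef 2 x in
  addk 53 c1 (addk 54 (Z.add c1 c2)
    (foldr (fun kc s => if Pos.leb 4 kc.1 then addk (Pos.add kc.1 51) kc.2 s else s) [::] x)).

(** Inverts the pivots -1 and -4 of [dpair_check]. Exactness of the integer quotient needs no
    separate argument, since the results are validated by [T7_check], [wC_check] and [sP_check]. *)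
Definition dpiv (k : positive) (f : positive -> sv) : Z :=
  let c := coef (dpair k).2 (f (dpair k).1) in
  if Pos.leb k 24 then Z.opp c else Z.opp (Z.div c 4).

Definition dvec (f : positive -> sv) : sv :=
  foldr (fun k s => addk k (dpiv k f) s) [::] (upto 52).

(* The coordinates of [24 (PK k o PK l - PK l o PK k)] on the [PK]: B, A and nu are read  *)
(* off the last two columns, and then phi = D + T~ gives T (as phi E = T) and D.            *)
Definition c7 (k l : positive) : sv :=
  let c55 := ccol k l 55 in let c56 := ccol k l 56 in
  let n := coef 55 c55 in
  let fE := axpy (Zpos 12) (cut 27 (axpy (Zpos 1) (ccol k l 1) (axpy (Zpos 1) (ccol k l 2)
              (ccol k l 3)))) (axpy (Z.mul (Zpos 4) n) oneC [::]) in
  axpy (Zpos 1) (dvec (fun j => axpy (Zpos 24) (ccol k l j) (axpy (Zneg 1) (mC fE [:: (j, Zpos 1)]) [::])))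
  (axpy (Zpos 1) (tvec fE)
  (axpy (Zpos 12) (shift 78 27 (cut 27 c56))
  (axpy (Zpos 12) (shift 78 54 (foldr (fun kc s => if Pos.leb 28 kc.1 then addk kc.1 kc.2 s else s) [::] c55))
  (addk 133 (Z.mul (Zpos 8) n) [::])))).

Definition T7 := Eval vm_compute in
  tab (fun k => tab (c7 k) (Pos.to_nat k).-1) 133.

Lemma T7_check : all (fun k => all (fun l => all (fun j =>
    eqsv (axpy (Zpos 24) (ccol k l j) [::]) (bind (pC^~ j) (look2 T7 k l)))
  (upto 56)) (upto (Pos.to_nat k).-1)) (upto 133).
Proof. by vm_compute. Qed.

Definition commC (k l : positive) : sv :=
  if Pos.leb k 133 && Pos.leb l 133 then
    match Pos.compare k l with
    | Gt => look2 T7 k l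
    | Lt => axpy (Zneg 1) (look2 T7 l k) [::]
    | Eq => [::]
    end
  else [::].

Definition wvec (p q : positive) : sv :=
  dvec (fun j => axpy (Zpos 2) (dcol p q j) [::]).

Definition TW := Eval vm_compute in tab2 wvec 27 27.

Lemma TWE : TW = tab2 wvec 27 27.
Proof. by vm_compute. Qed.

Definition wC : positive -> positive -> sv := look2 TW.

Lemma wC_check : all (fun p => all (fun q => all (fun j =>
    eqsv (axpy (Zpos 2) (dcol p q j) [::]) (bind (dC^~ j) (wC p q)))
  (upto 27)) (upto 27)) (upto 27).
Proof. by vm_compute. Qed.

Section GenericCommutator.
Variables (K : numFieldType) (V : vectType K).
Implicit Types F G H : 'End(V).

Definition comm F G : 'End(V) := (F \o G)%VF - (G \o F)%VF.

Lemma commE F G p : comm F G p = F (G p) - G (F p).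
Proof. by rewrite /comm add_lfunE opp_lfunE !comp_lfunE. Qed.

Lemma commN F G : comm F G = - comm G F.
Proof. by rewrite /comm opprB. Qed.

Lemma comm_linear F : linear (comm F).
Proof.
move=> a G H; apply/lfunP => p; rewrite commE !lfun_linE !commE linearP.
by rewrite scalerBr opprD addrACA.
Qed.

Lemma comm_linear_l G : linear (fun F => comm F G).
Proof.
by move=> a F H; rewrite !(commN _ G) comm_linear opprD scalerN.
Qed.

Lemma scale_comm0l c G : c *: comm 0 G = 0.
Proof. by rewrite (linear_0 (comm_linear_l _)) scaler0. Qed.
Lemma scale_comm0r c G : c *: comm G 0 = 0.
Proof. by rewrite (linear_0 (comm_linear _)) scaler0. Qed.
Lemma scale_commxx c F : c *: comm F F = 0.
Proof. by rewrite /comm subrr scaler0. Qed.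
Lemma scale_commN c F G : c *: comm F G = - (c *: comm G F).
Proof. by rewrite commN scalerN. Qed.

Lemma scale_comm_linear c F : linear (fun G => c *: comm F G).
Proof. by move=> a G H; rewrite comm_linear scalerDr !scalerA mulrC. Qed.
Lemma scale_comm_linear_l c F : linear (fun G => c *: comm G F).
Proof. by move=> a G H; rewrite comm_linear_l scalerDr !scalerA mulrC. Qed.

Lemma scale_commE c F G p : (c *: comm F G) p = c *: (F (G p) - G (F p)).
Proof. by rewrite scale_lfunE commE. Qed.

End GenericCommutator.

Lemma ev_oppsv (K : numFieldType) (V : lmodType K) (b : positive -> V) l :
  ev b (axpy (Zneg 1) l [::]) = - ev b l.
Proof. by rewrite ev_axpy ev_nil addr0 zKN1 scaleN1r. Qed.

Lemma ev_bind0 (K : numFieldType) (V : lmodType K) (b : positive -> V)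
    (f : positive -> sv) l :
  (forall m, ev b (f m) = 0) -> ev b (bind f l) = 0.
Proof.
move=> h; elim: l => //= -[m c] s IH.
by rewrite /bind /= ev_axpy h scaler0 add0r.
Qed.

Section Commutators.
Variable K : numFieldType.
Local Notation zK := (zK K).
Local Notation bJ := (bJ K).
Local Notation bF := (bF K).
Local Notation dK := (dK K).
Local Notation PK := (PK K).
Local Notation jordan := (jordan K).
Local Notation freudenthal := (freudenthal K).
Implicit Types F G : 'End(freudenthal).

Lemma app_linear (U V : vectType K) (u : U) : linear (fun f : 'Hom(U, V) => f u).
Proof. by move=> a f g; rewrite lfun_linE. Qed.

Lemma evPK_bF f j : ev PK f (bF j) = ev bF (bind (pC^~ j) f).
Proof.
by apply: (ev_bind (F := fun G : 'End(freudenthal) => G (bF j)));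
  [exact: app_linear|move=> k; exact: PK_bF].
Qed.

Lemma evPK_ev f x : ev PK f (ev bF x) = ev bF (bind2 pC f x).
Proof.
apply: (ev_bind2 (F := fun (G : 'End(freudenthal)) p => G p)) => [u|u|k j].
- exact: End_linear.
- exact: app_linear.
- exact: PK_bF.
Qed.

Lemma PK_out k : ~~ Pos.leb k 133 -> PK k = 0.
Proof. by rewrite /PK => /negPf->. Qed.

(** In particular e7 is closed under commutators. The table holds the pairs with l < k, compared as
    operators on the 56 basis vectors; antisymmetry gives the others. *)
Lemma comm_PK k l : 24 *: comm (PK k) (PK l) = ev PK (commC k l).
Proof.
rewrite /commC; case hk : (Pos.leb k 133); last first.
  by rewrite PK_out ?hk // scale_comm0l.
case hl : (Pos.leb l 133); last first.
  by rewrite (@PK_out l) ?hl // scale_comm0r.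
move: hk hl => /Pos.leb_spec0 hk /Pos.leb_spec0 hl; rewrite [_ && _]/=.
have main k' l' : (k' <= 133)%positive -> (l' < k')%positive ->
    24 *: comm (PK k') (PK l') = ev PK (look2 T7 k' l').
  move=> h1 h2; apply: (End_eq (@spans_bF K)) => j.
  rewrite evPK_bF scale_commE !PK_bF !PK_bind.
  have [hj|hj] := leqP (Pos.to_nat j) 56; last first.
    have pj m : ev bF (pC m j) = 0 by rewrite -PK_bF bF_out // linear0.
    by rewrite [RHS]ev_bind0 // -!PK_bind !pj !linear0 addr0 linear0.
  have h1' : (Pos.to_nat k' <= 133)%N by lia.
  have h2' : (Pos.to_nat l' <= (Pos.to_nat k').-1)%N by lia.
  have /(ev_eq bF) <- := all_upto (all_upto (all_upto T7_check h1') h2') hj.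
  by rewrite ev_axpy ev_nil addr0 /ccol ev_axpy ev_oppsv zK1 scale1r.
case: Pos.compare_spec => h.
- by rewrite h scale_commxx.
- by rewrite ev_oppsv -main // scale_commN.
- exact: main.
Qed.

Lemma comm_ev f g : 24 *: comm (ev PK f) (ev PK g) = ev PK (bind2 commC f g).
Proof.
apply: (ev_bind2 (F := fun F G => 24 *: comm F G)) => [F|G|k l].
- exact: scale_comm_linear.
- exact: scale_comm_linear_l.
- exact: comm_PK.
Qed.

Lemma jbracket_linear phi : linear (@jbracket K phi).
Proof. exact: comm_linear. Qed.

Lemma jbracket_linear_l psi : linear (fun phi : 'End(jordan) => jbracket phi psi).
Proof. exact: comm_linear_l. Qed.

Lemma jbracket_jtilde p q :
  8 *: jbracket (jtilde (bJ p)) (jtilde (bJ q)) = ev dK (wC p q).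
Proof.
have [hp|hp] := leqP (Pos.to_nat p) 27; last first.
  rewrite /wC TWE look2_tab leqNgt hp.
  by rewrite [bJ p]bJ_out // jtilde0 (linear_0 (jbracket_linear_l _)) scaler0.
have [hq|hq] := leqP (Pos.to_nat q) 27; last first.
  rewrite /wC TWE look2_tab andbC leqNgt hq.
  by rewrite [bJ q]bJ_out // jtilde0 (linear_0 (jbracket_linear _)) scaler0.
apply: (End_eq (@spans_bJ K)) => j.
have -> : ev dK (wC p q) (bJ j) = ev bJ (bind (dC^~ j) (wC p q)).
  by apply: (ev_bind (F := fun D : 'End(jordan) => D (bJ j)));
    [exact: app_linear|move=> k; exact: dK_bJ].
have [hj|hj] := leqP (Pos.to_nat j) 27; last first.
  have dj m : ev bJ (dC m j) = 0 by rewrite -dK_bJ bJ_out // linear0.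
  by rewrite [bJ j]bJ_out // linear0 ev_bind0.
have /(ev_eq bJ) <- := all_upto2 (all_upto wC_check hp) hq hj.
by rewrite ev_axpy ev_nil addr0 -dcol_ev !scale_lfunE scalerA -natrM.
Qed.

End Commutators.

(** * The cross product of the Freudenthal space in coordinates *)

Definition tv1 (p : positive) : sv :=
  if Pos.eqb p 1 then [:: (53, Zpos 1); (54, Zpos 1)]%positive
  else if Pos.eqb p 2 then [:: (54%positive, Zpos 1)]
  else if Pos.eqb p 3 then [::]
  else if Pos.leb p 27 then [:: (Pos.add p 51, Zpos 1)] else [::].

Definition splX (l : sv) : sv := cut 27 l.
Definition splY (l : sv) : sv :=
  foldr (fun kc s => if Pos.leb 28 kc.1 && Pos.leb kc.1 54
    then addk (Pos.sub kc.1 27) kc.2 s else s) [::] l.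

Definition fcrC (p q : sv) : sv :=
  let X := splX p in let Y := splY p in let x := coef 55 p in let y := coef 56 p in
  let Z := splX q in let W := splY q in let z := coef 55 q in let w := coef 56 q in
  axpy (Zpos 1) (cut 52 (axpy (Zneg 3) (bind2 wC X W) (axpy (Zneg 3) (bind2 wC Z Y) [::])))
  (axpy (Zpos 1) (bind tv1 (axpy (Zneg 6) (mC X W) (axpy (Zneg 6) (mC Z Y)
      (axpy (Z.mul (Zpos 2) (Z.add (formC X W) (formC Z Y))) oneC [::]))))
  (axpy (Zpos 1) (shift 78 27 (axpy (Zneg 3) (crossC Y W)
      (axpy (Z.mul (Zpos 6) x) Z (axpy (Z.mul (Zpos 6) z) X [::]))))
  (axpy (Zpos 1) (shift 105 27 (axpy (Zpos 3) (crossC X Z)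
      (axpy (Z.mul (Zneg 6) y) W (axpy (Z.mul (Zneg 6) w) Y [::]))))
  (addk 133 (Z.add (Z.add (formC X W) (formC Z Y))
      (Z.mul (Zneg 6) (Z.add (Z.mul x w) (Z.mul z y)))) [::])))).

Definition fskC (p q : sv) : Z :=
  Z.add (Z.sub (formC (splX p) (splY q)) (formC (splX q) (splY p)))
    (Z.mul (Zpos 2) (Z.sub (Z.mul (coef 55 p) (coef 56 q)) (Z.mul (coef 55 q) (coef 56 p)))).

Lemma tv1_check : all (fun p =>
  eqsv (axpy (Zpos 1) [:: (p, Zpos 1)] (addk 3 (Z.opp (trC [:: (p, Zpos 1)])) [::]))
    (bind tC (tv1 p)) &&
  all (fun kc => shape kc.1 (tC kc.1) [::] [::] Z0 && ~~ Pos.leb kc.1 52) (tv1 p))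
  (upto 27).
Proof. by vm_compute. Qed.

Lemma vee_scale (K : numFieldType) (V : lmodType K) (b t b' t' : V) :
  48 *: (- 2^-1 *: (b + t + (b' + t'))) =
  -3 *: (8 *: b) + -3 *: (8 *: b') + 2 *: (-12 *: (t + t')).
Proof.
rewrite !scalerA.
have -> : 48 * - 2^-1 = -24 :> K by field.
have -> : -3 * 8 = -24 :> K by ring.
have -> : 2 * -12 = -24 :> K by ring.
by rewrite -!scalerDr addrACA.
Qed.

Section Freudenthal.
Variable K : numFieldType.
Local Notation zK := (zK K).
Local Notation bJ := (bJ K).
Local Notation bF := (bF K).
Local Notation dK := (dK K).
Local Notation PK := (PK K).
Local Notation jordan := (jordan K).
Local Notation freudenthal := (freudenthal K).
Implicit Types (X Y Z W A B : jordan) (n : K).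

Lemma ev_spl l : ev bF l = (ev bJ (splX l), ev bJ (splY l), zK (coef 55 l), zK (coef 56 l)).
Proof.
elim: l => [|[k c] l IH] //=; rewrite IH.
case h1 : (Pos.leb k 27).
  have h2 : Pos.leb 28 k = false by move: h1 => /Pos.leb_spec0 h1; apply/Pos.leb_spec0; lia.
  have h3 : Pos.eqb 55 k = false by move: h1 => /Pos.leb_spec0 h1; apply/Pos.eqb_spec; lia.
  have h4 : Pos.eqb 56 k = false by move: h1 => /Pos.leb_spec0 h1; apply/Pos.eqb_spec; lia.
  rewrite h2 h3 h4 ev_addk /bF h1 frZ frD !scaler0 !add0r.
  by [].
have h1' : bF k = if Pos.leb k 54 then (0, bJ (Pos.sub k 27), 0, 0)
  else if Pos.eqb k 55 then (0, 0, 1, 0)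
  else if Pos.eqb k 56 then (0, 0, 0, 1) else 0 by rewrite /bF h1.
have -> : Pos.leb 28 k by move: h1 => /Pos.leb_spec0 h1; apply/Pos.leb_spec0; lia.
rewrite h1' !(Pos.eqb_sym _ k) andTb; case h2 : (Pos.leb k 54).
  have h3 : Pos.eqb k 55 = false by move: h2 => /Pos.leb_spec0 h2; apply/Pos.eqb_spec; lia.
  have h4 : Pos.eqb k 56 = false by move: h2 => /Pos.leb_spec0 h2; apply/Pos.eqb_spec; lia.
  by rewrite h3 h4 ev_addk frZ frD !scaler0 !add0r.
case h3 : (Pos.eqb k 55).
  have -> : Pos.eqb k 56 = false by move: h3 => /Pos.eqb_spec ->.
  by rewrite frZ frD !scaler0 !add0r zKD [_ *: 1]mulr1.
case h4 : (Pos.eqb k 56).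
  by rewrite frZ frD !scaler0 !add0r zKD [_ *: 1]mulr1.
by rewrite scaler0 add0r.
Qed.

Lemma fskew_ev p q : 2 * fskew (ev bF p) (ev bF q) = zK (fskC p q).
Proof.
rewrite !ev_spl /fskew /fskC /Z.sub !(zKD, zKN, zKM) -!jform_ev.
have -> : zK (Zpos 2) = 2 by [].
by ring.
Qed.

Definition PhiD (D : 'End(jordan)) : 'End(freudenthal) := Phi D 0 0 0.
Definition PhiA A : 'End(freudenthal) := Phi 0 (2 *: A) 0 0.
Definition PhiB B : 'End(freudenthal) := Phi 0 0 (2 *: B) 0.
(** The trace is removed along E_3, which involves no division by 3. In [Phi_split] the argument is
    trace-free, and there this is just doubling. *)
Definition tr0 A : jordan := 2 *: (A - jtr A *: bJ 3).
Definition PhiT A : 'End(freudenthal) := PhiD (jtilde (tr0 A)).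

Lemma PhiD_linear : linear PhiD.
Proof.
by move=> a u v; have := Phi_linear a u v 0 0 0 0 0 0; rewrite !scaler0 !addr0 mulr0.
Qed.
Lemma PhiA_linear : linear PhiA.
Proof.
move=> a u v; have := Phi_linear a 0 0 (2 *: u) (2 *: v) 0 0 0 0.
by rewrite !scaler0 !addr0 mulr0 /PhiA scalerDr !scalerA (mulrC 2 a).
Qed.
Lemma PhiB_linear : linear PhiB.
Proof.
move=> a u v; have := Phi_linear a 0 0 0 0 (2 *: u) (2 *: v) 0 0.
by rewrite !scaler0 !addr0 mulr0 /PhiB scalerDr !scalerA (mulrC 2 a).
Qed.

Lemma tr0_linear : linear tr0.
Proof.
move=> a u v; rewrite /tr0.
have -> : jtr (a *: u + v) = a * jtr u + jtr v by exact: jtr_linear.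
move: (jtr u) (jtr v) (bJ 3) => s r e.
apply: jordan_eq => [i|i l]; rewrite !mxE; ring.
Qed.

Lemma PhiT_linear : linear PhiT.
Proof.
by move=> a u v; rewrite /PhiT tr0_linear jtilde_linear; exact: PhiD_linear.
Qed.

Lemma PK_dK p : Pos.leb p 52 -> PK p = PhiD (dK p).
Proof.
move=> hp; have hp' : (Pos.to_nat p <= 52)%N by move: hp => /Pos.leb_spec0; lia.
rewrite (PK_shape _ (all_upto shape_f4 hp')) !ev_nil scaler0 jtilde0 addr0.
by rewrite zK0 mulr0.
Qed.

Lemma PK_A p : Pos.leb p 27 -> PK (Pos.add p 78) = PhiA (bJ p).
Proof.
move=> hp; have hp' : (Pos.to_nat p <= 27)%N by move: hp => /Pos.leb_spec0; lia.
have /andP[h1 h2] := all_upto shape_A hp'.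
by rewrite (PK_shape _ h1) (dK_out _ h2) !ev_nil ev1 !scaler0 jtilde0 addr0 zK0 mulr0.
Qed.

Lemma PK_B p : Pos.leb p 27 -> PK (Pos.add p 105) = PhiB (bJ p).
Proof.
move=> hp; have hp' : (Pos.to_nat p <= 27)%N by move: hp => /Pos.leb_spec0; lia.
have /andP[h1 h2] := all_upto shape_B hp'.
by rewrite (PK_shape _ h1) (dK_out _ h2) !ev_nil ev1 !scaler0 jtilde0 addr0 zK0 mulr0.
Qed.

Lemma PK_T p : PhiT (bJ p) = ev PK (tv1 p).
Proof.
case hp : (Pos.leb p 27); last first.
  rewrite bJ_out' ?hp // (linear_0 PhiT_linear) /tv1 hp.
  by do !(case: Pos.eqb_spec => [e|_]; first by rewrite e in hp).
have hp' : (Pos.to_nat p <= 27)%N by move: hp => /Pos.leb_spec0; lia.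
have /andP[/(ev_eq bJ) e ha] := all_upto tv1_check hp'.
have {}e : tr0 (bJ p) = 2 *: ev bJ (bind tC (tv1 p)).
  rewrite /tr0 -e ev_axpy ev_addk ev_nil addr0 ev1 zK1 scale1r zKN -jtr_ev ev1.
  by rewrite scaleNr.
rewrite /PhiT e; elim: (tv1 p) ha {e} => [|[k c] l IH] /=.
  by rewrite scaler0 jtilde0 (linear_0 PhiD_linear).
move=> /andP[/andP[h1 h2] /IH h3]; rewrite /bind /= ev_axpy -h3.
rewrite (PK_shape _ h1) (dK_out _ h2) !ev_nil scaler0 zK0 mulr0 add0r.
rewrite scalerDr scalerA mulrC -scalerA jtilde_linear; exact: PhiD_linear.
Qed.

Lemma PK_n : PK 133 = Phi 0 0 0 3.
Proof.
have h : shape 133 [::] [::] [::] (Zpos 1) by vm_compute.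
by rewrite (PK_shape _ h) dK_out // !ev_nil !scaler0 jtilde0 addr0 zK1 mulr1.
Qed.

Lemma Phi_split D T A B n : jtr T = 0 ->
  Phi (D + jtilde (2 *: T)) (2 *: A) (2 *: B) (3 * n) =
  PhiD D + (PhiT T + (PhiA A + (PhiB B + n *: PK 133))).
Proof.
move=> hT; have -> : n *: PK 133 = Phi 0 0 0 (3 * n).
  by rewrite PK_n -Phi_Z !scaler0 mulrC.
rewrite /PhiT /tr0 /PhiD /PhiA /PhiB hT scale0r subr0 -!Phi_D.
by rewrite !addr0 !add0r.
Qed.

Lemma Phi_eq D D' A A' B B' n n' : D = D' -> A = A' -> B = B' -> n = n' ->
  Phi D A B n = Phi D' A' B' n'.
Proof. by move=> -> -> -> ->. Qed.

Lemma fcross_ev p q : 48 *: fcross (ev bF p) (ev bF q) = ev PK (fcrC p q).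
Proof.
rewrite !ev_spl /fcross /fcrC -Phi_Z.
move: (splX p) (splY p) (coef 55 p) (coef 56 p) => X Y x y.
move: (splX q) (splY q) (coef 55 q) (coef 56 q) => Z W z w.
set d := axpy (Zneg 3) (bind2 wC X W) _; set t := axpy (Zneg 6) (mC X W) _.
set a := axpy (Zneg 3) (crossC Y W) _; set b := axpy (Zpos 3) (crossC X Z) _.
set n := Z.add _ (Z.mul (Zneg 6) _).
rewrite !ev_axpy ev_addk ev_nil addr0 zK1 !scale1r.
rewrite (ev_cut d PhiD_linear PK_dK (dK_out K)).
rewrite -(ev_bind t PhiT_linear PK_T).
rewrite (ev_shift a PhiA_linear PK_A (@bJ_out' K)) (ev_shift b PhiB_linear PK_B (@bJ_out' K)).
have f2 U V : jform (ev bJ U) (ev bJ V) = 2^-1 * zK (formC U V).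
  by rewrite -jform_ev mulrA mulVf ?mul1r // pnatr_eq0.
have m2 U V : jmul (ev bJ U) (ev bJ V) = 2^-1 *: ev bJ (mC U V).
  by rewrite -jmul_ev scalerA mulVf ?scale1r // pnatr_eq0.
have c4 U V : jcross (ev bJ U) (ev bJ V) = 4^-1 *: ev bJ (crossC U V).
  by rewrite -jcross_ev scalerA mulVf ?scale1r // pnatr_eq0.
have zs : [/\ zK (Zneg 3) = -3, zK (Zneg 6) = -6, zK (Zpos 6) = 6, zK (Zpos 2) = 2
   & zK (Zpos 3) = 3] by [].
case: zs => z1 z2 z3 z4 z5.
have one3 : jtr (jone K) = 3 by rewrite /jtr !big_ord_recl big_ord0 !mxE; ring.
(* The constant comes from 48 * (-1/2) = 2 * (-12), the 2 being the one contained in [PhiT]. The two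
   summands are the trace-free multiplications in the two [jvee]. *)
have tE : ev bJ t = -12 *: (jmul (ev bJ X) (ev bJ W) - (3^-1 * jform (ev bJ X) (ev bJ W)) *: jone K
    + (jmul (ev bJ Z) (ev bJ Y) - (3^-1 * jform (ev bJ Z) (ev bJ Y)) *: jone K)).
  rewrite /t !ev_axpy ev_nil addr0 -jone_ev !m2 !f2 !(zKM, zKD) z2 z4.
  move: (ev bJ _) (ev bJ _) (zK _) (zK _) (jone K) => u1 u2 c1 c2 e.
  by apply: jordan_eq => [i|i l]; rewrite !(jZ_1, jZ_2, jD_1, jD_2) ?mxE; field.
have ht : jtr (ev bJ t) = 0.
  have lt := @jtr_linear K.
  rewrite tE (linear_Z _ _ lt) !(linear_D _ _ lt) -!scaleNr !(linear_Z _ _ lt) one3.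
  by rewrite /GRing.scale /= /jform; field.
rewrite -Phi_split //; apply: Phi_eq.
- have br8 U V : 8 *: jbracket (jtilde (ev bJ U)) (jtilde (ev bJ V)) = ev dK (bind2 wC U V).
    apply: (ev_bind2 (F := fun U V : jordan => 8 *: jbracket (jtilde U) (jtilde V)))
      => [u a' v v'|u a' v v'|k l]; last exact: jbracket_jtilde.
      by rewrite jtilde_linear jbracket_linear scalerDr !scalerA mulrC.
    by rewrite jtilde_linear jbracket_linear_l scalerDr !scalerA mulrC.
  rewrite tE /jvee /d !ev_axpy ev_nil addr0 -!br8 z1.
  set U1 := (jmul (ev bJ X) _ - _); set U2 := (jmul (ev bJ Z) _ - _).
  by rewrite !jtilde_Z jtilde_D; exact: vee_scale.
- rewrite c4 /a; move: (crossC Y W) => k1; rewrite !ev_axpy ev_nil addr0 !zKM z1 z3.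
  move: (ev bJ k1) (ev bJ _) (ev bJ _) (zK _) (zK _) => u1 u2 u3 c1 c2.
  by apply: jordan_eq => [i|i l]; rewrite !(jZ_1, jZ_2, jD_1, jD_2) ?mxE; field.
- rewrite c4 /b; move: (crossC X Z) => k1; rewrite !ev_axpy ev_nil addr0 !zKM z5 z2.
  move: (ev bJ k1) (ev bJ _) (ev bJ _) (zK _) (zK _) => u1 u2 u3 c1 c2.
  by apply: jordan_eq => [i|i l]; rewrite !(jZ_1, jZ_2, jD_1, jD_2) ?mxE; field.
- by rewrite /n !f2 !(zKD, zKM) z2; field.
Qed.

End Freudenthal.

(** * The bracket of e8 *)

Definition e8C : Type := (sv * sv * sv * Z * Z * Z)%type.

Definition flatL (x : e8C) : sv :=
  let: (f, P, Q, r, s, t) := x in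
  axpy (Zpos 1) (cut 133 f) (axpy (Zpos 1) (shift 133 56 P) (axpy (Zpos 1) (shift 189 56 Q)
    (addk 246 r (addk 247 s (addk 248 t [::]))))).

(* The basis of e8: indices 1-133 are e7, 134-189 and 190-245 the two copies of P, and     *)
(* 246, 247, 248 the coordinates r, s, t.                                                 *)
Definition unitL (p : positive) : e8C :=
  if Pos.leb p 133 then ([:: (p, Zpos 1)], [::], [::], Z0, Z0, Z0)
  else if Pos.leb p 189 then ([::], [:: (Pos.sub p 133, Zpos 1)], [::], Z0, Z0, Z0)
  else if Pos.leb p 245 then ([::], [::], [:: (Pos.sub p 189, Zpos 1)], Z0, Z0, Z0)
  else if Pos.eqb p 246 then ([::], [::], [::], Zpos 1, Z0, Z0)
  else if Pos.eqb p 247 then ([::], [::], [::], Z0, Zpos 1, Z0)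
  else if Pos.eqb p 248 then ([::], [::], [::], Z0, Z0, Zpos 1)
  else ([::], [::], [::], Z0, Z0, Z0).

Definition bracketC (x y : e8C) : e8C :=
  let: (f1, P1, Q1, r1, s1, t1) := x in
  let: (f2, P2, Q2, r2, s2, t2) := y in
  (axpy (Zpos 2) (bind2 commC f1 f2) (axpy (Zpos 1) (fcrC P1 Q2) (axpy (Zneg 1) (fcrC P2 Q1) [::])),
   axpy (Zpos 48) (bind2 pC f1 P2) (axpy (Zneg 48) (bind2 pC f2 P1)
    (axpy (Z.mul (Zpos 48) r1) P2 (axpy (Z.mul (Zneg 48) r2) P1
    (axpy (Z.mul (Zpos 48) s1) Q2 (axpy (Z.mul (Zneg 48) s2) Q1 [::]))))),
   axpy (Zpos 48) (bind2 pC f1 Q2) (axpy (Zneg 48) (bind2 pC f2 Q1)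
    (axpy (Z.mul (Zneg 48) r1) Q2 (axpy (Z.mul (Zpos 48) r2) Q1
    (axpy (Z.mul (Zpos 48) t1) P2 (axpy (Z.mul (Zneg 48) t2) P1 [::]))))),
   Z.add (Z.add (Z.mul (Zneg 3) (fskC P1 Q2)) (Z.mul (Zpos 3) (fskC P2 Q1)))
     (Z.add (Z.mul (Zpos 48) (Z.mul s1 t2)) (Z.mul (Zneg 48) (Z.mul s2 t1))),
   Z.add (Z.mul (Zpos 6) (fskC P1 P2))
     (Z.add (Z.mul (Zpos 96) (Z.mul r1 s2)) (Z.mul (Zneg 96) (Z.mul r2 s1))),
   Z.add (Z.mul (Zneg 6) (fskC Q1 Q2))
     (Z.add (Z.mul (Zneg 96) (Z.mul r1 t2)) (Z.mul (Zpos 96) (Z.mul r2 t1)))).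

Definition brC (p q : positive) : sv := flatL (bracketC (unitL p) (unitL q)).

Definition TL := Eval vm_compute in tab2 brC 248 248.

Lemma TLE : TL = tab2 brC 248 248.
Proof. by vm_compute. Qed.

Definition brL : positive -> positive -> sv := look2 TL.

Section E8Table.
Variable K : numFieldType.
Local Notation zK := (zK K).
Local Notation bJ := (bJ K).
Local Notation bF := (bF K).
Local Notation PK := (PK K).
Local Notation jordan := (jordan K).
Local Notation freudenthal := (freudenthal K).
Local Notation e7 := (e7 K).
Local Notation e8 := (e8 K).

Lemma add_scale_pair (V : lmodType K) (a : K) (b t b' t' : V) :
  (a *: b + b') + (a *: t + t') = a *: (b + t) + (b' + t').
Proof. by rewrite addrACA -scalerDr. Qed.

Lemma jvee_linear X : linear (@jvee K X).
Proof.
move=> a u v; rewrite /jvee jtilde_linear jbracket_linear jmul_linear.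
have -> : jform X (a *: u + v) = a * jform X u + jform X v by exact: jform_linear.
have -> : a *: jmul X u + jmul X v - (3^-1 * (a * jform X u + jform X v)) *: jone K =
   a *: (jmul X u - (3^-1 * jform X u) *: jone K) + (jmul X v - (3^-1 * jform X v) *: jone K).
  rewrite scalerBr scalerA addrACA -opprD -scalerDl; congr (_ - _ *: _); ring.
move: (jmul X u - _) (jmul X v - _) => U V.
by rewrite jtilde_linear; exact: add_scale_pair.
Qed.

Lemma jvee_linear_l Y : linear (fun X => @jvee K X Y).
Proof.
move=> a u v; rewrite /jvee jtilde_linear jbracket_linear_l jmul_linear_l.
have -> : jform (a *: u + v) Y = a * jform u Y + jform v Y by exact: jform_linear_l.
have -> : a *: jmul u Y + jmul v Y - (3^-1 * (a * jform u Y + jform v Y)) *: jone K =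
   a *: (jmul u Y - (3^-1 * jform u Y) *: jone K) + (jmul v Y - (3^-1 * jform v Y) *: jone K).
  rewrite scalerBr scalerA addrACA -opprD -scalerDl; congr (_ - _ *: _); ring.
move: (jmul u Y - _) (jmul v Y - _) => U V.
by rewrite jtilde_linear; exact: add_scale_pair.
Qed.

Lemma fcrossC (p q : freudenthal) : fcross p q = fcross q p.
Proof.
case: p q => [[[X Y] x] y] [[[Z W] z] w]; rewrite /fcross; apply: Phi_eq.
- by rewrite addrC.
- by rewrite jcrossC addrAC.
- by rewrite jcrossC addrAC.
- by congr (_ * _); ring.
Qed.

Lemma vee_pair (V : lmodType K) (a c : K) (b t b' t' : V) :
  c *: ((a *: b + b') + (a *: t + t')) = a *: (c *: (b + t)) + c *: (b' + t').
Proof. by rewrite add_scale_pair scalerDr !scalerA mulrC. Qed.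

Lemma fcross_linear (p : freudenthal) : linear (fcross p).
Proof.
case: p => [[[X Y] x] y] a [[[Z W] z] w] [[[Z' W'] z'] w'].
rewrite frZ frD /fcross -Phi_linear; apply: Phi_eq.
- by rewrite jvee_linear jvee_linear_l; exact: vee_pair.
- rewrite jcross_linear [a *: (z : K^o)]/GRing.scale /=.
  move: (jcross Y W) (jcross Y W') => u v.
  by apply: jordan_eq => [i|i l]; rewrite !(jZ_1, jZ_2, jD_1, jD_2) ?mxE; field.
- rewrite jcross_linear [a *: (w : K^o)]/GRing.scale /=.
  move: (jcross X Z) (jcross X Z') => u v.
  by apply: jordan_eq => [i|i l]; rewrite !(jZ_1, jZ_2, jD_1, jD_2) ?mxE; field.
have -> : jform X (a *: W + W') = a * jform X W + jform X W' by exact: jform_linear.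
have -> : jform (a *: Z + Z') Y = a * jform Z Y + jform Z' Y by exact: jform_linear_l.
by rewrite /GRing.scale /=; ring.
Qed.

Lemma fskewN (p q : freudenthal) : fskew p q = - fskew q p.
Proof.
case: p q => [[[X Y] x] y] [[[Z W] z] w]; rewrite /fskew (jformC Z) (jformC X).
by ring.
Qed.

Lemma fskew_linear (p : freudenthal) : linear (fskew p : freudenthal -> K^o).
Proof.
case: p => [[[X Y] x] y] a [[[Z W] z] w] [[[Z' W'] z'] w'].
rewrite frZ frD /fskew.
have -> : jform X (a *: W + W') = a * jform X W + jform X W' by exact: jform_linear.
have -> : jform (a *: Z + Z') Y = a * jform Z Y + jform Z' Y by exact: jform_linear_l.
by rewrite /GRing.scale /=; ring.
Qed.

End E8Table.

Lemma add_scale_sub (K : numFieldType) (V : lmodType K) (a : K) (b t b' t' : V) :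
  (a *: b + b') - (a *: t + t') = a *: (b - t) + (b' - t').
Proof. by rewrite opprD -scalerN add_scale_pair. Qed.

Section GradedBracket.
Variables (K : numFieldType) (S E F : lmodType K).
Variables (val : S -> E) (prj : E -> S) (act : E -> F -> F) (cm : E -> E -> E).
Variables (cr : F -> F -> E) (om : F -> F -> K).
Local Notation L := (S * F * F * K^o * K^o * K^o)%type.

(** The e8 bracket over abstract summands. Linearity, antisymmetry and the coordinate formula are
    derived for variables, and reach the concrete bracket by conversion in [gbr8E]. *)
Definition gbr (x y : L) : L :=
  let: (f1, P1, Q1, r1, s1, t1) := x in
  let: (f2, P2, Q2, r2, s2, t2) := y in
  (prj (cm (val f1) (val f2) + cr P1 Q2 - cr P2 Q1),
   act (val f1) P2 - act (val f2) P1 + r1 *: P2 - r2 *: P1 + s1 *: Q2 - s2 *: Q1,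
   act (val f1) Q2 - act (val f2) Q1 - r1 *: Q2 + r2 *: Q1 + t1 *: P2 - t2 *: P1,
   - 8^-1 * om P1 Q2 + 8^-1 * om P2 Q1 + s1 * t2 - s2 * t1,
   4^-1 * om P1 P2 + 2 * r1 * s2 - 2 * r2 * s1,
   - 4^-1 * om Q1 Q2 - 2 * r1 * t2 + 2 * r2 * t1).

Hypotheses (lval : linear val) (lprj : linear prj).
Hypotheses (lact : forall f, linear (act f)) (lact_l : forall p, linear (act^~ p)).
Hypotheses (lcm : forall f, linear (cm f)) (cmN : forall f g, cm f g = - cm g f).
Hypotheses (lcr : forall p, linear (cr p)) (crC : forall p q, cr p q = cr q p).
Hypotheses (lom : forall p, linear (om p : F -> K^o)) (omN : forall p q, om p q = - om q p).

Lemma L_eq (x1 y1 : S) (x2 y2 x3 y3 : F) (x4 y4 x5 y5 x6 y6 : K^o) :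
  x1 = y1 -> x2 = y2 -> x3 = y3 -> x4 = y4 -> x5 = y5 -> x6 = y6 ->
  ((x1, x2, x3, x4, x5, x6) : L) = (y1, y2, y3, y4, y5, y6).
Proof. by move=> -> -> -> -> -> ->. Qed.

Lemma LZ a (x1 : S) (x2 x3 : F) (x4 x5 x6 : K^o) :
  a *: ((x1, x2, x3, x4, x5, x6) : L) = (a *: x1, a *: x2, a *: x3, a *: x4, a *: x5, a *: x6).
Proof. by []. Qed.

Lemma LD (x1 y1 : S) (x2 y2 x3 y3 : F) (x4 y4 x5 y5 x6 y6 : K^o) :
  ((x1, x2, x3, x4, x5, x6) : L) + (y1, y2, y3, y4, y5, y6) =
  (x1 + y1, x2 + y2, x3 + y3, x4 + y4, x5 + y5, x6 + y6).
Proof. by []. Qed.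

Let zl (V : lmodType K) (a : K) : 0 = a *: 0 + 0 :> V.
Proof. by rewrite scaler0 addr0. Qed.

Lemma in0_linear : linear (fun x : S => (x, 0, 0, 0, 0, 0) : L).
Proof. by move=> a f g; rewrite LZ LD; apply: L_eq => //; exact: zl. Qed.
Lemma in2_linear : linear (fun P : F => (0, P, 0, 0, 0, 0) : L).
Proof. by move=> a f g; rewrite LZ LD; apply: L_eq => //; exact: zl. Qed.
Lemma in3_linear : linear (fun P : F => (0, 0, P, 0, 0, 0) : L).
Proof. by move=> a f g; rewrite LZ LD; apply: L_eq => //; exact: zl. Qed.

Lemma L_split (x1 : S) (x2 x3 : F) (x4 x5 x6 : K^o) :
  (x1, x2, x3, x4, x5, x6) = ((x1, 0, 0, 0, 0, 0) : L) + (((0, x2, 0, 0, 0, 0) : L)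
  + (((0, 0, x3, 0, 0, 0) : L) + (x4 *: ((0, 0, 0, 1, 0, 0) : L)
  + (x5 *: ((0, 0, 0, 0, 1, 0) : L) + x6 *: ((0, 0, 0, 0, 0, 1) : L))))) :> L.
Proof.
have h1 (c : K) : c *: (1 : K^o) = c by rewrite /GRing.scale /= mulr1.
have r1 (V : lmodType K) (x : V) : x = x + (0 + (0 + (x4 *: 0 + (x5 *: 0 + x6 *: 0)))).
  by rewrite !scaler0 !addr0.
have r2 (V : lmodType K) (x : V) : x = 0 + (x + (0 + (x4 *: 0 + (x5 *: 0 + x6 *: 0)))).
  by rewrite !scaler0 !addr0 add0r.
have r3 (V : lmodType K) (x : V) : x = 0 + (0 + (x + (x4 *: 0 + (x5 *: 0 + x6 *: 0)))).
  by rewrite !scaler0 !addr0 !add0r.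
have r4 (V : lmodType K) (x y : V) : x4 *: y = x -> x = 0 + (0 + (0 + (x4 *: y + (x5 *: 0 + x6 *: 0)))).
  by move=> ->; rewrite !scaler0 !addr0 !add0r.
have r5 (V : lmodType K) (x y : V) : x5 *: y = x -> x = 0 + (0 + (0 + (x4 *: 0 + (x5 *: y + x6 *: 0)))).
  by move=> ->; rewrite !scaler0 !addr0 !add0r.
have r6 (V : lmodType K) (x y : V) : x6 *: y = x -> x = 0 + (0 + (0 + (x4 *: 0 + (x5 *: 0 + x6 *: y)))).
  by move=> ->; rewrite !scaler0 !add0r.
rewrite !LZ !LD; apply: L_eq.
- exact: (r1 S).
- exact: (r2 F).
- exact: (r3 F).
- exact: (r4 K^o _ _ (h1 x4)).
- exact: (r5 K^o _ _ (h1 x5)).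
- exact: (r6 K^o _ _ (h1 x6)).
Qed.

Lemma gbrN x y : gbr x y = - gbr y x.
Proof.
case: x y => [[[[[f1 P1] Q1] r1] s1] t1] [[[[[f2 P2] Q2] r2] s2] t2].
rewrite -scaleN1r /gbr LZ; apply: L_eq.
- by rewrite -(linear_Z _ _ lprj) scaleN1r cmN !opprD opprK addrAC.
- by rewrite scaleN1r !opprD !opprK [- _ + _]addrC -!addrA; congr (_ + _);
  congr (_ + _); rewrite addrCA; do 2! congr (_ + _); rewrite addrC.
- by rewrite scaleN1r !opprD !opprK [- _ + _]addrC -!addrA; congr (_ + _);
  congr (_ + _); rewrite addrCA; do 2! congr (_ + _); rewrite addrC.
- by rewrite (omN P1) (omN P2) /GRing.scale /=; have := omN P2 Q1; rewrite (omN Q1) => ->; ring.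
- by rewrite (omN P1) /GRing.scale /=; ring.
- by rewrite (omN Q1) /GRing.scale /=; ring.
Qed.

Lemma gbr_linear x : linear (gbr x).
Proof.
case: x => [[[[[f1 P1] Q1] r1] s1] t1] a [[[[[f2 P2] Q2] r2] s2] t2]
  [[[[[f3 P3] Q3] r3] s3] t3].
have hl (b b' : K) (U : F) : (a * b + b') *: U = a *: (b *: U) + b' *: U.
  by rewrite scalerDl scalerA.
have hr b (U U' : F) : b *: (a *: U + U') = a *: (b *: U) + b *: U'.
  by rewrite scalerDr !scalerA mulrC.
have omr p u v : om p (a *: u + v) = a * om p u + om p v by exact: lom.
have oml p u v : om (a *: u + v) p = a * om u p + om v p.
  by rewrite omN omr (omN u) (omN v); ring.
rewrite LZ LD /gbr LZ LD; apply: L_eq.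
- by rewrite lval lcm lcr (crC _ Q1) lcr !(crC Q1) add_scale_pair add_scale_sub lprj.
- rewrite lval (lact_l P1) !lact ![_ *: r2 + _]/(a * r2 + r3) ![_ *: s2 + _]/(a * s2 + s3).
  by rewrite !hl !hr add_scale_sub !(add_scale_pair, add_scale_sub).
- rewrite lval (lact_l Q1) !lact ![_ *: r2 + _]/(a * r2 + r3) ![_ *: t2 + _]/(a * t2 + t3).
  by rewrite !hl !hr add_scale_sub !(add_scale_pair, add_scale_sub).
- by rewrite omr oml /GRing.scale /=; ring.
- by rewrite omr /GRing.scale /=; ring.
- by rewrite omr /GRing.scale /=; ring.
Qed.

Let zK_3 : zK K (Zpos 3) = 3. Proof. by []. Qed.
Let zK_m3 : zK K (Zneg 3) = - 3. Proof. by []. Qed.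
Let zK_6 : zK K (Zpos 6) = 6. Proof. by []. Qed.
Let zK_m6 : zK K (Zneg 6) = - 6. Proof. by []. Qed.
Let zK_48 : zK K (Zpos 48) = 48. Proof. by []. Qed.
Let zK_m48 : zK K (Zneg 48) = - 48. Proof. by []. Qed.
Let zK_96 : zK K (Zpos 96) = 96. Proof. by []. Qed.
Let zK_m96 : zK K (Zneg 96) = - 96. Proof. by []. Qed.
Variables (bE : positive -> E) (bF : positive -> F).
Hypothesis act_ev : forall f x, act (ev bE f) (ev bF x) = ev bF (bind2 pC f x).
Hypothesis cm_ev : forall f g, 24 *: cm (ev bE f) (ev bE g) = ev bE (bind2 commC f g).
Hypothesis cr_ev : forall p q, 48 *: cr (ev bF p) (ev bF q) = ev bE (fcrC p q).
Hypothesis om_ev : forall p q, 2 * om (ev bF p) (ev bF q) = zK K (fskC p q).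
Hypothesis val_prj : forall f, val (prj (ev bE f)) = ev bE f.

Definition elC (x : e8C) : L :=
  let: (f, P, Q, r, s, t) := x in
  (prj (ev bE f), ev bF P, ev bF Q, zK K r, zK K s, zK K t).

Lemma gbr_elC x y : 48 *: gbr (elC x) (elC y) = elC (bracketC x y).
Proof.
case: x y => [[[[[f1 P1] Q1] r1] s1] t1] [[[[[f2 P2] Q2] r2] s2] t2].
rewrite /elC /gbr /bracketC LZ !val_prj; apply: L_eq.
- rewrite -(linear_Z _ _ lprj) 3!ev_axpy ev_nil addr0 -cm_ev -!cr_ev zK1 zKN1.
  by rewrite scale1r scaleN1r scalerBr scalerDr scalerA -natrM -addrA.
- rewrite !act_ev !ev_axpy ev_nil addr0 !zKM !scalerDr !scalerN !scalerA -!addrA.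
  rewrite zK_m48.
  by rewrite !mulNr !scaleNr.
- rewrite !act_ev !ev_axpy ev_nil addr0 !zKM !scalerDr !scalerN !scalerA -!addrA.
  rewrite zK_m48.
  by rewrite !mulNr !scaleNr.
- have := om_ev P1 Q2; have := om_ev P2 Q1.
  move: (fskC P2 Q1) (fskC P1 Q2) => u v e1 e2.
  rewrite !(zKD, zKM) -e1 -e2 zK_m3 zK_3 zK_m48 zK_48; move: (om _ _) (om _ _) => a b.
  by rewrite /GRing.scale /=; field.
- have := om_ev P1 P2; move: (fskC P1 P2) => u e1.
  rewrite !(zKD, zKM) -e1 zK_96 zK_m96 zK_6; move: (om _ _) => a.
  by rewrite /GRing.scale /=; field.
- have := om_ev Q1 Q2; move: (fskC Q1 Q2) => u e1.
  rewrite !(zKD, zKM) -e1 zK_96 zK_m96 zK_m6; move: (om _ _) => a.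
  by rewrite /GRing.scale /=; field.
Qed.

End GradedBracket.

(** * The 248 basis elements of e8 and their brackets *)

Section E8Basis.
Variable K : numFieldType.
Local Notation e8 := (e8 K).
Local Notation freudenthal := (freudenthal K).
Local Notation PK := (PK K).
Local Notation bF := (bF K).
Local Notation zK := (zK K).

Definition act7 (f : 'End(freudenthal)) (p : freudenthal) : freudenthal := f p.

Definition gbr8 : e8 -> e8 -> e8 :=
  gbr (@vsval K _ (e7 K)) (vsproj (e7 K)) act7 (@comm K _) (@fcross K) (@fskew K).

Lemma gbr8E : @e8_bracket K = gbr8.
Proof. by []. Qed.

Lemma vsval_linear : linear (@vsval K _ (e7 K)).
Proof. by move=> a u v; rewrite linearP. Qed.

Lemma act7_linear f : linear (act7 f).
Proof. by move=> a u v; rewrite /act7 linearP. Qed.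

Lemma act7_linear_l p : linear (act7^~ p).
Proof. by move=> a u v; rewrite /act7 lfun_linE. Qed.

Lemma br_linear (x : e8) : linear (e8_bracket x).
Proof.
rewrite gbr8E; apply: gbr_linear.
- exact: vsval_linear.
- exact: vsproj_is_linear.
- exact: act7_linear.
- exact: act7_linear_l.
- exact: comm_linear.
- exact: fcross_linear.
- exact: fcrossC.
- exact: fskew_linear.
- exact: fskewN.
Qed.

Lemma brN (x y : e8) : e8_bracket x y = - e8_bracket y x.
Proof.
rewrite gbr8E; apply: gbrN.
- exact: vsproj_is_linear.
- exact: commN.
- exact: fskewN.
Qed.

Lemma br_linear_l (y : e8) : linear (fun x => e8_bracket x y).
Proof. by move=> a u v; rewrite !(brN _ y) br_linear opprD -scalerN. Qed.

Lemma ev_PK_e7 f : ev PK f \in e7 K.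
Proof.
elim: f => [|[k c] f IH]; first exact: mem0v.
by apply: memvD IH; apply: memvZ; exact: in_e7_PK.
Qed.

Lemma val_prj8 f : vsval (vsproj (e7 K) (ev PK f)) = ev PK f.
Proof. by rewrite vsprojK // ev_PK_e7. Qed.

Definition el8 : e8C -> e8 := elC (vsproj (e7 K)) PK bF.

Lemma br_el8 x y : 48 *: e8_bracket (el8 x) (el8 y) = el8 (bracketC x y).
Proof.
rewrite gbr8E; apply: gbr_elC.
- exact: vsproj_is_linear.
- by move=> f p; rewrite /act7 evPK_ev.
- exact: comm_ev.
- exact: fcross_ev.
- exact: fskew_ev.
- exact: val_prj8.
Qed.

Definition bL (p : positive) : e8 := el8 (unitL p).

Definition inP1 (f : 'End(freudenthal)) : e8 := (vsproj (e7 K) f, 0, 0, 0, 0, 0).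
Definition inP2 (P : freudenthal) : e8 := (0, P, 0, 0, 0, 0).
Definition inP3 (P : freudenthal) : e8 := (0, 0, P, 0, 0, 0).

Lemma e8D (x1 y1 : subvs_of (e7 K)) (x2 y2 x3 y3 : freudenthal) (x4 y4 x5 y5 x6 y6 : K^o) :
  ((x1, x2, x3, x4, x5, x6) : e8) + (y1, y2, y3, y4, y5, y6) =
  (x1 + y1, x2 + y2, x3 + y3, x4 + y4, x5 + y5, x6 + y6).
Proof. by []. Qed.

Lemma e8Z a (x1 : subvs_of (e7 K)) (x2 x3 : freudenthal) (x4 x5 x6 : K^o) :
  a *: ((x1, x2, x3, x4, x5, x6) : e8) =
  (a *: x1, a *: x2, a *: x3, a *: x4, a *: x5, a *: x6).
Proof. by []. Qed.

Lemma inP1_linear : linear inP1.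
Proof.
move=> a f g.
have -> : inP1 (a *: f + g) = (a *: vsproj (e7 K) f + vsproj (e7 K) g, 0, 0, 0, 0, 0).
  by rewrite /inP1 vsproj_is_linear.
exact: (@in0_linear K (subvs_of (e7 K)) freudenthal).
Qed.
Lemma inP2_linear : linear inP2.
Proof. exact: (@in2_linear K (subvs_of (e7 K)) freudenthal). Qed.
Lemma inP3_linear : linear inP3.
Proof. exact: (@in3_linear K (subvs_of (e7 K)) freudenthal). Qed.

Lemma bL_1 p : Pos.leb p 133 -> bL p = inP1 (PK p).
Proof. by move=> h; rewrite /bL /unitL h /el8 /elC ev1. Qed.

Lemma bL_2 p : Pos.leb p 56 -> bL (Pos.add p 133) = inP2 (bF p).
Proof.
move=> h; rewrite /bL /unitL.
have -> : Pos.leb (p + 133) 133 = false by apply/negP => /Pos.leb_spec0; lia.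
have -> : Pos.leb (p + 133) 189 by apply/Pos.leb_spec0; move/Pos.leb_spec0: h; lia.
have -> : Pos.sub (p + 133) 133 = p by lia.
by rewrite /el8 /elC ev1 !ev_nil linear0.
Qed.

Lemma bL_3 p : Pos.leb p 56 -> bL (Pos.add p 189) = inP3 (bF p).
Proof.
move=> h; rewrite /bL /unitL.
have -> : Pos.leb (p + 189) 133 = false by apply/negP => /Pos.leb_spec0; lia.
have -> : Pos.leb (p + 189) 189 = false by apply/negP => /Pos.leb_spec0; lia.
have -> : Pos.leb (p + 189) 245 by apply/Pos.leb_spec0; move/Pos.leb_spec0: h; lia.
have -> : Pos.sub (p + 189) 189 = p by lia.
by rewrite /el8 /elC ev1 !ev_nil linear0.
Qed.

Lemma bL_4 : bL 246 = (0, 0, 0, 1, 0, 0).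
Proof.
rewrite /bL (_ : unitL 246 = ([::], [::], [::], Zpos 1, Z0, Z0)) //.
by rewrite /el8 /elC !ev_nil linear0.
Qed.
Lemma bL_5 : bL 247 = (0, 0, 0, 0, 1, 0).
Proof.
rewrite /bL (_ : unitL 247 = ([::], [::], [::], Z0, Zpos 1, Z0)) //.
by rewrite /el8 /elC !ev_nil linear0.
Qed.
Lemma bL_6 : bL 248 = (0, 0, 0, 0, 0, 1).
Proof.
rewrite /bL (_ : unitL 248 = ([::], [::], [::], Z0, Z0, Zpos 1)) //.
by rewrite /el8 /elC !ev_nil linear0.
Qed.

Lemma e8_split (x1 : subvs_of (e7 K)) (x2 x3 : freudenthal) (x4 x5 x6 : K^o) :
  (x1, x2, x3, x4, x5, x6) = (x1, 0, 0, 0, 0, 0) + (inP2 x2 + (inP3 x3 +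
   (x4 *: bL 246 + (x5 *: bL 247 + x6 *: bL 248)))).
Proof.
rewrite bL_4 bL_5 bL_6.
exact: (@L_split K (subvs_of (e7 K)) freudenthal).
Qed.

Lemma bF_out' p : ~~ Pos.leb p 56 -> bF p = 0.
Proof. by move=> /Pos.leb_spec0 h; apply: bF_out; lia. Qed.

Lemma ev_flatL x : ev bL (flatL x) = el8 x.
Proof.
case: x => [[[[[f P] Q] r] s] t]; rewrite /el8 /elC e8_split /flatL.
rewrite 3!ev_axpy 3!ev_addk ev_nil addr0 zK1 !scale1r.
rewrite (@ev_cut _ _ _ PK bL inP1 133 f inP1_linear bL_1 (@PK_out K)).
rewrite (@ev_shift _ _ _ bF bL inP2 133 56 P inP2_linear bL_2 bF_out').
by rewrite (@ev_shift _ _ _ bF bL inP3 189 56 Q inP3_linear bL_3 bF_out').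
Qed.

Lemma bL_out p : ~~ Pos.leb p 248 -> bL p = 0.
Proof.
move=> h; rewrite /bL /unitL.
have -> : Pos.leb p 133 = false by apply/negP => /Pos.leb_spec0; move/Pos.leb_spec0: h; lia.
have -> : Pos.leb p 189 = false by apply/negP => /Pos.leb_spec0; move/Pos.leb_spec0: h; lia.
have -> : Pos.leb p 245 = false by apply/negP => /Pos.leb_spec0; move/Pos.leb_spec0: h; lia.
have -> : Pos.eqb p 246 = false by apply/negP => /Pos.eqb_spec; move/Pos.leb_spec0: h; lia.
have -> : Pos.eqb p 247 = false by apply/negP => /Pos.eqb_spec; move/Pos.leb_spec0: h; lia.
have -> : Pos.eqb p 248 = false by apply/negP => /Pos.eqb_spec; move/Pos.leb_spec0: h; lia.
by rewrite /el8 /elC !ev_nil linear0.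
Qed.

Lemma br_bL p q : 48 *: e8_bracket (bL p) (bL q) = ev bL (brL p q).
Proof.
rewrite /brL TLE look2_tab; case: ifP => [_|hpq].
  by rewrite br_el8 -ev_flatL.
have s0 (x y : e8) : x = 0 \/ y = 0 -> 48 *: e8_bracket x y = 0.
  by move=> [|] ->; [rewrite (linear_0 (br_linear_l y))|rewrite (linear_0 (br_linear x))]; rewrite scaler0.
move: hpq => /negbT; rewrite negb_and => /orP[] h; apply: s0; [left|right]; apply: bL_out;
  by apply/negP => /Pos.leb_spec0; lia.
Qed.

Lemma spans_bL : spans bL.
Proof.
move=> P P0 PL Pb [[[[[x1 x2] x3] x4] x5] x6].
have PD u v : P u -> P v -> P (u + v).
  by move=> hu hv; rewrite -[u]scale1r; apply: PL.
have PZ a u : P u -> P (a *: u).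
  by move=> hu; rewrite -[_ *: _]addr0; apply: PL.
have P2 x : P (inP2 x).
  apply: (@spans_bF K (fun x => P (inP2 x))) => [|a u v hu hv|p].
  - by rewrite (linear_0 inP2_linear).
  - by rewrite inP2_linear; apply: PL.
  - case h : (Pos.leb p 56); first by rewrite -bL_2.
    by rewrite bF_out' ?h // (linear_0 inP2_linear).
have P3 x : P (inP3 x).
  apply: (@spans_bF K (fun x => P (inP3 x))) => [|a u v hu hv|p].
  - by rewrite (linear_0 inP3_linear).
  - by rewrite inP3_linear; apply: PL.
  - case h : (Pos.leb p 56); first by rewrite -bL_3.
    by rewrite bF_out' ?h // (linear_0 inP3_linear).
have P1 F : F \in e7 K -> P (inP1 F).
  move=> /mem_e7; apply: (@closed_e7 K (fun F => P (inP1 F))) => [|a u v hu hv|p].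
  - by rewrite (linear_0 inP1_linear).
  - by rewrite inP1_linear; apply: PL.
  - case h : (Pos.leb p 133); first by rewrite -bL_1.
    by rewrite PK_out ?h // (linear_0 inP1_linear).
rewrite e8_split; have -> : x1 = vsproj (e7 K) (vsval x1) by rewrite vsvalK.
apply: (PD); first by apply: P1; exact: subvsP.
apply: (PD); first exact: P2.
apply: (PD); first exact: P3.
apply: (PD); first exact: (PZ).
by apply: (PD); apply: (PZ).
Qed.

End E8Basis.

(** * Clifford algebras and the spinor group *)

Section CliffordRep.
Variables (K : numFieldType) (n d : nat) (g : 'I_n -> 'M[K]_d).
Hypothesis gg : forall i j, g i * g j + g j * g i = (2 * (i == j)%:R)%:M.
Implicit Types A B C : {set 'I_n}.
Local Notation symd A B := ((A :\: B) :|: (B :\: A)).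

Definition cl_basis A : 'M[K]_d := \prod_(i in A) g i.

Lemma mulZl (a : K) (M N : 'M[K]_d) : (a *: M) * N = a *: (M * N).
Proof. by rewrite /GRing.mul /= scalemxAl. Qed.
Lemma mulZr (a : K) (M N : 'M[K]_d) : M * (a *: N) = a *: (M * N).
Proof. by rewrite /GRing.mul /= scalemxAr. Qed.

Lemma g_sqr i : g i * g i = 1.
Proof.
have := gg i i; rewrite eqxx mulr1 => e; apply: (@scalerI K _ 2); first by rewrite pnatr_eq0.
by rewrite scaler_nat mulr2n e -scalemx1 scaler_nat.
Qed.

Lemma g_anti i j : i != j -> g i * g j = - (g j * g i).
Proof.
move=> /negPf h; have := gg i j; rewrite h mulr0.
by rewrite -scalemx1 scale0r => /eqP; rewrite addr_eq0 => /eqP.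
Qed.

Lemma symdE A B i : (i \in symd A B) = (i \in A) (+) (i \in B).
Proof. by rewrite !inE; case: (i \in A); case: (i \in B). Qed.

Let gl (r : seq 'I_n) A : 'M[K]_d := \prod_(i <- r | i \in A) g i.

Lemma sorted_ord : sorted (fun i j : 'I_n => (i < j)%N) (index_enum 'I_n).
Proof.
rewrite -(@sorted_map _ _ val ltn) /index_enum -enumT val_enum_ord.
exact: iota_ltn_sorted.
Qed.

(** The generator g_j moves past the factors with smaller index, at the cost of one sign each, and
    is then either inserted or cancelled against itself. *)
Let glj (r : seq 'I_n) B j : sorted (fun i j : 'I_n => (i < j)%N) r -> j \in r ->
  g j * gl r B = (-1) ^+ (\sum_(b <- r | b \in B) (b < j)%N) *: gl r (symd [set j] B).
Proof.
elim: r => [|x r IH] // hs; rewrite in_cons.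
have hx y : y \in r -> (x < y)%N.
  have ht : transitive (fun i j : 'I_n => (i < j)%N) by move=> ? ? ?; apply: ltn_trans.
  by move: hs => /= /(order_path_min ht)/allP; apply.
have hs' : sorted (fun i j : 'I_n => (i < j)%N) r by apply: path_sorted hs.
rewrite /gl !big_cons symdE; have [->|ne] /= := eqVneq j x.
  move=> _; rewrite finset.in_set1 eqxx ltnn.
  have -> : \prod_(i <- r | i \in symd [set x] B) g i = \prod_(i <- r | i \in B) g i.
    rewrite big_seq_cond [RHS]big_seq_cond; apply: eq_bigl => i.
    case ir : (i \in r) => //=; rewrite symdE finset.in_set1.
    by have := hx _ ir; case: eqVneq => // ->; rewrite ltnn.
  have -> : (\sum_(b <- r | b \in B) (b < x) = 0)%N.
    rewrite big1_seq // => i /andP[_ ir].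
    by have := hx _ ir; case: ltngtP.
  by case: ifP => _ /=; rewrite ?addn0 expr0 scale1r // mulrA g_sqr mul1r.
move=> jr; rewrite finset.in_set1 eq_sym (negPf ne) /= (hx _ jr).
have {}IH := IH hs' jr; rewrite /gl in IH.
case: ifP => _ //; rewrite mulrA g_anti // mulNr -mulrA IH mulZr exprD expr1.
by rewrite mulN1r scaleNr.
Qed.

Lemma basis_mulg j B : g j * cl_basis B =
  (-1) ^+ (\sum_(b in B) (b < j)%N) *: cl_basis (symd [set j] B).
Proof. exact: (@glj (index_enum 'I_n) B j sorted_ord (mem_index_enum j)). Qed.

(** The combinatorial sign of [cliff_mul] agrees with that of the matrices. The factors of e_A are
    multiplied onto e_B from the right-most to the left-most, so the induction runs over suffixes
    [r] of the ordered index list and involves only the part of [A] inside [r]. *)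
Lemma basis_mul A B : cl_basis A * cl_basis B = (-1) ^+ cliff_inv A B *: cl_basis (symd A B).
Proof.
have h r : sorted (fun i j : 'I_n => (i < j)%N) r ->
    gl r A * cl_basis B = (-1) ^+ (\sum_(i <- r | i \in A) \sum_(j in B) (j < i)%N) *:
      cl_basis (symd (A :&: [set i in r]) B).
  elim: r => [|x r IH] hs.
    rewrite /gl !big_nil mul1r expr0 scale1r; congr cl_basis.
    by apply/setP => i; rewrite symdE !inE andbF.
  have hx y : y \in r -> (x < y)%N.
    have ht : transitive (fun i j : 'I_n => (i < j)%N) by move=> ? ? ?; apply: ltn_trans.
    by move: hs => /= /(order_path_min ht)/allP; apply.
  have {}IH : _ := IH (path_sorted hs).
  rewrite /gl !big_cons; case: ifP => xA.
    rewrite -mulrA IH mulZr basis_mulg scalerA -exprD addnC; congr (_ ^+ (_ + _) *: _).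
      (* All indices in [r] exceed [x], so below [x] the symmetric difference still coincides with
         [B]. *)
      rewrite [LHS]big_mkcond [RHS]big_mkcond; apply: eq_bigr => b _.
      rewrite symdE !inE; case: ltnP => bx; last by case: ifP; case: ifP.
      by case br : (b \in r); rewrite ?andbF //; have := hx _ br; case: ltngtP bx.
    congr cl_basis; apply/setP => i; rewrite !symdE !inE.
    case: eqVneq => [->|_] //=; rewrite xA.
    by case xr : (x \in r); first (by have := hx _ xr; rewrite ltnn); case: (x \in B).
  rewrite IH; congr (_ *: cl_basis _); apply/setP => i; rewrite !symdE !inE.
  by case: eqVneq => [->|] //; rewrite xA.
rewrite {1}/cl_basis; have := h _ sorted_ord; rewrite /gl => ->.
congr (_ *: cl_basis _); apply/setP => i; rewrite !symdE !inE mem_index_enum.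
by rewrite andbT.
Qed.

Definition cl_rep (x : clifford K n) : 'M[K]_d := \sum_A x A *: cl_basis A.

Lemma cl_rep_mul x y : cl_rep (cliff_mul x y) = cl_rep x * cl_rep y.
Proof.
rewrite /cl_rep mulr_suml.
under [RHS]eq_bigr => A _ do rewrite mulr_sumr.
transitivity (\sum_C \sum_A \sum_(B | symd A B == C)
    ((-1) ^+ cliff_inv A B * (x A * y B) *: cl_basis C)).
  apply: eq_bigr => C _; rewrite ffunE scaler_suml.
  by apply: eq_bigr => A _; rewrite scaler_suml.
rewrite exchange_big; apply: eq_bigr => A _ /=.
rewrite (exchange_big_dep predT) //=; apply: eq_bigr => B _.
rewrite (big_pred1 (symd A B)) => [|C]; last by rewrite eq_sym.
rewrite mulZl mulZr basis_mul !scalerA; congr (_ *: _).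
exact: (mulrC ((-1) ^+ cliff_inv A B) (x A * y B : K)).
Qed.

Lemma basis0 : cl_basis finset.set0 = 1.
Proof. by rewrite /cl_basis big1 // => i; rewrite inE. Qed.

Lemma basis1 i : cl_basis [set i] = g i.
Proof. by rewrite /cl_basis big_set1. Qed.

Lemma cl_rep_one : cl_rep (cliff_one K n) = 1.
Proof.
rewrite /cl_rep (bigD1 finset.set0) //= big1 => [|C /negPf h]; rewrite ffunE.
  by rewrite eqxx scale1r basis0 addr0.
by rewrite h scale0r.
Qed.

Lemma cl_rep_linear : linear cl_rep.
Proof.
move=> a x y; rewrite /cl_rep scaler_sumr -big_split; apply: eq_bigr => A _.
by rewrite !ffunE scalerDl scalerA.
Qed.

Lemma cl_rep_vec (v : 'rV[K]_n) : cl_rep (cliff_vec v) = \sum_i v 0 i *: g i.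
Proof.
rewrite /cl_rep; under eq_bigr => C _ do rewrite ffunE scaler_suml.
rewrite exchange_big; apply: eq_bigr => i _ /=.
rewrite (bigD1 [set i]%SET) //= eqxx mulr1n basis1 big1 ?addr0 // => C /negPf->.
by rewrite mulr0n scale0r.
Qed.

Lemma g_basis i A : g i * cl_basis A = (-1) ^+ (\sum_(x in A) (x != i)) *: (cl_basis A * g i).
Proof.
rewrite /cl_basis; elim: (index_enum _) => [|x r IH].
  by rewrite !big_nil expr0 scale1r mulr1 mul1r.
rewrite !big_cons; case: ifP => _ //; have [->|ne] /= := eqVneq x i.
  by rewrite -{1}mulrA IH add0n mulZr !mulrA.
by rewrite mulrA g_anti 1?eq_sym // mulNr -[g x * g i * _]mulrA IH mulZr exprD expr1 mulN1r scaleNr mulrA.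
Qed.

(** Some g_i anticommutes with e_A, and conjugation by g_i then shows that the trace is its own
    opposite. If |A| is even, any i in A will do; if |A| is odd, any i outside A, which exists
    because n is even. *)
Lemma tr_basis A : ~~ odd n -> A != finset.set0 -> \tr (cl_basis A) = 0.
Proof.
move=> on A0.
have card i : (\sum_(x in A) (x != i) = #|A| - (i \in A))%N.
  rewrite -sum1_card; case iA : (i \in A).
    rewrite (bigD1 i) //= eqxx [in RHS](bigD1 i) //= add0n addKn.
    by apply: eq_bigr => j /andP[_ ->].
  by rewrite subn0; apply: eq_bigr => j jA; case: eqVneq => // e; rewrite -e jA in iA.
have [i hi] : exists i, odd (#|A| - (i \in A)).
  case oA : (odd #|A|).
    have [i iA] : exists i, i \notin A.
      apply/existsP; rewrite -negb_forall; apply/negP => /forallP h.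
      have e : A = [set: 'I_n]%SET by apply/setP => i; rewrite h inE.
      by move: on; rewrite -[n]card_ord -cardsT -e oA.
    by exists i; rewrite (negPf iA) subn0.
  have /set0Pn[i iA] := A0.
  by exists i; rewrite iA oddB ?oA //; apply/card_gt0P; exists i.
have e : cl_basis A = - (g i * cl_basis A * g i).
  rewrite g_basis card -signr_odd hi expr1 scaleN1r mulNr -mulrA g_sqr mulr1.
  by rewrite opprK.
have : \tr (cl_basis A) = - \tr (cl_basis A).
  by rewrite {1}e linearN /= [_ * g i]/(_ *m _) mxtrace_mulC -[g i *m _]/(g i * _) mulrA g_sqr mul1r.
move=> h; apply: (@mulfI K 2); first by rewrite pnatr_eq0.
by rewrite mulr0 mulr2n mulrDl mul1r {2}h subrr.
Qed.

End CliffordRep.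

(** * Faithfulness of the Clifford representation, reversal and vectors *)

Section CliffordCoord.
Variables (K : numFieldType) (n d : nat) (g : 'I_n -> 'M[K]_d).
Hypothesis gg : forall i j, g i * g j + g j * g i = (2 * (i == j)%:R)%:M.
Hypotheses (even_n : ~~ odd n) (d_gt0 : (0 < d)%N).
Implicit Types (A B C : {set 'I_n}) (x y z : clifford K n) (u v w : 'rV[K]_n).
Local Notation symd A B := ((A :\: B) :|: (B :\: A)).
Local Notation rep := (cl_rep g).
Local Notation basis := (cl_basis g).

(** The e_A are orthogonal for the trace form, with e_A^2 = (-1)^inv(A, A), so a trace extracts each
    coordinate. This linear left inverse gives both faithfulness and, later, continuity. *)
Definition cl_coord (M : 'M[K]_d) : clifford K n :=
  [ffun A : {set 'I_n} => (-1) ^+ cliff_inv A A * d%:R^-1 * \tr (basis A * M)].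

Lemma tr_basis_mul A B :
  \tr (basis A * basis B) = (-1) ^+ cliff_inv A A * d%:R * (B == A)%:R.
Proof.
rewrite (basis_mul gg) linearZ /=; have [->|ne] := eqVneq B A.
  have -> : symd A A = finset.set0 by apply/setP => i; rewrite symdE inE addbb.
  by rewrite basis0 mxtrace1 mulr1.
rewrite (tr_basis gg) ?mulr0 //; apply: contra ne => /eqP e; apply/eqP/setP => i.
by have := finset.in_set0 i; rewrite -e symdE; case: (i \in A); case: (i \in B).
Qed.

Lemma cl_repK x : cl_coord (rep x) = x.
Proof.
apply/ffunP => A; rewrite ffunE /cl_rep [basis A * _]mulr_sumr.
rewrite raddf_sum mulr_sumr /=.
rewrite (bigD1 A) //= big1 => [|B /negPf ne].
  rewrite addr0 mulZr linearZ /= tr_basis_mul eqxx mulr1.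
  have : (-1) ^+ cliff_inv A A * (-1) ^+ cliff_inv A A = 1 :> K by rewrite -expr2 sqrr_sign.
  have d0 : d%:R != 0 :> K by rewrite pnatr_eq0 -lt0n.
  move: (x A : K) ((-1) ^+ _) => a s s2.
  transitivity (s * s * a); last by rewrite s2 mul1r.
  by field.
by rewrite mulZr linearZ /= tr_basis_mul ne !mulr0.
Qed.

Lemma rep_inj : injective rep.
Proof. exact: can_inj cl_repK. Qed.

Lemma cl_coord_linear : linear cl_coord.
Proof.
move=> a M N; apply/ffunP => A; rewrite !ffunE mulrDr mulZr linearD linearZ /= mulrDr.
by congr (_ + _); rewrite /GRing.scale /= mulrCA.
Qed.

Lemma ggT i j : (g i)^T * (g j)^T + (g j)^T * (g i)^T = (2 * (i == j)%:R)%:M.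
Proof.
rewrite -[LHS]trmxK [(_ + _)^T]linearD /= !trmx_mul !trmxK.
by rewrite [X in X^T](gg j i) tr_scalar_mx eq_sym.
Qed.

Lemma basis_tr A : (cl_basis (fun i => (g i)^T) A)^T = (-1) ^+ 'C(#|A|, 2) *: basis A.
Proof.
have h (r : seq 'I_n) : uniq r ->
    (\prod_(i <- r) (g i)^T)^T = (-1) ^+ 'C(size r, 2) *: \prod_(i <- r) g i.
  have hj j s : j \notin s ->
      (\prod_(i <- s) g i) * g j = (-1) ^+ size s *: (g j * \prod_(i <- s) g i).
    elim: s => [|k s IH] /=; first by rewrite !big_nil mul1r mulr1 expr0 scale1r.
    rewrite in_cons negb_or !big_cons => /andP[jk js].
    by rewrite -mulrA IH // mulZr exprS mulN1r scaleNr -scalerN !mulrA (g_anti gg jk) mulNr opprK.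
  elim: r => [_|j r IH /= /andP[jr ur]].
    by rewrite !big_nil trmx1 bin0n expr0 scale1r.
  rewrite !big_cons trmx_mul trmxK [X in X *m _]IH // -[_ *m _]/(_ * _) mulZl hj //.
  by rewrite scalerA -exprD binS bin1.
have := h [seq i <- index_enum 'I_n | i \in A] (filter_uniq _ (index_enum_uniq _)).
by rewrite -sum1_size !big_filter sum1_card.
Qed.

(** The transposed generators satisfy the same relations, so reversal becomes an honest
    transposition and its anti-multiplicativity, [rep_rev_mul], needs no further sign count. *)
Lemma rep_rev x : rep (cliff_rev x) = (cl_rep (fun i => (g i)^T) x)^T.
Proof.
rewrite /cl_rep.
rewrite [RHS]raddf_sum; apply: eq_bigr => A _ /=.
rewrite ffunE linearZ /= basis_tr scalerA; congr (_ *: _); exact: mulrC.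
Qed.

Lemma rep_rev_mul x y : rep (cliff_rev (cliff_mul x y)) = rep (cliff_rev y) * rep (cliff_rev x).
Proof. by rewrite !rep_rev (cl_rep_mul ggT) trmx_mul. Qed.

Lemma rev_vec u : cliff_rev (cliff_vec u) = cliff_vec u.
Proof.
apply/ffunP => C; rewrite !ffunE mulr_sumr; apply: eq_bigr => i _.
by case: eqP => [->|_]; rewrite ?mulr0n ?mulr0 // cards1 bin_small ?expr0 ?mul1r.
Qed.

Definition gvec u : 'M[K]_d := \sum_i u 0 i *: g i.
Definition dot u v : K := \sum_i u 0 i * v 0 i.

Lemma gvec_dot u v : gvec u * gvec v + gvec v * gvec u = (2 * dot u v)%:M.
Proof.
have e p q : gvec p * gvec q = \sum_i \sum_j (p 0 i * q 0 j) *: (g i * g j).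
  rewrite /gvec mulr_suml; apply: eq_bigr => i _; rewrite mulr_sumr; apply: eq_bigr => j _.
  by rewrite mulZl mulZr scalerA.
rewrite (e u v) (e v u) [X in _ + X]exchange_big -big_split /=.
rewrite /dot mulr_sumr raddf_sum; apply: eq_bigr => i _ /=.
rewrite -big_split /= (bigD1 i) //= big1 ?addr0 => [|j /negPf ne].
  by rewrite -scalemx1 [v 0 i * _]mulrC -scalerDr gg eqxx mulr1 -scalemx1 scalerA mulrC.
by rewrite [v 0 j * _]mulrC -scalerDr gg eq_sym ne mulr0 raddf0 scaler0.
Qed.

Lemma gvec_linear : linear gvec.
Proof.
move=> a u v; rewrite /gvec scaler_sumr -big_split; apply: eq_bigr => i _ /=.
by rewrite !mxE scalerDl scalerA.
Qed.

Lemma gvec0 : gvec 0 = 0.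
Proof. by rewrite (linear_0 gvec_linear). Qed.

Lemma gvec_sqr u : dot u u = 1 -> gvec u * gvec u = 1.
Proof.
move=> h; have := gvec_dot u u; rewrite h mulr1 -scalemx1 -mulr2n -scaler_nat => e.
by apply: (@scalerI K _ 2) => //; rewrite pnatr_eq0.
Qed.

(** Conjugation by a unit vector is minus the reflection in its orthogonal hyperplane. *)
Lemma gvec_refl u v : dot u u = 1 ->
  gvec u * gvec v * gvec u = gvec ((2 * dot u v) *: u - v).
Proof.
move=> h; rewrite gvec_linear.
have -> : gvec (- v) = - gvec v.
  by have := gvec_linear (-1) v 0; rewrite gvec0 !addr0 !scaleN1r.
have -> : gvec u * gvec v = (2 * dot u v)%:M - gvec v * gvec u.
  by rewrite -gvec_dot addrK.
by rewrite mulrBl -mulrA gvec_sqr // mulr1 -scalemx1 mulZl mul1r.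
Qed.

Lemma odd_symd A B : odd #|symd A B| = odd #|A| (+) odd #|B|.
Proof.
have := cardsUI (A :\: B) (B :\: A).
have -> : (A :\: B) :&: (B :\: A) = finset.set0.
  by apply/setP => i; rewrite !inE; case: (i \in A); case: (i \in B).
rewrite cards0 addn0 => ->; rewrite -(cardsID B A) -(cardsID A B) finset.setIC !oddD.
by case: (odd #|A :\: B|); case: (odd #|B :\: A|); case: (odd _).
Qed.

Lemma mul_even x y : (forall C, odd #|C| -> x C = 0) -> (forall C, odd #|C| -> y C = 0) ->
  forall C, odd #|C| -> cliff_mul x y C = 0.
Proof.
move=> hx hy C oC; rewrite ffunE big1 // => A _; rewrite big1 // => B /eqP e.
move: oC; rewrite -e odd_symd; case oA : (odd #|A|) => /=.
  by rewrite hx // mul0r mulr0.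
by move=> /hy->; rewrite !mulr0.
Qed.

Lemma Spin_mul x y : Spin x -> Spin y -> Spin (cliff_mul x y).
Proof.
move=> [ex ux vx] [ey uy vy]; split; first exact: mul_even.
  apply: rep_inj; have := congr1 rep ux; have := congr1 rep uy.
  rewrite !(cl_rep_mul gg) rep_rev_mul => e1 e2.
  by rewrite mulrA -[_ * rep y * _]mulrA e1 cl_rep_one mulr1 e2 cl_rep_one.
move=> v; have [w hw] := vy v; have [t ht] := vx w; exists t.
apply: rep_inj; rewrite -ht -hw !(cl_rep_mul gg) rep_rev_mul.
by rewrite !mulrA.
Qed.

Lemma Spin_vec2 u w : dot u u = 1 -> dot w w = 1 ->
  Spin (cliff_mul (cliff_vec u) (cliff_vec w)).
Proof.
move=> hu hw.
have hv (z : 'rV[K]_n) : rep (cliff_vec z) = gvec z by exact: cl_rep_vec.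
split.
- move=> C oC; rewrite ffunE big1 // => A _; rewrite big1 // => B /eqP e.
  have hc (z : 'rV[K]_n) (D : {set 'I_n}) : ~~ odd #|D| -> cliff_vec z D = 0.
    move=> oD; rewrite ffunE big1 // => i _; case: eqP => // e'.
    by rewrite e' cards1 in oD.
  move: oC; rewrite -e odd_symd; case oA : (odd #|A|) => /=.
    by move=> hB; rewrite [cliff_vec w B]hc ?mulr0.
  by move=> _; rewrite hc ?oA // mul0r mulr0.
- apply: rep_inj; rewrite (cl_rep_mul gg) rep_rev_mul !rev_vec (cl_rep_mul gg) !hv.
  by rewrite -mulrA [gvec w * (_ * _)]mulrA gvec_sqr // mul1r gvec_sqr // cl_rep_one.
(* The composite of the negated reflections in [w] and then in [u]. *)
- move=> v; exists ((2 * dot u ((2 * dot w v) *: w - v)) *: u - ((2 * dot w v) *: w - v)).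
  apply: rep_inj; rewrite !(cl_rep_mul gg) rep_rev_mul !rev_vec !hv.
  by rewrite -(gvec_refl _ hu) -(gvec_refl _ hw) !mulrA.
Qed.

End CliffordCoord.

(** * Orthonormal frames and plane rotations *)

Section PlaneRotations.
Variables (K : numClosedFieldType) (n : nat).
Implicit Types (u v w : 'rV[K]_n) (S : {set 'I_n}) (q : 'I_n * 'I_n * K * K).

(** The pair (a, b) is the cosine and sine of half the angle, so that the same parameters describe
    the rotor a + b e_i e_j above this rotation. *)
Definition rot q u : 'rV[K]_n :=
  let: (i, j, a, b) := q in
  \row_k (if k == i then (a ^+ 2 - b ^+ 2) * u 0 i + 2 * a * b * u 0 j
          else if k == j then (a ^+ 2 - b ^+ 2) * u 0 j - 2 * a * b * u 0 i
          else u 0 k).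

Definition is_rot S q : bool :=
  let: (i, j, a, b) := q in [&& i \in S, j \in S, i != j & a ^+ 2 + b ^+ 2 == 1].

Definition rots (r : seq ('I_n * 'I_n * K * K)) u : 'rV[K]_n := foldr rot u r.

Lemma rots_cat r1 r2 u : rots (r1 ++ r2) u = rots r1 (rots r2 u).
Proof. exact: foldr_cat. Qed.

Lemma dot_rot S q u v : is_rot S q -> dot (rot q u) (rot q v) = dot u v.
Proof.
case: q => [[[i j] c] s] /and4P[_ _ ij /eqP cs]; rewrite /dot.
rewrite (bigD1 i) //= [in RHS](bigD1 i) //= (bigD1 j) 1?eq_sym //= [in RHS](bigD1 j) 1?eq_sym //=.
rewrite !addrA; congr (_ + _).
  rewrite !mxE eqxx eq_sym (negPf ij) eqxx.
  transitivity ((c ^+ 2 + s ^+ 2) ^+ 2 * (u 0 i * v 0 i + u 0 j * v 0 j)); first by ring.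
  by rewrite cs expr1n mul1r.
by apply: eq_bigr => k /andP[/negPf ki /negPf kj]; rewrite !mxE ki kj.
Qed.

Lemma dot_rots S r u v : all (is_rot S) r -> dot (rots r u) (rots r v) = dot u v.
Proof. by elim: r => [|q r IH] //= /andP[hq hr]; rewrite (dot_rot _ _ hq) IH. Qed.

Definition e_ i : 'rV[K]_n := delta_mx 0 i.

Lemma rot_fix S q k : is_rot S q -> k \notin S -> rot q (e_ k) = e_ k.
Proof.
case: q => [[[i j] c] s] /and4P[iS jS ij _] kS; apply/rowP => l; rewrite !mxE !eqxx /=.
have ki : (i == k) = false by apply/negP => /eqP e; rewrite -e iS in kS.
have kj : (j == k) = false by apply/negP => /eqP e; rewrite -e jS in kS.
rewrite ki kj !mulr0 addr0 subr0; case: eqP => [->|_]; first by rewrite ki.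
by case: eqP => // ->; rewrite kj.
Qed.

Lemma rots_fix S r k : all (is_rot S) r -> k \notin S -> rots r (e_ k) = e_ k.
Proof. by move=> hr kS; elim: r hr => //= q r IH /andP[hq /IH->]; exact: rot_fix hq kS. Qed.

Lemma rot_supp S q u : is_rot S q -> (forall k, k \notin S -> u 0 k = 0) ->
  forall k, k \notin S -> (rot q u) 0 k = 0.
Proof.
case: q => [[[i j] c] s] /and4P[iS jS ij _] hu k kS; rewrite mxE.
case: eqP => [e|_]; first by rewrite e iS in kS.
by case: eqP => [e|_]; [rewrite e jS in kS|exact: hu].
Qed.

Lemma half_angle (c s : K) : c ^+ 2 + s ^+ 2 = 1 ->
  exists a b, [/\ a ^+ 2 + b ^+ 2 = 1, a ^+ 2 - b ^+ 2 = c & 2 * a * b = s].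
Proof.
move=> cs; pose a := sqrtC ((1 + c) / 2).
have a2 : a ^+ 2 = (1 + c) / 2 by rewrite sqrtCK.
have [a0|a0] := eqVneq a 0.
  have c1 : c = -1.
    move: a2; rewrite a0 expr0n /= => /esym/eqP.
    by rewrite mulf_eq0 invr_eq0 pnatr_eq0 orbF addrC addr_eq0 => /eqP.
  have /eqP : s ^+ 2 = 0.
    by move: cs; rewrite c1 sqrrN expr1n => e; apply: (@addrI _ 1); rewrite e addr0.
  rewrite expf_eq0 /= => /eqP s0.
  by exists 0, 1; rewrite c1 s0; split; ring.
have b2 : (s / (2 * a)) ^+ 2 = (1 - c) / 2.
  have s2 : s ^+ 2 = (1 - c) * (1 + c) by rewrite -subr_sqr expr1n -cs addrC addKr.
  have c0 : 1 + c != 0 by apply: contraNneq a0 => h; rewrite -sqrf_eq0 a2 h mul0r.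
  by rewrite expr_div_n exprMn a2 s2; field.
exists a, (s / (2 * a)); rewrite a2 b2; split; first by field.
  by field.
by field.
Qed.

(** The angle has cosine u_i / m and sine u_j / m, with m a square root of u_i^2 + u_j^2. Over K
    this sum may vanish for non-zero entries, hence the condition. *)
Lemma rot_kill (S : {set 'I_n}) i j u : i \in S -> j \in S -> i != j ->
  u 0 i ^+ 2 + u 0 j ^+ 2 != 0 -> exists q, [/\ is_rot S q, (rot q u) 0 j = 0,
    (rot q u) 0 i != 0 & forall k, k != i -> k != j -> (rot q u) 0 k = u 0 k].
Proof.
move=> iS jS ij; set p := u 0 i; set t := u 0 j => N0.
set m := sqrtC (p ^+ 2 + t ^+ 2).
have m2 : m ^+ 2 = p ^+ 2 + t ^+ 2 by rewrite sqrtCK.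
have m0 : m != 0 by apply: contraNneq N0 => e; rewrite -m2 e expr0n.
have [a [b [ab ec es]]] : exists a b,
    [/\ a ^+ 2 + b ^+ 2 = 1, a ^+ 2 - b ^+ 2 = p / m & 2 * a * b = t / m].
  apply: half_angle; rewrite !exprMn exprVn -mulrDl -m2 mulfV //.
  by rewrite expf_neq0.
exists (i, j, a, b); split.
- by rewrite /is_rot iS jS ij /= ab.
- by rewrite mxE eq_sym (negPf ij) eqxx -/p -/t ec es; ring.
- rewrite mxE eqxx -/p -/t ec es; have -> : p / m * p + t / m * t = m ^+ 2 / m.
    by rewrite m2; ring.
  by rewrite expr2 mulfK.
- by move=> k /negPf ki /negPf kj; rewrite mxE ki kj.
Qed.

(** Induction on the number of non-zero coordinates other than the one at [s]. If the planes (s, k)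
    and (s, l) are both isotropic for [u], then u_k^2 = u_l^2 and the plane (k, l) is not. If k is
    the only such coordinate, then u_s^2 + u_k^2 = 1. *)
Lemma rots_unit S s u : s \in S -> (1 < #|S|)%N -> dot u u = 1 ->
  (forall k, k \notin S -> u 0 k = 0) ->
  exists r, all (is_rot S) r /\ rots r u = e_ s.
Proof.
move=> sS S1 hu hS.
have [m] := ubnP #|[set k in S | (k != s) && (u 0 k != 0)]|.
elim: m u hu hS => // m IH u hu hS hm.
have step i j : i \in S -> j \in S -> i != j -> j != s -> u 0 j != 0 ->
    (i != s -> u 0 i != 0) ->
    u 0 i ^+ 2 + u 0 j ^+ 2 != 0 -> exists r, all (is_rot S) r /\ rots r u = e_ s.
  move=> iS jS ij js uj0 ui N0.
  have [q [hq qj qi qk]] := rot_kill iS jS ij N0.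
  have [|||r [hr er]] := IH (rot q u).
  - by rewrite (dot_rot _ _ hq).
  - exact: rot_supp hq hS.
  - rewrite -ltnS; apply: leq_trans hm; rewrite ltnS; apply: proper_card; apply/properP; split.
      apply/fintype.subsetP => k; rewrite !inE => /and3P[kS ks].
      rewrite kS ks /=; have [->|kj] := eqVneq k j; first by rewrite uj0.
      have [ki|ki] := eqVneq k i; last by rewrite qk.
      by move=> _; rewrite ki; apply: ui; rewrite -ki.
    by exists j; rewrite !inE jS js ?uj0 // qj eqxx.
  by exists (r ++ [:: q]); rewrite all_cat hr /= hq rots_cat /= er.
have [/existsP[k /and3P[kS ks uk0]]|] := boolP [exists k, [&& k \in S, k != s & u 0 k != 0]].
  have [N0|N0] := boolP (u 0 s ^+ 2 + u 0 k ^+ 2 == 0); last first.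
    by apply: (step s k) => //; rewrite ?eqxx // eq_sym.
  have [/existsP[l /and4P[lS ls ul0 lk]]|] :=
      boolP [exists l, [&& l \in S, l != s, u 0 l != 0 & l != k]].
    have [M0|M0] := boolP (u 0 s ^+ 2 + u 0 l ^+ 2 == 0); last first.
      by apply: (step s l) => //; rewrite ?eqxx // eq_sym.
    apply: (step k l) => //; first by rewrite eq_sym.
    move: N0 M0; rewrite !addr_eq0 => /eqP e1 /eqP e2.
    have -> : u 0 k ^+ 2 = u 0 l ^+ 2 by apply: oppr_inj; rewrite -e1.
    by rewrite -addr_eq0 -mulr2n mulrn_eq0 /= expf_neq0.
  rewrite negb_exists => /forallP h.
  have : dot u u = u 0 s ^+ 2 + u 0 k ^+ 2.
    rewrite /dot (bigD1 s) //= (bigD1 k) //= big1 ?addr0 ?expr2 // => l /andP[ls lk].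
    have := h l; rewrite ls lk /=; have [lS|/hS->] := boolP (l \in S); last by rewrite mul0r.
    by rewrite andbT negbK => /eqP->; rewrite mul0r.
  by rewrite hu (eqP N0) => /eqP; rewrite oner_eq0.
rewrite negb_exists => /forallP h.
have uk k : k != s -> u 0 k = 0.
  move=> ks; have := h k; rewrite ks /=.
  by have [lS|/hS->] := boolP (k \in S); rewrite //= negbK => /eqP.
have us : u 0 s ^+ 2 = 1.
  rewrite -hu /dot (bigD1 s) //= big1 ?addr0 ?expr2 // => l ls.
  by rewrite uk // mul0r.
have eu : u = u 0 s *: e_ s.
  apply/rowP => k; rewrite !mxE eqxx /=; case: eqVneq => [->|ks]; first by rewrite mulr1.
  by rewrite uk // mulr0.
move: us => /eqP; rewrite sqrf_eq1 => /orP[]/eqP us; rewrite us in eu.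
  by exists [::]; rewrite /= eu scale1r.
have [k kS ks] : exists2 k, k \in S & k != s.
  have : (0 < #|S :\ s|)%N by move: S1; rewrite (cardsD1 s) sS.
  by move=> /card_gt0P[k]; rewrite !inE => /andP[ks kS]; exists k.
(* The half-turn a = 0, b = 1 changes the remaining sign; the second coordinate that it requires is
   where |S| > 1 enters. *)
exists [:: (s, k, 0, 1)]; split.
  by rewrite /= sS kS eq_sym ks expr1n expr0n add0r eqxx.
apply/rowP => l; rewrite eu !mxE /= !eqxx (negPf ks) /=.
have [_|_] := eqVneq l s; first by rewrite /=; ring.
by have [_|_] := eqVneq l k; rewrite /=; ring.
Qed.

Lemma dot_delta u i : dot (e_ i) u = u 0 i.
Proof.
rewrite /dot (bigD1 i) //= big1 => [|k /negPf ki]; rewrite mxE ?eqxx ?ki ?mul1r ?mul0r //.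
by rewrite addr0.
Qed.

(** The next vector is moved by rotations among the coordinates from [m] on, which fix the vectors
    already aligned. At least two such coordinates are needed, so the last vector cannot be reached:
    rotations have determinant 1. *)
Lemma frame_rots (U : 'I_n -> 'rV[K]_n) : (forall i j, dot (U i) (U j) = (i == j)%:R) ->
  forall m, (m < n)%N -> exists r, all (is_rot [set: 'I_n]%SET) r /\ 
    forall i : 'I_n, (i < m)%N -> rots r (U i) = e_ i.
Proof.
move=> hU; elim => [|m IH] hm; first by exists [::].
have [r [hr er]] := IH (ltnW hm); pose i0 := Ordinal (ltnW hm).
pose S := [set k : 'I_n | (m <= k)%N].
have [||||r' [hr' er']] := @rots_unit S i0 (rots r (U i0)).
- by rewrite inE.
- have -> : 1%N = #|[set i0]| by rewrite cards1.
  apply: proper_card; apply/properP; split.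
    by apply/fintype.subsetP => k; rewrite !inE => /eqP->.
  exists (Ordinal hm); rewrite !inE //=; apply/eqP => /(congr1 val) /=; lia.
- by rewrite (dot_rots _ _ hr) hU eqxx.
- move=> k; rewrite inE -ltnNge => km; rewrite -dot_delta -er // (dot_rots _ _ hr) hU.
  by case: eqVneq => // e; rewrite e ltnn in km.
exists (r' ++ r); split.
  rewrite all_cat hr andbT; apply: sub_all hr' => -[[[i j] c] s] /and4P[_ _ h1 h2].
  by rewrite /is_rot !inE h1 h2.
move=> i; rewrite ltnS leq_eqVlt => /orP[/eqP e|im].
  by have -> : i = i0 by [exact: val_inj|]; rewrite rots_cat er'.
by rewrite rots_cat er // (rots_fix hr') // inE -ltnNge.
Qed.

End PlaneRotations.

(** * Rotors and words of rotors in the spinor group *)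

Section Rotors.
Variables (K : numClosedFieldType) (n d : nat) (g : 'I_n -> 'M[K]_d).
Hypothesis gg : forall i j, g i * g j + g j * g i = (2 * (i == j)%:R)%:M.
Hypotheses (even_n : ~~ odd n) (d_gt0 : (0 < d)%N).
Implicit Types (u v w : 'rV[K]_n) (q : 'I_n * 'I_n * K * K).
Implicit Types (r : seq ('I_n * 'I_n * K * K)).
Local Notation rep := (cl_rep g).
Local Notation gvec := (gvec g).
Local Notation e_ := (@e_ K n).
Local Notation rotation := (is_rot [set: 'I_n]%SET).

Definition rotor_vec q : 'rV[K]_n := let: (i, j, a, b) := q in a *: e_ i + b *: e_ j.

(** The product e_i (a e_i + b e_j) = a + b e_i e_j, written with two unit vectors so that
    [Spin_vec2] applies. *)
Definition rotor q : clifford K n :=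
  let: (i, j, a, b) := q in cliff_mul (cliff_vec (e_ i)) (cliff_vec (rotor_vec q)).

Definition spin_word r : clifford K n :=
  foldr (fun q x => cliff_mul (rotor q) x) (cliff_one K n) r.

Definition rot_inv r := rev [seq (let: (i, j, a, b) := q in (i, j, a, - b)) | q <- r].

Lemma dot_e i j : dot (e_ i) (e_ j) = (i == j)%:R.
Proof. by rewrite dot_delta mxE eqxx. Qed.

Lemma gvec_e i : gvec (e_ i) = g i.
Proof.
rewrite /gvec (bigD1 i) //= big1 => [|k /negPf ki]; rewrite mxE ?eqxx ?ki ?scale0r //.
by rewrite addr0 scale1r.
Qed.

Lemma rotor_vec_dot q u : dot (rotor_vec q) u =
  let: (i, j, a, b) := q in a * u 0 i + b * u 0 j.
Proof.
case: q => [[[i j] a] b]; rewrite -!dot_delta /dot !mulr_sumr -big_split.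
by apply: eq_bigr => k _ /=; rewrite !mxE mulrDl !mulrA.
Qed.

Lemma rotor_vec_unit q : rotation q -> dot (rotor_vec q) (rotor_vec q) = 1.
Proof.
case: q => [[[i j] a] b] /and4P[_ _ ij /eqP ab].
transitivity (a ^+ 2 + b ^+ 2) => //.
have ji : (j == i) = false by rewrite eq_sym (negPf ij).
by rewrite rotor_vec_dot !mxE !eqxx /= (negPf ij) ji /=; ring.
Qed.

Lemma Spin_rotor q : rotation q -> Spin (rotor q).
Proof.
move=> hq; have := rotor_vec_unit hq; case: q hq => [[[i j] a] b] hq h.
by apply: (Spin_vec2 gg) => //; rewrite dot_e eqxx.
Qed.

Lemma rep_rotor_E q : rotation q -> rep (rotor q) =
  let: (i, j, a, b) := q in a%:M + b *: (g i * g j).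
Proof.
case: q => [[[i j] a] b] /and4P[_ _ ij _]; rewrite (cl_rep_mul gg) !cl_rep_vec.
rewrite -!/(gvec _) gvec_linear gvec_e -[b *: _]addr0 gvec_linear gvec0 addr0 !gvec_e.
by rewrite mulrDr !mulZr (g_sqr gg) scalemx1.
Qed.

(** A rotor is a product of two unit vectors, each acting as a negated reflection, and the composite
    of the two reflections is the rotation by twice the angle between them. *)
Lemma rep_rotor q u : rotation q -> rep (rotor q) * gvec u = gvec (rot q u) * rep (rotor q).
Proof.
move=> hq; have hw := rotor_vec_unit hq.
have hd := fun u => rotor_vec_dot q u.
case: q hq hw hd => [[[i j] a] b] hq; set w := rotor_vec _ => hw hd.
have he : dot (e_ i) (e_ i) = 1 by rewrite dot_e eqxx.
rewrite (cl_rep_mul gg) !cl_rep_vec -!/(gvec _) -/w.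
set v := (2 * dot w u) *: w - u.
have -> : rot (i, j, a, b) u = (2 * dot (e_ i) v) *: e_ i - v.
  move: hq => /and4P[_ _ /negPf ij /eqP ab].
  have eb : b ^+ 2 = 1 - a ^+ 2 by rewrite -ab [a ^+ 2 + _]addrC addrK.
  apply/rowP => k; rewrite dot_delta /v hd !mxE !eqxx /=.
  rewrite [i == j]ij; have [->|ki] := eqVneq k i.
    by rewrite ij /= eb; ring.
  have [->|kj] := eqVneq k j; last by rewrite /=; ring.
  rewrite /= -[RHS]/(_ - (2 * (a * u 0 i + b * u 0 j) * (a * 0 + b * 1) - u 0 j)).
  transitivity (u 0 j - 2 * b ^+ 2 * u 0 j - 2 * a * b * u 0 i); last by ring.
  by rewrite eb; ring.
rewrite -(gvec_refl gg _ he) -(gvec_refl gg _ hw).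
have := gvec_sqr gg hw; have := gvec_sqr gg he.
move: (gvec (e_ i)) (gvec w) (gvec u) => A B C hA hB.
by rewrite -[RHS]mulrA [A * (A * B)]mulrA hA mul1r -!mulrA hB mulr1.
Qed.

Lemma rep_word r u : all rotation r ->
  rep (spin_word r) * gvec u = gvec (rots r u) * rep (spin_word r).
Proof.
elim: r => [_|q r IH /= /andP[hq hr]]; first by rewrite cl_rep_one mul1r mulr1.
by rewrite (cl_rep_mul gg) -mulrA IH // mulrA rep_rotor // mulrA.
Qed.

Lemma Spin_one : Spin (cliff_one K n).
Proof.
have r1 : cliff_rev (cliff_one K n) = cliff_one K n.
  apply/ffunP => C; rewrite !ffunE; case: eqP => [->|_]; last by rewrite mulr0.
  by rewrite cards0 bin0n expr0 mul1r.
split.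
- by move=> C oC; rewrite ffunE; case: eqP oC => // ->; rewrite cards0.
- by apply: (rep_inj gg even_n d_gt0); rewrite (cl_rep_mul gg) r1 cl_rep_one mulr1.
- move=> v; exists v; apply: (rep_inj gg even_n d_gt0).
  by rewrite !(cl_rep_mul gg) r1 cl_rep_one mulr1 mul1r.
Qed.

Lemma Spin_word r : all rotation r -> Spin (spin_word r).
Proof.
elim: r => [_|q r IH /= /andP[hq /IH hr]]; first exact: Spin_one.
exact: (Spin_mul gg even_n d_gt0 (Spin_rotor hq) hr).
Qed.

Lemma rot_inv_all r : all rotation r -> all rotation (rot_inv r).
Proof.
rewrite all_rev all_map => h; apply: sub_all h => -[[[i j] a] b] /and4P[h1 h2 h3 h4].
by rewrite /= sqrrN h3 h4 !inE.
Qed.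

Lemma word_cat r1 r2 : rep (spin_word (r1 ++ r2)) = rep (spin_word r1) * rep (spin_word r2).
Proof.
by elim: r1 => [|q r1 IH] /=; rewrite ?cl_rep_one ?mul1r // !(cl_rep_mul gg) IH mulrA.
Qed.

Lemma word_inv r : all rotation r -> rep (spin_word (rot_inv r)) * rep (spin_word r) = 1.
Proof.
elim: r => [_|q r IH /= /andP[hq hr]]; first by rewrite cl_rep_one mulr1.
rewrite /rot_inv /= rev_cons -cats1 word_cat /= !(cl_rep_mul gg) cl_rep_one mulr1.
suff e : rep (rotor (let: (i, j, a, b) := q in (i, j, a, - b))) * rep (rotor q) = 1.
  by rewrite -mulrA [X in _ * X]mulrA e mul1r IH.
have hq' : rotation (let: (i, j, a, b) := q in (i, j, a, - b)).
  by have := @rot_inv_all [:: q]; rewrite /= hq andbT => /(_ isT)/andP[].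
rewrite !rep_rotor_E //; case: q hq {hq'} => [[[i j] a] b] /and4P[_ _ ij /eqP ab].
have e : g i * g j * (g i * g j) = - 1.
  rewrite mulrA -[g i * g j * g i]mulrA -[g j * g i]opprK -(g_anti gg ij).
  by rewrite mulrN mulrA (g_sqr gg) mul1r mulNr (g_sqr gg).
rewrite -scalemx1 scaleNr mulrDl !mulrDr mulNr mulNr !mulZl !mulZr e !mul1r !mulr1.
rewrite !scalerA scalerN opprK !addrA [b * a]mulrC addrK -scalerDl -!expr2 ab.
by rewrite scale1r.
Qed.

End Rotors.

(** * Matrices that normalise the span of Clifford generators *)

Section CliffordGroup.
Variables (K : numClosedFieldType) (p d : nat) (g : 'I_p.+1 -> 'M[K]_d).
Hypothesis gg : forall i j, g i * g j + g j * g i = (2 * (i == j)%:R)%:M.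
Hypotheses (odd_p : odd p) (d_gt0 : (0 < d)%N).
Variables (C : 'M[K]_d -> Prop) (s0 : 'M[K]_d).
Hypothesis C_g : forall s i, C s -> s * g i = g i * s.
Hypotheses (s0_g : forall i, s0 * g i = - (g i * s0)) (s0_neq0 : s0 != 0).
Hypothesis irr : forall N, (forall i, N * g i = g i * N) ->
  (forall s, C s -> N * s = s * N) -> exists c, N = c%:M.
Local Notation rep := (cl_rep g).
Local Notation gvec := (gvec g).
Local Notation rotation := (is_rot [set: 'I_p.+1]%SET).

Let even_n : ~~ odd p.+1. Proof. by rewrite /= odd_p. Qed.

Lemma scalar_mx_inj0 (a b : K) : a%:M = b%:M :> 'M_d -> a = b.
Proof.
by move=> /matrixP/(_ (Ordinal d_gt0) (Ordinal d_gt0)); rewrite !mxE eqxx.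
Qed.

Lemma cl_rep_comm s x : C s -> s * rep x = rep x * s.
Proof.
move=> Cs; have h : forall A, s * cl_basis g A = cl_basis g A * s.
  move=> A; rewrite /cl_basis; elim: (index_enum _) => [|i r IH].
    by rewrite !big_nil mulr1 mul1r.
  by rewrite !big_cons; case: ifP => // _; rewrite mulrA C_g // -!mulrA IH.
rewrite /cl_rep mulr_sumr mulr_suml; apply: eq_bigr => A _.
by rewrite mulZl mulZr h.
Qed.

Lemma s0_basis A : s0 * cl_basis g A = (-1) ^+ #|A| *: (cl_basis g A * s0).
Proof.
rewrite -sum1_card /cl_basis; elim: (index_enum _) => [|i r IH].
  by rewrite !big_nil mulr1 mul1r expr0 scale1r.
rewrite !big_cons; case: ifP => // _; rewrite mulrA s0_g mulNr -[g i * s0 * _]mulrA IH.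
by rewrite mulZr exprD expr1 mulN1r scaleNr mulrA.
Qed.

Lemma s0_even (x : clifford K p.+1) : (forall A : {set 'I_p.+1}, odd #|A| -> x A = 0) -> s0 * rep x = rep x * s0.
Proof.
move=> hx; rewrite /cl_rep mulr_sumr mulr_suml; apply: eq_bigr => A _.
rewrite mulZl mulZr s0_basis scalerA -signr_odd.
by case oA : (odd _); rewrite ?expr0 ?mulr1 // hx // mul0r !scale0r.
Qed.

(** The [U i] form an orthonormal frame. After multiplication by a word that aligns all of them but
    the last, [X] commutes with every generator up to a sign at the last one. For the sign 1,
    Schur's lemma [irr] makes [X] a scalar; the sign -1, of determinant -1, is excluded by [s0]. *)
Lemma clifford_group M M' (U : 'I_p.+1 -> 'rV[K]_p.+1) : M * M' = 1 ->
  (forall i, M * g i = gvec (U i) * M) -> (forall s, C s -> M * s = s * M) ->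
  M * s0 = s0 * M ->
  exists r c, [/\ all rotation r, c != 0 & M = c *: rep (spin_word r)].
Proof.
move=> MM' hU hC hs.
have M'M : M' * M = 1 by apply: mulmx1C.
have hU' i : gvec (U i) = M * g i * M' by rewrite hU -mulrA MM' mulr1.
have dU i j : dot (U i) (U j) = (i == j)%:R.
  apply: (@mulfI K 2); first by rewrite pnatr_eq0.
  apply: scalar_mx_inj0; rewrite -(gvec_dot gg) !hU' -!mulrA.
  rewrite [M' * (M * _)]mulrA M'M mul1r [M' * (M * (g i * M'))]mulrA M'M mul1r.
  rewrite -mulrDr [g i * (g j * M')]mulrA [g j * (g i * M')]mulrA -mulrDl gg -scalemx1.
  by rewrite mulZl mul1r mulZr MM'.
have [r [hr er]] := frame_rots dU (ltnSn p).
pose X := rep (spin_word r) * M.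
have hX i : X * g i = gvec (rots r (U i)) * X.
  by rewrite /X -mulrA hU mulrA (rep_word gg) // mulrA.
have hXC s : C s -> X * s = s * X.
  by move=> Cs; rewrite /X -mulrA hC // mulrA -cl_rep_comm // mulrA.
have [ev _ _] := Spin_word gg even_n d_gt0 hr.
have hXs : X * s0 = s0 * X.
  by rewrite /X -mulrA hs mulrA -s0_even // mulrA.
have XI : (M' * rep (spin_word (rot_inv r))) * X = 1.
  rewrite /X -mulrA [rep (spin_word (rot_inv r)) * _]mulrA (word_inv gg hr) mul1r.
  exact: M'M.
have X0 : X != 0.
  apply: contraTneq isT => X0; move: XI; rewrite X0 mulr0 => /matrixP.
  move=> /(_ (Ordinal d_gt0) (Ordinal d_gt0)); rewrite !mxE eqxx => /eqP.
  by rewrite eq_sym oner_eq0.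
have lt_p (i : 'I_p.+1) : i != ord_max -> (i < p)%N.
  move=> ne; have := ltn_ord i; rewrite ltnS leq_eqVlt => /orP[/eqP e|//].
  by case/eqP: ne; apply: val_inj.
(* Being orthogonal to the p vectors already aligned, the last one is [t] times the last basis
   vector, with t^2 = 1. *)
pose t := (rots r (U ord_max)) 0 ord_max.
have el : rots r (U ord_max) = t *: e_ K ord_max.
  apply/rowP => k; rewrite !mxE eqxx /=; have [->|ne] := eqVneq k ord_max; first by rewrite mulr1.
  rewrite mulr0 -dot_delta -er ?lt_p // (dot_rots _ _ hr) dU.
  by rewrite (negPf ne).
have t2 : t ^+ 2 = 1.
  have := dot_rots (U ord_max) (U ord_max) hr; rewrite dU eqxx el => h; rewrite -[RHS]h.
  rewrite /dot (bigD1 ord_max) //= big1 => [|k /negPf ne]; rewrite !mxE ?ne ?mulr0 ?mul0r //.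
  by rewrite !eqxx mulr1 addr0 expr2.
have hXl : X * g ord_max = t *: (g ord_max * X).
  rewrite hX el -[t *: e_ _ _]addr0 (gvec_linear g) gvec0 addr0 gvec_e mulZl //.
have hXi (i : 'I_p.+1) : i != ord_max -> X * g i = g i * X.
  by move=> ne; rewrite hX er ?lt_p // gvec_e.
have wi := word_inv gg (rot_inv_all hr).
move: t2 => /eqP; rewrite sqrf_eq1 => /orP[]/eqP t1; rewrite t1 ?scale1r ?scaleN1r in hXl.
  have [|c ec] := irr (N := X) _ hXC.
    by move=> i; have [->|/hXi] := eqVneq i ord_max.
  exists (rot_inv r), c; split; first exact: rot_inv_all.
    by apply: contraNneq X0 => c0; rewrite ec c0 raddf0.
  have := congr1 (fun Y => rep (spin_word (rot_inv r)) * Y) ec.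
  by rewrite /X mulrA (word_inv gg hr) mul1r -scalemx1 mulZr mulr1.
(* As p is odd, the product [N] of all generators but the last anticommutes with the last and
   commutes with the others. It corrects the sign, and [X * N] is central. *)
pose A0 := [set~ ord_max : 'I_p.+1]%SET; pose N := cl_basis g A0.
have NI : exists e : K, (e != 0) /\ (N * N = e%:M).
  rewrite /N (basis_mul gg); exists ((-1) ^+ cliff_inv A0 A0).
  rewrite signr_eq0; split=> //.
  by rewrite finset.setDv finset.setU0 basis0 scalemx1.
have cA : #|A0| = p by rewrite cardsC1 card_ord.
have gN i : g i * N = (-1) ^+ (i == ord_max) *: (N * g i).
  rewrite /N (g_basis gg); congr (_ *: _).
  rewrite -signr_odd -[RHS]signr_odd; congr (_ ^+ nat_of_bool _).
  have [->|ne] /= := eqVneq i ord_max.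
    rewrite -[RHS]odd_p -[in RHS]cA -sum1_card; congr odd; apply: eq_bigr => k.
    by rewrite !inE => ->.
  have : (#|A0| = 1 + \sum_(x in A0) (x != i))%N.
    rewrite -sum1_card (bigD1 i) /=; last by rewrite !inE.
    congr (_ + _)%N; rewrite [RHS](bigD1 i) /=; last by rewrite !inE.
    by rewrite eqxx add0n; apply: eq_bigr => k /andP[_ ->].
  by rewrite cA => /(congr1 odd); rewrite odd_p oddD /=; case: odd.
have [|s Cs|c ec] := irr (N := X * N).
- move=> i; rewrite -mulrA mulrA; have := gN i; have [->|ne] := eqVneq i ord_max.
    rewrite expr1 scaleN1r => e; rewrite -mulrA -[N * _]opprK -e mulrN mulrA hXl mulNr opprK.
    by rewrite -mulrA.
  by rewrite /= expr0 scale1r => e; rewrite -mulrA -e mulrA hXi // -mulrA.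
- rewrite -mulrA; have -> : N * s = s * N.
    rewrite /N /cl_basis; elim: (index_enum _) => [|i l IH].
      by rewrite !big_nil mulr1 mul1r.
    by rewrite !big_cons; case: ifP => // _; rewrite mulrA C_g // -!mulrA IH.
  transitivity (X * s * N); first exact: mulrA.
  by rewrite hXC //; apply/esym/mulrA.
(* [s0] commutes with [X] and anticommutes with the odd product [N], hence anticommutes with the
   scalar [X * N]; so c = 0, although [X] and [N] are invertible. *)
have : c *: s0 = - (c *: s0).
  have e1 : s0 * (X * N) = - (X * N * s0).
    have sN : s0 * N = - (N * s0).
      by rewrite /N s0_basis cA -signr_odd odd_p expr1 scaleN1r.
    transitivity (X * s0 * N); first by rewrite hXs; apply: mulrA.
    by rewrite -[LHS]mulrA sN mulrN; congr (- _); apply: mulrA.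
  by move: e1; rewrite ec -scalemx1 mulZl mulZr mul1r mulr1.
move=> /eqP; rewrite -addr_eq0 -scalerDr -mulr2n -scaler_nat scalerA scaler_eq0 (negPf s0_neq0) orbF.
rewrite mulf_eq0 pnatr_eq0 orbF => /eqP c0.
have [e [e0 NN]] := NI; case/negP: X0.
have : X * N * N = 0 by rewrite ec c0 raddf0 mul0r.
by rewrite -mulrA NN -scalemx1 mulZr mulr1 => /eqP; rewrite scaler_eq0 (negPf e0).
Qed.

End CliffordGroup.

Lemma v2rD (K : numFieldType) (L : vectType K) (x y : L) : v2r (x + y) = v2r x + v2r y.
Proof. exact: linearD. Qed.
Lemma v2rN (K : numFieldType) (L : vectType K) (x : L) : v2r (- x) = - v2r x.
Proof. exact: linearN. Qed.
Lemma v2rZ (K : numFieldType) (L : vectType K) a (x : L) : v2r (a *: x) = a *: v2r x.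
Proof. exact: linearZ. Qed.
Lemma v2r0 (K : numFieldType) (L : vectType K) : v2r (0 : L) = 0.
Proof. exact: linear0. Qed.

(** Identities between linear combinations of vectors are settled coordinate by coordinate as
    identities in the field. *)
Ltac vec_ring := apply: (@v2r_inj _ _); apply/rowP => ?;
  rewrite ?(v2rD, v2rN, v2rZ, v2r0) ?mxE; field.

(** Serves to prove vector identities modulo a^2 + b^2 = 1: the witness [w] is the cofactor of 1 - c
    in the difference of the two sides. *)
Lemma eq_mod1 (K : numFieldType) (L : lmodType K) (c : K) (w u v : L) :
  c = 1 -> u - v = (1 - c) *: w -> u = v.
Proof. by move=> ->; rewrite subrr scale0r => /eqP; rewrite subr_eq0 => /eqP. Qed.

(** * Graded Lie algebras with an odd Clifford module *)

Section GradedAutomorphism.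
Variables (K : numFieldType) (L : vectType K) (br : L -> L -> L) (tau D : L -> L).
Hypotheses (brL : forall x, linear (br x)) (brN : forall x y, br x y = - br y x).
Hypotheses (tauL : linear tau) (tauK : forall x, tau (tau x) = x).
Hypothesis tau_br : forall x y, tau (br x y) = br (tau x) (tau y).
Hypotheses (DL : linear D) (D_tau : forall x, tau (D x) = D (tau x)).
Hypothesis D_br : forall x y, D (br x y) = br (D x) y + br x (D y).
Hypothesis D2 : forall x, tau x = - x -> D (D x) = - x.
Hypothesis D3 : forall x, tau x = x -> D (D (D x)) = - (4 *: D x).

Definition odd_part x : L := 2^-1 *: (x - tau x).

Let brDr x y z : br x (y + z) = br x y + br x z.
Proof. exact: linear_D. Qed.
Let brZr a x y : br x (a *: y) = a *: br x y.
Proof. exact: linear_Z. Qed.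
Let brDl x y z : br (x + y) z = br x z + br y z.
Proof. by rewrite brN brDr opprD -!brN. Qed.
Let brZl a x y : br (a *: x) y = a *: br x y.
Proof. by rewrite brN brZr -scalerN -brN. Qed.
Let brNr x y : br x (- y) = - br x y.
Proof. by rewrite -scaleN1r brZr scaleN1r. Qed.
Let brNl x y : br (- x) y = - br x y.
Proof. by rewrite -scaleN1r brZl scaleN1r. Qed.
Let DD x y : D (x + y) = D x + D y. Proof. exact: linear_D. Qed.
Let DZ a x : D (a *: x) = a *: D x. Proof. exact: linear_Z. Qed.
Let DN x : D (- x) = - D x. Proof. by rewrite -scaleN1r DZ scaleN1r. Qed.
Let tauD x y : tau (x + y) = tau x + tau y. Proof. exact: linear_D. Qed.
Let tauZ a x : tau (a *: x) = a *: tau x. Proof. exact: linear_Z. Qed.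
Let tauN x : tau (- x) = - tau x. Proof. by rewrite -scaleN1r tauZ scaleN1r. Qed.

Lemma tau_odd x : tau (odd_part x) = - odd_part x.
Proof. by rewrite /odd_part tauZ tauD tauN tauK -scalerN opprB. Qed.

Lemma tau_even x : tau (x - odd_part x) = x - odd_part x.
Proof.
rewrite tauD tauN tau_odd opprK /odd_part; set y := tau x.
by vec_ring.
Qed.

Variables a b : K.
Hypothesis ab : a ^+ 2 + b ^+ 2 = 1.

(* exp (2 theta D) for a + i b = exp (i theta): the eigenvalues of D are i, - i  *)
(* where tau = -1 and 0, 2 i, - 2 i where tau = 1.                              *)
Definition rotor_aut x : L :=
  let y := odd_part x in let z := x - y in
  a *: y + b *: D y + (z + (a * b) *: D z + (b ^+ 2 / 2) *: D (D z)).

Lemma odd_part_odd x : tau x = - x -> odd_part x = x.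
Proof. by rewrite /odd_part => ->; set y := x; vec_ring. Qed.

Lemma odd_part_even x : tau x = x -> odd_part x = 0.
Proof. by rewrite /odd_part => ->; rewrite subrr scaler0. Qed.

Lemma D0 : D 0 = 0. Proof. exact: linear_0. Qed.

Lemma rotor_aut_odd x : tau x = - x -> rotor_aut x = a *: x + b *: D x.
Proof.
by move=> hx; rewrite /rotor_aut odd_part_odd // subrr !D0 !scaler0 !addr0.
Qed.

Lemma rotor_aut_even x : tau x = x ->
  rotor_aut x = x + (a * b) *: D x + (b ^+ 2 / 2) *: D (D x).
Proof.
by move=> hx; rewrite /rotor_aut odd_part_even // subr0 !D0 !scaler0 !add0r.
Qed.

Lemma odd_part_linear : linear odd_part.
Proof.
by move=> c x y; rewrite /odd_part tauD tauZ; move: (tau x) (tau y) => u v; vec_ring.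
Qed.

Lemma rotor_aut_linear : linear rotor_aut.
Proof.
move=> c x y; rewrite /rotor_aut odd_part_linear; move: (odd_part x) (odd_part y) => x' y'.
have -> : c *: x + y - (c *: x' + y') = c *: (x - x') + (y - y') by vec_ring.
move: (x - x') (y - y') => x1 y1; rewrite !(DD, DZ).
move: (D x') (D y') (D (D x1)) (D (D y1)) (D x1) (D y1) => u1 u2 u3 u4 u5 u6.
by vec_ring.
Qed.

Let D_odd x : tau x = - x -> tau (D x) = - D x.
Proof. by move=> h; rewrite D_tau h DN. Qed.
Let D_even x : tau x = x -> tau (D x) = D x.
Proof. by move=> h; rewrite D_tau h. Qed.

Let aut_oo x y : tau x = - x -> tau y = - y ->
  rotor_aut (br x y) = br (rotor_aut x) (rotor_aut y).
Proof.
move=> hx hy; rewrite rotor_aut_even; last by rewrite tau_br hx hy brNr brNl opprK.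
rewrite !rotor_aut_odd // D_br DD !D_br !D2 //.
rewrite !(brDl, brDr, brZl, brZr, brNl, brNr) !scalerA.
move: (br x y) (br (D x) y) (br x (D y)) (br (D x) (D y)) => B00 B10 B01 B11.
by apply: (eq_mod1 (w := B00) ab); vec_ring.
Qed.

Let aut_oe x z : tau x = - x -> tau z = z ->
  rotor_aut (br x z) = br (rotor_aut x) (rotor_aut z).
Proof.
move=> hx hz; rewrite rotor_aut_odd; last by rewrite tau_br hx hz brNl.
rewrite rotor_aut_odd // rotor_aut_even // D_br.
(* [u, z] is odd, so D^2 = -1 on it. Expanding D^2 by the Leibniz rule, with D^2 u = - u, leaves
   this relation. *)
have rel u : tau u = - u -> br u (D (D z)) = - 2 *: br (D u) (D z).
  move=> hu; have : D (D (br u z)) = - br u z by apply: D2; rewrite tau_br hu hz brNl.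
  rewrite D_br DD !D_br D2 // brNl => /eqP; rewrite -subr_eq0 => /eqP e.
  apply/eqP; rewrite -subr_eq0 -[X in _ == X]e; apply/eqP.
  by move: (br u _) (br (D u) _) (br u _) => u1 u2 u3; vec_ring.
have e1 := rel _ hx; have e2 := rel _ (D_odd hx); rewrite (D2 hx) brNl in e2.
rewrite !(brDl, brDr, brZl, brZr) e1 e2.
move: (br x z) (br (D x) z) (br x (D z)) (br (D x) (D z)) => B00 B10 B01 B11.
by apply: (eq_mod1 (w := b *: B01) ab); vec_ring.
Qed.

Let aut_ee y z : tau y = y -> tau z = z ->
  rotor_aut (br y z) = br (rotor_aut y) (rotor_aut z).
Proof.
move=> hy hz; rewrite !rotor_aut_even //; last by rewrite tau_br hy hz.
(* [u, z] is even, so D^3 = - 4 D on it. In the Leibniz expansion the outer terms cancel against the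
   right-hand side and three times this sum remains. *)
have rel u : tau u = u -> br (D (D u)) (D z) + br (D u) (D (D z)) = 0.
  move=> hu; have : D (D (D (br u z))) = - (4 *: D (br u z)).
    by apply: D3; rewrite tau_br hu hz.
  rewrite D_br DD !D_br !DD !D_br !D3 // !(brNl, brNr, brZl, brZr).
  move: (br (D u) z) (br u (D z)) (br (D (D u)) (D z)) (br (D u) (D (D z))).
  move=> B10 B01 B21 B12 /eqP; rewrite -subr_eq0 => /eqP e.
  apply: (@scalerI _ _ 3); first by rewrite pnatr_eq0.
  by rewrite scaler0 -[RHS]e; vec_ring.
have e1 := rel _ hy.
have e2 : br (D (D y)) (D (D z)) = 4 *: br (D y) (D z).
  have := rel _ (D_even hy); rewrite D3 // brNl brZl addrC => /eqP.
  by rewrite subr_eq0 => /eqP.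
have {}e1 : br (D (D y)) (D z) = - br (D y) (D (D z)) by apply/eqP; rewrite -addr_eq0 e1.
rewrite D_br !DD !D_br !(brDl, brDr, brZl, brZr) e1 e2.
move: (br y z) (br (D y) z) (br y (D z)) (br (D y) (D z)) (br (D (D y)) z)
  (br y (D (D z))) (br (D y) (D (D z))) => B00 B10 B01 B11 B20 B02 B12.
by apply: (eq_mod1 (w := b ^+ 2 *: B11) ab); vec_ring.
Qed.

(** An exponential of a derivation is an automorphism. With the closed form at hand no series is
    involved: the arguments are split by parity, and the polynomial relations of [D] on brackets
    reduce each case to a^2 + b^2 = 1. *)
Lemma rotor_aut_br x y : rotor_aut (br x y) = br (rotor_aut x) (rotor_aut y).
Proof.
have RD u v : rotor_aut (u + v) = rotor_aut u + rotor_aut v by apply: linear_D rotor_aut_linear.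
have RN u : rotor_aut (- u) = - rotor_aut u.
  by rewrite -scaleN1r (linear_Z _ _ rotor_aut_linear) scaleN1r.
have ex z : z = odd_part z + (z - odd_part z) by rewrite addrC subrK.
rewrite (ex x) (ex y); move: (tau_odd x) (tau_odd y) (tau_even x) (tau_even y).
move: (odd_part x) (odd_part y) (x - odd_part x) (y - odd_part y) => x1 y1 x2 y2 h1 h2 h3 h4.
rewrite (brDl x1 x2) !(brDr _ y1 y2) !RD (brDl (rotor_aut x1)) !(brDr _ (rotor_aut y1)).
rewrite (aut_oo h1 h2) (aut_oe h1 h4) (aut_ee h3 h4).
by rewrite (brN x2 y1) RN (aut_oe h2 h3) -brN.
Qed.

End GradedAutomorphism.

(** Changing the sign of [b] reverses the angle; on the odd part (a - b D) (a + b D) = a^2 + b^2. *)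
Lemma rotor_autK (K : numFieldType) (L : vectType K) (tau D : L -> L) (a b : K) :
  linear tau -> (forall x, tau (tau x) = x) -> linear D ->
  (forall x, tau (D x) = D (tau x)) ->
  (forall x, tau x = - x -> D (D x) = - x) ->
  (forall x, tau x = x -> D (D (D x)) = - (4 *: D x)) -> a ^+ 2 + b ^+ 2 = 1 ->
  cancel (rotor_aut tau D a b) (rotor_aut tau D a (- b)).
Proof.
move=> tauL tauK DL D_tau D2 D3 ab x.
have DD u v : D (u + v) = D u + D v by apply: linear_D.
have DZ c u : D (c *: u) = c *: D u by apply: linear_Z.
have DN u : D (- u) = - D u by rewrite -scaleN1r DZ scaleN1r.
have tD u v : tau (u + v) = tau u + tau v by apply: linear_D.
have tZ c u : tau (c *: u) = c *: tau u by apply: linear_Z.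
have ex z : z = odd_part tau z + (z - odd_part tau z) by rewrite addrC subrK.
have RD c u v : rotor_aut tau D a c (u + v) = rotor_aut tau D a c u + rotor_aut tau D a c v.
  by apply: linear_D (rotor_aut_linear tauL DL a c).
rewrite (ex x); move: (tau_odd tauL tauK x) (tau_even tauL tauK x).
move: (odd_part _ _) (x - _) => y z hy hz.
rewrite (RD b y z) (RD (- b) (rotor_aut tau D a b y)); congr (_ + _).
  have hDy : tau (a *: y + b *: D y) = - (a *: y + b *: D y).
    rewrite tD !tZ D_tau hy -[- y]scaleN1r DZ.
    by move: (D y) => u; vec_ring.
  rewrite [rotor_aut tau D a b y]rotor_aut_odd // rotor_aut_odd // DD !DZ D2 //.
  by apply: (eq_mod1 (w := - y) ab); move: (D y) => u; vec_ring.
have hDz : tau (z + (a * b) *: D z + (b ^+ 2 / 2) *: D (D z)) =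
    z + (a * b) *: D z + (b ^+ 2 / 2) *: D (D z).
  by rewrite !tD !tZ !D_tau hz.
rewrite [rotor_aut tau D a b z]rotor_aut_even // rotor_aut_even // !(DD, DZ) !D3 // ?DN ?DZ.
move: (D z) (D (D z)) => v u.
by apply: (eq_mod1 (w := b ^+ 2 *: u) ab); vec_ring.
Qed.

Lemma linfunE (K : numFieldType) (U V : vectType K) (f : U -> V) : linear f ->
  forall x, linfun f x = f x.
Proof.
move=> lf; pose f' : {linear U -> V} := HB.pack f (GRing.isLinear.Build _ _ _ _ f lf).
exact: (lfunE f').
Qed.

(** * Operators on the odd part as matrices *)

Section OddOperators.
Variables (K : numFieldType) (L : vectType K) (tau : L -> L).
Hypotheses (tauL : linear tau) (tauK : forall x, tau (tau x) = x).

Definition odd_space : {vspace L} := subspace_of [set x : L | tau x = - x].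
Local Notation d := (\dim odd_space).

Lemma mem_odd_space x : x \in odd_space <-> tau x = - x.
Proof.
apply: mem_subspace_of => [|a u w hu hw] /=; first by rewrite (linear_0 tauL) oppr0.
by rewrite tauL hu hw opprD scalerN.
Qed.

Definition emb (r : 'rV[K]_d) : L := \sum_i r 0 i *: (vbasis odd_space)`_i.
Definition prj (x : L) : 'rV[K]_d := \row_i coord (vbasis odd_space) i (odd_part tau x).

Lemma emb_linear : linear emb.
Proof.
move=> a r s; rewrite /emb scaler_sumr -big_split; apply: eq_bigr => i _.
by rewrite !mxE scalerDl scalerA.
Qed.

Lemma prj_linear : linear prj.
Proof.
by move=> a x y; apply/rowP => i; rewrite !mxE (odd_part_linear tauL) linearP.
Qed.

Lemma emb_odd r : tau (emb r) = - emb r.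
Proof.
apply/mem_odd_space; apply: memv_suml => i _; apply: memvZ.
by apply: vbasis_mem; rewrite mem_nth // size_tuple.
Qed.

Lemma prjK x : tau x = - x -> emb (prj x) = x.
Proof.
move=> hx; rewrite [RHS](coord_vbasis (U := odd_space)); last exact/mem_odd_space.
by apply: eq_bigr => i _; rewrite mxE (odd_part_odd hx).
Qed.

Lemma embK : cancel emb prj.
Proof.
move=> r; apply/rowP => i; rewrite mxE (odd_part_odd (emb_odd r)).
by rewrite /emb coord_sum_free //; apply: basis_free (vbasisP _).
Qed.

(** Only the restriction of [T] to the odd part matters. Coordinates are row vectors, so the
    transpose is what makes composition correspond to the matrix product in the same order. *)
Definition represents (T : L -> L) (N : 'M[K]_d) : Prop :=
  forall r, T (emb r) = emb (r *m N^T).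

Lemma represents_odd T N x : represents T N -> tau x = - x -> T x = emb (prj x *m N^T).
Proof. by move=> h hx; rewrite -{1}(prjK hx) h. Qed.

Lemma represents_inj T N P : represents T N -> represents T P -> N = P.
Proof.
move=> hN hP; apply: trmx_inj; apply/row_matrixP => i; rewrite !rowE.
by apply: (can_inj embK); rewrite -hN -hP.
Qed.

Lemma represents_comp T S N P : represents T N -> represents S P ->
  represents (fun x => T (S x)) (N * P).
Proof. by move=> hT hS r; rewrite hS hT [N * P]/(N *m P) trmx_mul mulmxA. Qed.

Lemma represents_lin c T S N P : represents T N -> represents S P ->
  represents (fun x => c *: T x + S x) (c *: N + P).
Proof.
move=> hT hS r; rewrite hT hS -emb_linear; congr emb.
by rewrite linearP /= mulmxDr -scalemxAr.
Qed.

Lemma represents_scalar c T : (forall x, tau x = - x -> T x = c *: x) -> represents T c%:M.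
Proof.
move=> h r; rewrite h ?emb_odd // tr_scalar_mx mul_mx_scalar.
by rewrite (linear_Z _ _ emb_linear).
Qed.

Lemma represents_eq T S N : represents T N -> (forall x, tau x = - x -> T x = S x) ->
  represents S N.
Proof. by move=> hT h r; rewrite -h ?emb_odd. Qed.

Definition matrix_of (T : L -> L) : 'M[K]_d := \matrix_(i, j) prj (T (emb 'e_j)) 0 i.

Lemma matrix_ofP T : linear T -> (forall x, tau x = - x -> tau (T x) = - T x) ->
  represents T (matrix_of T).
Proof.
move=> lT hT r; rewrite -[LHS]prjK; last by apply: hT; exact: emb_odd.
congr emb; rewrite {1}(row_sum_delta r).
have lf : linear (fun r => prj (T (emb r))) by move=> a u w; rewrite emb_linear lT prj_linear.
rewrite (linear_lincomb _ _ _ lf); apply/rowP => i; rewrite summxE !mxE.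
by apply: eq_bigr => j _; rewrite !mxE.
Qed.

Lemma matrix_of_linear : linear (fun T : 'End(L) => matrix_of T).
Proof.
move=> a T S; apply/matrixP => i j; rewrite !mxE.
by rewrite lfun_linE (odd_part_linear tauL) linearP.
Qed.

End OddOperators.

(** * Continuity of linear and quadratic maps *)

Section Continuity.
Variable K : numFieldType.

Lemma continuous_rows m n (h : 'rV[K]_m -> 'rV[K]_n) :
  (forall k, continuous (fun u => h u 0 k)) -> continuous h.
Proof.
move=> hc x A [P hP PA].
have : \forall y \near x, forall ij : 'I_1 * 'I_n, P ij.1 ij.2 (h y ij.1 ij.2).
  apply: (@filter_forall _ _ (fun ij y => P ij.1 ij.2 (h y ij.1 ij.2)) (nbhs x)).
  move=> [i j] /=; rewrite (ord1 i).
  exact: (hc j x (P 0 j) (hP 0 j)).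
by apply: filterS => y hy; apply: PA => i j; exact: (hy (i, j)).
Qed.

Lemma continuous_add (T : topologicalType) (f g : T -> K) :
  continuous f -> continuous g -> continuous (fun x => f x + g x).
Proof. by move=> hf hg x; apply: (cvgD (hf x) (hg x)). Qed.

Lemma continuous_mul (T : topologicalType) (f g : T -> K) :
  continuous f -> continuous g -> continuous (fun x => f x * g x).
Proof. by move=> hf hg x; apply: (cvgM (hf x) (hg x)). Qed.

Lemma continuous_sum (T : topologicalType) (I : Type) (r : seq I) (F : I -> T -> K) :
  (forall i, continuous (F i)) -> continuous (fun x => \sum_(i <- r) F i x).
Proof.
move=> hF; elim: r => [|i r IH].
  rewrite (_ : (fun x => _) = fun _ : T => 0); first exact: cst_continuous.
  by apply: funext => y; rewrite big_nil.
rewrite (_ : (fun x => _) = fun x => F i x + \sum_(j <- r) F j x); first exact: continuous_add.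
by apply: funext => y; rewrite big_cons.
Qed.

Variables U V : vectType K.

Let r2v_sum (u : 'rV[K]_(dim U)) : r2v u = \sum_i u 0 i *: r2v 'e_i :> U.
Proof.
have lr : linear (@r2v K U) by move=> a x y; rewrite linearP.
by rewrite {1}(row_sum_delta u) (linear_lincomb _ _ _ lr).
Qed.

(** In coordinates the map is a polynomial of degree 2. This is the shape of [aut_of]. *)
Lemma continuous_quadratic (S : set U) (A : U -> V) (B : U -> U -> V) : linear A ->
  (forall x, linear (B x)) -> (forall y, linear (fun x => B x y)) ->
  continuous_on S (fun x => A x + B x x).
Proof.
move=> lA lB lB'; apply: continuous_subspaceT; apply: continuous_rows => k.
pose e i : U := r2v 'e_i.
pose q (u : 'rV[K]_(dim U)) : K := \sum_i u 0 i * v2r (A (e i)) 0 k +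
  \sum_i \sum_j u 0 i * u 0 j * v2r (B (e i) (e j)) 0 k.
rewrite (_ : (fun u => _) = q); last first.
  apply: funext => u; rewrite v2rD mxE r2v_sum; congr (_ + _).
    rewrite (linear_lincomb _ _ _ lA) linear_sum summxE; apply: eq_bigr => i _.
    by rewrite linearZ mxE.
  have eB w : B (\sum_i u 0 i *: e i) w = \sum_i u 0 i *: B (e i) w.
    exact: (linear_lincomb _ _ _ (lB' w)).
  rewrite eB linear_sum summxE; apply: eq_bigr => i _.
  rewrite linearZ mxE (linear_lincomb _ _ _ (lB _)) linear_sum summxE mulr_sumr.
  by apply: eq_bigr => j _; rewrite linearZ mxE mulrA.
have hc i : continuous (fun u : 'rV[K]_(dim U) => u 0 i) by exact: coord_continuous.
have hk (c : K) : continuous (fun _ : 'rV[K]_(dim U) => c) by exact: cst_continuous.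
apply: continuous_add.
  by apply: continuous_sum => i; apply: continuous_mul.
apply: continuous_sum => i; apply: continuous_sum => j.
by apply: continuous_mul => //; apply: continuous_mul.
Qed.

Lemma continuous_linear (S : set U) (A : U -> V) : linear A -> continuous_on S A.
Proof.
move=> lA; have := @continuous_quadratic S A (fun _ _ => 0) lA.
have -> : (fun x => A x + 0) = A by apply: funext => x; rewrite addr0.
by apply => x a y z; rewrite scaler0 addr0.
Qed.

End Continuity.

(** * The group of graded automorphisms is a spinor group *)

Definition graded_aut (K : numFieldType) (L : vectType K) (br : L -> L -> L) (sg : L -> L)
    (So : L -> Prop) (al : 'End(L)) : Prop :=
  [/\ bijective al /\ (forall x y, al (br x y) = br (al x) (al y)),
      forall x, sg (al x) = al (sg x)
    & forall s, So s -> forall x, br s (al x) = al (br s x)].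

Definition square (T : Type) (sg : T -> T) (x : T) : T := sg (sg x).

Section SpinAutomorphisms.
Variables (K : numClosedFieldType) (L : vectType K) (br : L -> L -> L) (sg : L -> L).
Variables (So C : L -> Prop) (s0 : L) (p : nat) (v : 'I_p.+1 -> L).
Variables (m : nat) (ca cb : 'I_m -> L).
Local Notation tau := (square sg).
Hypotheses (brL : forall x, linear (br x)) (brN : forall x y, br x y = - br y x).
Hypotheses (sgL : linear sg) (tauK : forall x, tau (tau x) = x).
Hypothesis tau_br : forall x y, tau (br x y) = br (tau x) (tau y).
Hypothesis odd_p : odd p.
Hypothesis v_br : forall i x y, br (v i) (br x y) = br (br (v i) x) y + br x (br (v i) y).
Hypothesis v_sg : forall i x, sg (br (v i) x) = - br (v i) (sg x).
Hypothesis v_tau : forall i, tau (v i) = v i.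
Hypothesis v_cliff : forall i j x, tau x = - x ->
  br (v i) (br (v j) x) + br (v j) (br (v i) x) = (2 * (i == j)%:R) *: x.
Hypothesis So_tau : forall s, So s -> tau s = s.
Hypothesis v_So : forall i j s, So s -> br (v i) (br (v j) s) = br (v j) (br (v i) s).
Hypotheses (ca_odd : forall t, tau (ca t) = - ca t) (cb_odd : forall t, tau (cb t) = - cb t).
Hypothesis casimir : forall z, tau z = z -> z = \sum_t br (ca t) (br (cb t) z).
Hypothesis aut_v : forall al : 'End(L), graded_aut br sg So al -> forall i,
  exists u : 'rV[K]_p.+1, al (v i) = \sum_j u 0 j *: v j.
Hypothesis C_So : forall s, C s -> So s.
Hypothesis C_v : forall s i x, C s -> tau x = - x -> br s (br (v i) x) = br (v i) (br s x).
Hypothesis So_s0 : So s0.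
Hypothesis s0_v : forall i x, tau x = - x -> br s0 (br (v i) x) = - br (v i) (br s0 x).
Variable w0 : L.
Hypotheses (w0_odd : tau w0 = - w0) (s0_w0 : br s0 w0 != 0).
Hypothesis irr : forall T : 'End(L),
  (forall i x, tau x = - x -> T (br (v i) x) = br (v i) (T x)) ->
  (forall s x, C s -> tau x = - x -> T (br s x) = br s (T x)) ->
  (forall x, tau x = - x -> tau (T x) = - T x) ->
  exists c, forall x, tau x = - x -> T x = c *: x.

Local Notation G := (graded_aut br sg So).
Local Notation d := (\dim (odd_space tau)).
Local Notation emb := (@emb K L tau).
Local Notation prj := (@prj K L tau).
Local Notation represents := (@represents K L tau).
Local Notation matrix_of := (@matrix_of K L tau).
Local Notation rotation := (is_rot [set: 'I_p.+1]%SET).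

Let tauL : linear tau. Proof. by move=> a x y; rewrite /square sgL sgL. Qed.
Let brDr x y z : br x (y + z) = br x y + br x z.
Proof. exact: linear_D. Qed.
Let brZr a x y : br x (a *: y) = a *: br x y.
Proof. exact: linear_Z. Qed.
Let brDl x y z : br (x + y) z = br x z + br y z.
Proof. by rewrite brN brDr opprD -!brN. Qed.
Let brZl a x y : br (a *: x) y = a *: br x y.
Proof. by rewrite brN brZr -scalerN -brN. Qed.
Let brNr x y : br x (- y) = - br x y.
Proof. by rewrite -scaleN1r brZr scaleN1r. Qed.
Let br0r x : br x 0 = 0. Proof. exact: linear_0. Qed.
Let brNl x y : br (- x) y = - br x y.
Proof. by rewrite -scaleN1r brZl scaleN1r. Qed.
Let sgD x y : sg (x + y) = sg x + sg y. Proof. exact: linear_D. Qed.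
Let sgZ a x : sg (a *: x) = a *: sg x. Proof. exact: linear_Z. Qed.
Let sgN x : sg (- x) = - sg x. Proof. by rewrite -scaleN1r sgZ scaleN1r. Qed.

Let br_odd x y : tau x = x -> tau y = - y -> tau (br x y) = - br x y.
Proof. by move=> hx hy; rewrite tau_br hx hy brNr. Qed.

Definition gam i : 'M[K]_d := matrix_of (br (v i)).

Lemma gamP i : represents (br (v i)) (gam i).
Proof. by apply: (matrix_ofP tauL) => // x; apply: br_odd. Qed.

Lemma gam_cliff i j : gam i * gam j + gam j * gam i = (2 * (i == j)%:R)%:M.
Proof.
have h := represents_lin 1 (represents_comp (gamP i) (gamP j))
  (represents_comp (gamP j) (gamP i)).
rewrite -[gam i * gam j]scale1r; apply: (represents_inj tauL h).
by apply: (represents_scalar tauL) => x hx; rewrite scale1r v_cliff.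
Qed.

Lemma w0_neq0 : w0 != 0.
Proof. by apply: contraNneq s0_w0 => ->; rewrite br0r. Qed.

Lemma odd_dim_gt0 : (0 < d)%N.
Proof.
rewrite lt0n dimv_eq0; apply: contraNneq w0_neq0 => e.
by have := (mem_odd_space tauL w0).2 w0_odd; rewrite e memv0 => /eqP->.
Qed.

Let even_n : ~~ odd p.+1. Proof. by rewrite /= odd_p. Qed.
Local Notation rep := (cl_rep gam).

Lemma aut_odd (al : 'End(L)) : G al -> forall x, tau x = - x -> tau (al x) = - al x.
Proof. by move=> [_ h _] x hx; rewrite /square !h -/(tau x) hx linearN. Qed.

Lemma aut_represents (al : 'End(L)) : G al -> represents al (matrix_of al).
Proof. by move=> h; apply: (matrix_ofP tauL); [exact: End_linear|exact: aut_odd]. Qed.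

Lemma graded_aut_comp (al be : 'End(L)) : G al -> G be -> G (al \o be)%VF.
Proof.
move=> [[ba ha] sa ca'] [[bb hb] sb cb']; split; first split.
- by apply: (eq_bij (bij_comp ba bb)) => x; rewrite lfunE.
- by move=> x y; rewrite !lfunE /= hb ha.
- by move=> x; rewrite !lfunE /= sa sb.
- by move=> s hs x; rewrite !lfunE /= ca' // cb'.
Qed.

Section Rotor.
Variables (i j : 'I_p.+1) (a b : K).
Hypotheses (ij : i != j) (ab : a ^+ 2 + b ^+ 2 = 1).

(** Half the commutator of the derivations ad v_i and ad v_j. On the odd part these anticommute, so
    it acts there as the Clifford product g_i g_j, with square -1. *)
Definition rot_der x : L := 2^-1 *: (br (v i) (br (v j) x) - br (v j) (br (v i) x)).

Let D_linear : linear rot_der.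
Proof.
move=> c x y; rewrite /rot_der !brL; move: (br _ _) (br _ _) (br _ _) (br _ _) => x1 x2 x3 x4.
by vec_ring.
Qed.

Let D_br x y : rot_der (br x y) = br (rot_der x) y + br x (rot_der y).
Proof.
have e k l : br (v k) (br (v l) (br x y)) =
    br (br (v k) (br (v l) x)) y + br (br (v l) x) (br (v k) y)
    + (br (br (v k) x) (br (v l) y) + br x (br (v k) (br (v l) y))).
  by rewrite (v_br l x y) brDr (v_br k (br (v l) x)) (v_br k x).
rewrite /rot_der !e brZr brZl brDr brDl brNr brNl.
move: (br (br _ (br _ x)) y) (br (br _ (br _ x)) y) (br x (br _ _)) (br x (br _ _)).
move: (br (br _ x) (br _ y)) (br (br _ x) (br _ y)) => x1 x2 x3 x4 x5 x6.
by vec_ring.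
Qed.

Let D_sg x : sg (rot_der x) = rot_der (sg x).
Proof. by rewrite /rot_der sgZ sgD sgN !v_sg !brNr !opprK. Qed.

Let D_tau x : tau (rot_der x) = rot_der (tau x).
Proof. by rewrite /square !D_sg. Qed.

Let D_odd x : tau x = - x -> rot_der x = br (v i) (br (v j) x).
Proof.
move=> hx; rewrite /rot_der; have := v_cliff i j hx; rewrite (negPf ij) mulr0 scale0r.
move=> /eqP; rewrite addr_eq0 => /eqP e; apply: (@scalerI _ _ 2); first by rewrite pnatr_eq0.
by rewrite scalerA mulfV ?pnatr_eq0 // scale1r {1}e e; vec_ring.
Qed.

Let v_odd k x : tau x = - x -> tau (br (v k) x) = - br (v k) x.
Proof. by move=> hx; apply: br_odd. Qed.

Let v_sqr k x : tau x = - x -> br (v k) (br (v k) x) = x.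
Proof.
move=> hx; have := v_cliff k k hx; rewrite eqxx mulr1 -mulr2n -scaler_nat.
by move/scalerI; apply; rewrite pnatr_eq0.
Qed.

Let D2 x : tau x = - x -> rot_der (rot_der x) = - x.
Proof.
move=> hx; rewrite !D_odd //; last by do 2!apply: v_odd.
have := v_cliff i j (v_odd j hx); rewrite (negPf ij) mulr0 scale0r v_sqr //.
move=> /eqP; rewrite addrC addr_eq0 => /eqP->.
by rewrite brNr v_sqr.
Qed.

Let DD x y : rot_der (x + y) = rot_der x + rot_der y.
Proof. exact: linear_D. Qed.
Let DZ c x : rot_der (c *: x) = c *: rot_der x.
Proof. exact: linear_Z. Qed.
Let DN x : rot_der (- x) = - rot_der x.
Proof. by rewrite -scaleN1r DZ scaleN1r. Qed.

(** By the Casimir identity an even element is a sum of brackets [y, z] of odd ones. On such a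
    bracket D^2 = -1 in each factor gives D^2 [y, z] = - 2 [y, z] + 2 [D y, D z], and one more D
    gives - 4 D [y, z]. *)
Let D3 x : tau x = x -> rot_der (rot_der (rot_der x)) = - (4 *: rot_der x).
Proof.
have oo y z : tau y = - y -> tau z = - z ->
    rot_der (rot_der (rot_der (br y z))) = - (4 *: rot_der (br y z)).
  move=> hy hz; have hDy : tau (rot_der y) = - rot_der y by rewrite D_tau hy DN.
  have hDz : tau (rot_der z) = - rot_der z by rewrite D_tau hz DN.
  rewrite D_br !DD !D_br !DD !D_br !D2 // !(DN, brNr, brNl).
  move: (br y (rot_der z)) (br (rot_der y) z) => x1 x2.
  by vec_ring.
move=> hx; rewrite (casimir hx).
have S (I : Type) (r : seq I) (F : I -> L) :
    rot_der (\sum_(t <- r) F t) = \sum_(t <- r) rot_der (F t).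
  elim: r => [|t r IH]; first by rewrite !big_nil; exact: (linear_0 D_linear).
  by rewrite !big_cons DD IH.
rewrite !S scaler_sumr -sumrN; apply: eq_bigr => t _; apply: oo => //.
by rewrite tau_br hx cb_odd brNl.
Qed.

Definition rotor_end : 'End(L) := linfun (rotor_aut tau rot_der a b).

Let rotor_endE x : rotor_end x = rotor_aut tau rot_der a b x.
Proof. exact: (linfunE (rotor_aut_linear tauL D_linear a b)). Qed.

(** The derivation commutes with sigma because its two factors ad v each change a sign, and with ad
    s for s in so(6) because it kills s. Both properties pass to the exponential. *)
Lemma rotor_graded : G rotor_end.
Proof.
split; first split.
- apply: (eq_bij (f := rotor_aut tau rot_der a b)); last by move=> x; rewrite rotor_endE.
  exists (rotor_aut tau rot_der a (- b)).
    exact: (rotor_autK tauL tauK D_linear D_tau D2 D3 ab).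
  have ab' : a ^+ 2 + (- b) ^+ 2 = 1 by rewrite sqrrN.
  by have := rotor_autK tauL tauK D_linear D_tau D2 D3 ab'; rewrite opprK.
- move=> x y; rewrite !rotor_endE.
  exact: (rotor_aut_br brL brN tauL tauK tau_br D_linear D_tau D_br D2 D3 ab).
- move=> x; rewrite !rotor_endE /rotor_aut.
  have op y : odd_part tau (sg y) = sg (odd_part tau y).
    by rewrite /odd_part sgZ sgD sgN.
  by rewrite op !(sgD, sgZ, sgN, D_sg).
- move=> s hs x; rewrite !rotor_endE /rotor_aut.
  have op y : odd_part tau (br s y) = br s (odd_part tau y).
    by rewrite /odd_part tau_br So_tau // brZr brDr brNr.
  (* On so(6) the products of ad v_i and ad v_j are symmetric in i and j, so [v_i, v_j] centralises
     so(6). *)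
  have Ds : rot_der s = 0 by rewrite /rot_der v_So // subrr scaler0.
  have Dbs y : rot_der (br s y) = br s (rot_der y).
    by rewrite D_br Ds brN br0r oppr0 add0r.
  rewrite op -[br s x - _](_ : br s (x - odd_part tau x) = _); last by rewrite brDr brNr.
  move: (odd_part tau x) (x - _) => y z.
  by rewrite !Dbs !brDr !brZr.
Qed.

Lemma rotor_represents : represents rotor_end (rep (rotor (i, j, a, b))).
Proof.
rewrite (rep_rotor_E gam_cliff); last by rewrite /is_rot !inE ij ab eqxx.
rewrite addrC.
have hg := represents_comp (gamP i) (gamP j).
have h1 : represents (fun x => a *: x) a%:M by exact: (represents_scalar tauL).
apply: (represents_eq tauL (represents_lin b hg h1)) => x hx.
by rewrite rotor_endE rotor_aut_odd // D_odd // addrC.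
Qed.

End Rotor.

Lemma word_graded r : all rotation r -> exists al, G al /\ represents al (rep (spin_word r)).
Proof.
elim: r => [_|[[[i j] a] b] r IH h]; last first.
  have /andP[/and4P[_ _ ij /eqP ab] /IH[al [hG hal]]] := h.
  exists (rotor_end i j a b \o al)%VF; split.
    by apply: graded_aut_comp => //; apply: rotor_graded.
  rewrite (cl_rep_mul gam_cliff).
  apply: (represents_eq tauL (represents_comp (rotor_represents ij ab) hal)) => x _.
  by rewrite lfunE.
exists \1%VF; split; last first.
  rewrite [spin_word _]/= cl_rep_one; apply: (represents_scalar tauL (c := 1)) => x _.
  by rewrite scale1r id_lfunE.
split; first split.
- by exists id => x; rewrite id_lfunE.
- by move=> x y; rewrite !id_lfunE.
- by move=> x; rewrite !id_lfunE.
- by move=> s _ x; rewrite !id_lfunE.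
Qed.

Definition centralizing (S : 'M[K]_d) : Prop := exists s, C s /\ represents (br s) S.
Definition s0_mx : 'M[K]_d := matrix_of (br s0).

Lemma s0_represents : represents (br s0) s0_mx.
Proof. by apply: (matrix_ofP tauL) => // x; apply: br_odd; apply: So_tau. Qed.

Lemma C_represents s : C s -> represents (br s) (matrix_of (br s)).
Proof.
by move=> hs; apply: (matrix_ofP tauL) => // x; apply: br_odd; apply: So_tau; exact: C_So.
Qed.

Lemma centralizing_gam S i : centralizing S -> S * gam i = gam i * S.
Proof.
move=> [s [hs hS]]; apply: (represents_inj tauL (represents_comp hS (gamP i))).
by apply: (represents_eq tauL (represents_comp (gamP i) hS)) => x hx; rewrite C_v.
Qed.

Lemma s0_gam i : s0_mx * gam i = - (gam i * s0_mx).
Proof.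
apply/eqP; rewrite -addr_eq0 -[s0_mx * _]scale1r -(raddf0 (@scalar_mx K d)); apply/eqP.
apply: (represents_inj tauL (represents_lin 1 (represents_comp s0_represents (gamP i))
  (represents_comp (gamP i) s0_represents))).
apply: (represents_scalar tauL) => x hx.
by rewrite s0_v // scale1r addNr scale0r.
Qed.

Lemma s0_mx_neq0 : s0_mx != 0.
Proof.
apply: contraNneq s0_w0 => e; rewrite (represents_odd tauL s0_represents w0_odd) e.
by rewrite trmx0 mulmx0 (linear_0 (@emb_linear K L tau)).
Qed.

Lemma gam_irr N : (forall i, N * gam i = gam i * N) ->
  (forall S, centralizing S -> N * S = S * N) -> exists c, N = c%:M.
Proof.
move=> hg hC; pose T := fun x => emb (prj x *m N^T).
have lT : linear T by move=> a x y; rewrite /T (prj_linear tauL) mulmxDl -scalemxAl emb_linear.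
have TE := linfunE lT.
have hT : represents (linfun T) N by move=> r; rewrite TE /T (embK tauL).
have hcomm S P : represents S P -> N * P = P * N ->
    forall x, tau x = - x -> linfun T (S x) = S (linfun T x).
  move=> hS hP x hx; have := represents_comp hT hS; rewrite hP => h1.
  rewrite (represents_odd tauL h1 hx).
  by rewrite -(represents_odd tauL (represents_comp hS hT) hx).
have [|||c hc] := irr (T := linfun T).
- by move=> i; apply: hcomm (gamP i) (hg i).
- move=> s x hs hx; apply: (hcomm _ _ (C_represents hs)) => //.
  by apply: hC; exists s; split=> //; apply: C_represents.
- by move=> x hx; rewrite TE /T (emb_odd tauL).
exists c; apply: (represents_inj tauL hT); exact: (represents_scalar tauL).
Qed.

(** A sign c is itself the rotor with a = c and b = 0, so words of rotors absorb signs. *)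
Lemma word_scale (c : K) (r : seq ('I_p.+1 * 'I_p.+1 * K * K)) :
  c ^+ 2 = 1 -> all rotation r ->
  exists r', all rotation r' /\ c *: (spin_word r : clifford K p.+1) = spin_word r'.
Proof.
move=> c2 hr; have p0 : ord0 != ord_max :> 'I_p.+1.
  by apply/eqP => /(congr1 val) /= e; have := odd_p; rewrite -e.
have hq : rotation (ord0, ord_max, c, 0).
  by rewrite /is_rot !inE p0 c2 expr0n addr0 eqxx.
exists ((ord0, ord_max, c, 0) :: r); split; first exact/andP.
apply: (rep_inj gam_cliff even_n odd_dim_gt0).
rewrite (cl_rep_mul gam_cliff) (rep_rotor_E gam_cliff hq) scale0r addr0.
by rewrite (linear_Z _ _ (cl_rep_linear _)) -scalemx1 mulZl mul1r.
Qed.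

Lemma gvec_represents (u : 'rV[K]_p.+1) :
  represents (br (\sum_j u 0 j *: v j)) (gvec gam u).
Proof.
move=> r; rewrite /gvec.
have lbr : linear (fun y => br y (emb r)) by move=> a y z; rewrite brDl brZl.
rewrite (linear_lincomb _ _ _ lbr) linear_sum mulmx_sumr.
have le := @emb_linear K L tau.
have -> : \sum_i r *m (u 0 i *: gam i)^T = \sum_i u 0 i *: (r *m (gam i)^T).
  by apply: eq_bigr => i _; rewrite linearZ /= -scalemxAr.
by rewrite (linear_lincomb _ _ _ le); apply: eq_bigr => i _; rewrite (gamP i r).
Qed.

(** [clifford_group] gives the matrix of [al] as [c] times a word. Composing with an automorphism
    that realises the inverse word leaves [de], which is [c] on the odd part; compatibility with
    brackets forces c^2 = 1. *)
Lemma aut_word (al : 'End(L)) : G al ->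
  exists r, all rotation r /\ represents al (rep (spin_word r)).
Proof.
move=> hG; have hM := aut_represents hG; set M := matrix_of al in hM.
have lal : linear al := End_linear al.
have [[[al' aK Ka] hbr] hsg hSo] := hG.
have lal' : linear al' by move=> c x y; apply: (can_inj aK); rewrite Ka lal !Ka.
have al'_odd x : tau x = - x -> tau (al' x) = - al' x.
  move=> hx; apply: (can_inj aK); rewrite /square -!hsg Ka -/(tau x) hx.
  by rewrite linearN /= Ka.
have hM' := matrix_ofP tauL lal' al'_odd; set M' := matrix_of al' in hM'.
have MM' : M * M' = 1.
  apply: (represents_inj tauL (represents_comp hM hM')).
  by apply: (represents_scalar tauL (c := 1)) => x _; rewrite Ka scale1r.
have [U hU] : exists U : 'I_p.+1 -> 'rV[K]_p.+1, forall i, al (v i) = \sum_j U i 0 j *: v j.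
  exists (fun i => xget 0 [set u : 'rV[K]_p.+1 | al (v i) = \sum_j u 0 j *: v j]) => i.
  have [u hu] := aut_v hG i.
  exact: (@xgetPex _ 0 [set u : 'rV[K]_p.+1 | al (v i) = \sum_j u 0 j *: v j] (ex_intro _ u hu)).
have [r [c [hr c0 eM]]] : exists r c,
    [/\ all rotation r, c != 0 & M = c *: rep (spin_word r)].
  apply: (clifford_group gam_cliff odd_p odd_dim_gt0 centralizing_gam s0_gam s0_mx_neq0
    gam_irr MM').
  - move=> i; apply: (represents_inj tauL (represents_comp hM (gamP i))).
    apply: (represents_eq tauL (represents_comp (gvec_represents (U i)) hM)) => x hx.
    by rewrite hbr hU.
  - move=> S [s [hs hS]]; apply: (represents_inj tauL (represents_comp hM hS)).
    apply: (represents_eq tauL (represents_comp hS hM)) => x hx.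
    by rewrite (hSo _ (C_So hs)).
  - apply: (represents_inj tauL (represents_comp hM s0_represents)).
    apply: (represents_eq tauL (represents_comp s0_represents hM)) => x hx.
    by rewrite (hSo _ So_s0).
have [be [hbe rbe]] := word_graded (rot_inv_all hr).
have [[_ dbr] _ _] := graded_aut_comp hbe hG; set de := (be \o al)%VF in dbr.
have hde x : tau x = - x -> de x = c *: x.
  move=> hx; rewrite /de lfunE /=.
  rewrite (represents_odd tauL (represents_comp rbe hM) hx) eM mulZr.
  rewrite (word_inv gam_cliff hr) scalemx1 tr_scalar_mx mul_mx_scalar.
  by rewrite (linear_Z _ _ (@emb_linear K L tau)) (prjK tauL hx).
(* Even elements are sums of brackets of two odd ones, so the scalar is squared. *)
have hde2 z : tau z = z -> de z = c ^+ 2 *: z.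
  move=> hz; rewrite (casimir hz) linear_sum scaler_sumr; apply: eq_bigr => t _ /=.
  have hb : tau (br (cb t) z) = - br (cb t) z.
    by rewrite tau_br hz cb_odd brNl.
  by rewrite dbr hde // hde // brZl brZr scalerA expr2.
have vw : tau (br (v ord0) w0) = - br (v ord0) w0 by apply: br_odd.
have vw0 : br (v ord0) w0 != 0.
  apply: contraNneq w0_neq0 => e; have := v_cliff ord0 ord0 w0_odd.
  rewrite e br0r addr0 eqxx mulr1 => /esym/eqP.
  by rewrite scaler_eq0 pnatr_eq0.
(* On the odd element [v, w0] the map is c, while the bracket of the images gives c^2 * c. *)
have c2 : c ^+ 2 = 1.
  have := dbr (v ord0) w0; rewrite (hde _ vw) (hde2 _ (v_tau _)) (hde _ w0_odd) brZl brZr scalerA.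
  move=> /eqP; rewrite -subr_eq0 -scalerBl scaler_eq0 (negPf vw0) orbF.
  have -> : c - c ^+ 2 * c = (1 - c ^+ 2) * c by ring.
  by rewrite mulf_eq0 (negPf c0) orbF subr_eq0 => /eqP.
have [r' [hr' er']] := word_scale c2 hr.
exists r'; split => //.
by rewrite -er' (linear_Z _ _ (cl_rep_linear _)) -eM.
Qed.

(** The second use of [clifford_group]: [rep x] normalises the span of the generators by the
    definition of [Spin], and commutes with [s0] because x is even. The condition x rev(x) = 1
    reduces the scalar to a sign. *)
Lemma spin_is_word (x : clifford K p.+1) : Spin x ->
  exists r, all rotation r /\ x = spin_word r.
Proof.
move=> hx; have [ev ux vx] := hx.
have MM' : rep x * rep (cliff_rev x) = 1 by rewrite -(cl_rep_mul gam_cliff) ux cl_rep_one.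
have M'M : rep (cliff_rev x) * rep x = 1 by apply: mulmx1C.
have [U hU] : exists U : 'I_p.+1 -> 'rV[K]_p.+1, forall i,
    cliff_mul (cliff_mul x (cliff_vec (e_ K i))) (cliff_rev x) = cliff_vec (U i).
  pose A i (u : 'rV[K]_p.+1) : Prop :=
    cliff_mul (cliff_mul x (cliff_vec (e_ K i))) (cliff_rev x) = cliff_vec u.
  exists (fun i => xget 0 (A i)) => i; exact: (@xgetPex _ 0 (A i) (vx _)).
have [r [c [hr c0 eM]]] : exists r c,
    [/\ all rotation r, c != 0 & rep x = c *: rep (spin_word r)].
  apply: (clifford_group gam_cliff odd_p odd_dim_gt0 centralizing_gam s0_gam s0_mx_neq0
    gam_irr MM' (U := U)).
  - move=> i; have hv (z : 'rV[K]_p.+1) : rep (cliff_vec z) = gvec gam z by exact: cl_rep_vec.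
    have := congr1 rep (hU i); rewrite !(cl_rep_mul gam_cliff) !hv gvec_e => <-.
    by rewrite -mulrA M'M mulr1.
  - by move=> S hS; rewrite (cl_rep_comm centralizing_gam).
  - by rewrite (s0_even s0_gam ev).
have ex : x = c *: (spin_word r : clifford K p.+1).
  apply: (rep_inj gam_cliff even_n odd_dim_gt0).
  by rewrite eM (linear_Z _ _ (cl_rep_linear _)).
have revZ y : cliff_rev (c *: y : clifford K p.+1) = c *: cliff_rev y :> clifford K p.+1.
  by apply/ffunP => A; rewrite !ffunE /GRing.scale /= mulrCA.
have [_ uw _] := Spin_word gam_cliff even_n odd_dim_gt0 hr.
have c2 : c ^+ 2 = 1.
  apply: (scalar_mx_inj0 odd_dim_gt0).
  have := congr1 rep ux; rewrite ex revZ (cl_rep_mul gam_cliff) cl_rep_one.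
  rewrite !(linear_Z _ _ (cl_rep_linear _)) mulZl mulZr -(cl_rep_mul gam_cliff) uw cl_rep_one.
  by rewrite scalerA -expr2 scalemx1.
by have [r' [hr' er']] := word_scale c2 hr; exists r'; rewrite ex.
Qed.

(** Extension of [N] from the odd part to all of L: the even part of [z] is expanded by the Casimir
    identity and [N] is applied to both odd factors. It makes sense for every matrix, and for that
    of an automorphism it returns the automorphism. *)
Definition aut_fun (N : 'M[K]_d) (z : L) : L :=
  emb (prj z *m N^T) +
  \sum_t br (emb (prj (ca t) *m N^T)) (emb (prj (br (cb t) (z - odd_part tau z)) *m N^T)).

Definition aut_of (x : clifford K p.+1) : 'End(L) := linfun (aut_fun (rep x)).
Definition cl_of (al : 'End(L)) : clifford K p.+1 := cl_coord gam (matrix_of al).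

Lemma aut_fun_linear N : linear (aut_fun N).
Proof.
move=> c y z; rewrite /aut_fun (prj_linear tauL) mulmxDl -scalemxAl emb_linear scalerDr.
rewrite addrACA; congr (_ + _); rewrite scaler_sumr -big_split; apply: eq_bigr => t _ /=.
rewrite (odd_part_linear tauL).
have -> : c *: y + z - (c *: odd_part tau y + odd_part tau z) =
    c *: (y - odd_part tau y) + (z - odd_part tau z).
  by move: (odd_part _ y) (odd_part _ z) => y' z'; vec_ring.
by rewrite brL (prj_linear tauL) mulmxDl -scalemxAl emb_linear brL.
Qed.

(** An automorphism is determined by its action on the odd part, since the even part consists of
    sums of brackets of odd elements. *)
Lemma aut_ofE (al : 'End(L)) x : G al -> represents al (rep x) -> aut_of x = al.
Proof.
move=> hG hx; have [[_ hbr] _ _] := hG; apply/lfunP => z.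
rewrite /aut_of (linfunE (aut_fun_linear _)) /aut_fun.
have hodd := tau_odd tauL tauK z; have heven := tau_even tauL tauK z.
have -> : prj z = prj (odd_part tau z).
  by apply/rowP => i; rewrite !mxE (odd_part_odd hodd).
rewrite -(represents_odd tauL hx hodd).
rewrite -[in RHS](subrK (odd_part tau z) z) linearD /= addrC; congr (_ + _).
have -> : al (z - odd_part tau z) = \sum_t al (br (ca t) (br (cb t) (z - odd_part tau z))).
  by rewrite {1}(casimir heven) linear_sum.
apply: eq_bigr => t _.
rewrite -(represents_odd tauL hx (ca_odd t)).
have hb : tau (br (cb t) (z - odd_part tau z)) = - br (cb t) (z - odd_part tau z).
  by rewrite tau_br heven cb_odd brNl.
by rewrite -(represents_odd tauL hx hb) -hbr.
Qed.

Lemma cl_ofE (al : 'End(L)) x : represents al (rep x) -> G al -> cl_of al = x.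
Proof.
move=> hx hG; rewrite /cl_of (represents_inj tauL (aut_represents hG) hx).
exact: (cl_repK gam_cliff even_n odd_dim_gt0).
Qed.

Lemma cl_of_spin (al : 'End(L)) : G al -> Spin (cl_of al) /\ aut_of (cl_of al) = al.
Proof.
move=> hG; have [r [hr hal]] := aut_word hG; rewrite (cl_ofE hal hG); split.
  exact: (Spin_word gam_cliff even_n odd_dim_gt0 hr).
exact: aut_ofE.
Qed.

Lemma aut_of_graded (x : clifford K p.+1) : Spin x -> G (aut_of x) /\ cl_of (aut_of x) = x.
Proof.
move=> /spin_is_word[r [hr ->]]; have [al [hG hal]] := word_graded hr.
by rewrite (aut_ofE hG hal); split => //; apply: cl_ofE.
Qed.

Lemma cl_of_comp (al be : 'End(L)) : G al -> G be ->
  cl_of (al \o be)%VF = cliff_mul (cl_of al) (cl_of be).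
Proof.
move=> ha hb; have [r [hr hal]] := aut_word ha; have [s [hs hbe]] := aut_word hb.
rewrite (cl_ofE hal ha) (cl_ofE hbe hb); apply: cl_ofE; last exact: graded_aut_comp.
rewrite (cl_rep_mul gam_cliff).
by apply: (represents_eq tauL (represents_comp hal hbe)) => x _; rewrite lfunE.
Qed.

Lemma aut_of_continuous (S : set (clifford K p.+1)) : continuous_on S aut_of.
Proof.
have le := @emb_linear K L tau.
have rT c x y : (rep (c *: x + y))^T = c *: (rep x)^T + (rep y)^T.
  by rewrite cl_rep_linear linearP.
have eR c r x y : emb (r *m (c *: x + y)) = c *: emb (r *m x) + emb (r *m y).
  by rewrite mulmxDr -scalemxAr le.
pose af x (z : L) := emb (prj z *m (rep x)^T).
have laf x : linear (af x) by move=> a y z; rewrite /af (prj_linear tauL) mulmxDl -scalemxAl le.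
pose z' (z : L) := z - odd_part tau z.
have lz' : linear z'.
  move=> c y z; rewrite /z' (odd_part_linear tauL).
  by move: (odd_part _ y) (odd_part _ z) => y1 z1; vec_ring.
(* The polarised form of the even contribution, which exhibits [aut_of] as a linear plus a quadratic
   map. *)
pose bf x y (z : L) := \sum_t br (af x (ca t)) (af y (br (cb t) (z' z))).
have lbf x y : linear (bf x y).
  move=> a z w; rewrite /bf scaler_sumr -big_split; apply: eq_bigr => t _ /=.
  by rewrite lz' brL laf brL.
pose A x : 'End(L) := linfun (af x); pose B x y : 'End(L) := linfun (bf x y).
have -> : aut_of = fun x => A x + B x x.
  apply: funext => x; apply/lfunP => z; rewrite add_lfunE /A /B (linfunE (laf x)).
  by rewrite (linfunE (lbf x x)) /aut_of (linfunE (aut_fun_linear _)).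
apply: continuous_quadratic.
- move=> a x y; apply/lfunP => z; rewrite lfun_linE /A !(linfunE (laf _)).
  by rewrite /af rT eR.
- move=> x a y w; apply/lfunP => z; rewrite lfun_linE /B !(linfunE (lbf _ _)).
  rewrite /bf scaler_sumr -big_split; apply: eq_bigr => t _ /=.
  by rewrite {2}/af rT eR brL.
- move=> y a x w; apply/lfunP => z; rewrite lfun_linE /B !(linfunE (lbf _ _)).
  rewrite /bf scaler_sumr -big_split; apply: eq_bigr => t _ /=.
  by rewrite {1}/af rT eR brDl brZl.
Qed.

Lemma cl_of_continuous (S : set 'End(L)) : continuous_on S cl_of.
Proof.
apply: continuous_linear => a al be.
rewrite /cl_of (matrix_of_linear tauL); exact: cl_coord_linear.
Qed.

Theorem spin_isog : topgroup_isog (fun al be : 'End(L) => (al \o be)%VF)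
  (@cliff_mul K p.+1) [set al | G al] (@Spin K p.+1).
Proof.
exists cl_of, aut_of; split.
- exact: cl_of_spin.
- exact: aut_of_graded.
- exact: cl_of_comp.
- exact: cl_of_continuous.
- exact: aut_of_continuous.
Qed.

End SpinAutomorphisms.

(** * The automorphism sigma'_4 in coordinates *)

Definition sJn (n : nat) : sv :=
  if (n < 3)%N then [:: (Pos.of_nat n.+1, Zpos 1)] else
  let k := ((n - 3) %/ 8)%N in let j := ((n - 3) %% 8)%N in
  match k with
  | 0 => [:: (keyF 0 (oxor (oxor 1 j) 1), Z.opp (Z.mul (osgn 1 j) (osgn (oxor 1 j) 1)))]
  | 1 => [:: (keyF 1 (oxor 1 j), osgn 1 j)]
  | _ => [:: (keyF 2 (oxor j 1), Z.opp (osgn j 1))]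
  end.

Definition sJ (p : positive) : sv := if Pos.leb p 27 then sJn (Pos.to_nat p).-1 else [::].
Definition sF (p : positive) : sv :=
  if Pos.leb p 27 then cut 27 (sJ p)
  else if Pos.leb p 54 then shift 27 27 (sJ (Pos.sub p 27))
  else if Pos.leb p 56 then [:: (p, Zpos 1)] else [::].

(** Conjugation of e7 by sigma. On f4 it is D |-> sigma D sigma^3, sigma having order 4; on the
    other summands sigma is applied to T, A or B. The outcome is validated by [sP_check]. *)
Definition sP0 (k : positive) : sv :=
  if Pos.leb k 52 then
    dvec (fun j => bind sJ (bind (dC k) (bind sJ (bind sJ (bind sJ [:: (j, Zpos 1)])))))
  else if Pos.leb k 54 then [:: (k, Zpos 1)]
  else if Pos.leb k 78 then shift 51 27 (sJ (Pos.sub k 51))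
  else if Pos.leb k 105 then shift 78 27 (sJ (Pos.sub k 78))
  else if Pos.leb k 132 then shift 105 27 (sJ (Pos.sub k 105))
  else [:: (k, Zpos 1)].

Definition TS := Eval vm_compute in tab sP0 133.
Lemma TSE : TS = tab sP0 133.
Proof. by vm_compute. Qed.

Definition sP : positive -> sv := look TS.

Lemma sP_check : all (fun k => all (fun j =>
  eqsv (bind sF (pC k j)) (bind2 pC (sP k) (sF j))) (upto 56)) (upto 133).
Proof. by vm_compute. Qed.

Lemma sF_order4 : all (fun j => eqsv (bind sF (bind sF (bind sF (sF j)))) [:: (j, Zpos 1)]) (upto 56).
Proof. by vm_compute. Qed.

Definition sE (x : e8C) : e8C :=
  let: (f, P, Q, r, s, t) := x in (bind sP f, bind sF P, bind sF Q, r, s, t).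
Definition sL (p : positive) : sv := flatL (sE (unitL p)).

Lemma conj_linear (K : numFieldType) (V : vectType K) (S T : 'End(V)) :
  linear (fun F : 'End(V) => (S \o F \o T)%VF).
Proof.
move=> a F G; apply/lfunP => x.
by rewrite lfun_linE !comp_lfunE lfun_linE linearP.
Qed.

Section Sigma.
Variable K : numFieldType.
Local Notation jordan := (jordan K).
Local Notation freudenthal := (freudenthal K).
Local Notation e8 := (e8 K).
Local Notation bJ := (bJ K).
Local Notation bF := (bF K).
Local Notation PK := (PK K).
Local Notation bL := (bL K).
Local Notation oe := (oe K).
Local Notation sigma_fun := (@sigma4_fun K).

Lemma sigma_jE k : sigma_fun (jE K k) = jE K k.
Proof.
rewrite /sigma4_fun /jE; congr pair; apply/matrixP => i j; rewrite !mxE /=.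
have r0 (l : 'I_3) : row l (0 : 'M[K]_(3, 8)) = 0 by apply/rowP => m; rewrite !mxE.
rewrite !r0 !(omul0r, omul0l) oppr0.
by case: i => [[|[|[|i]]]] //= hi; rewrite mxE.
Qed.

Lemma sigma_jF (k : 'I_3) x : sigma_fun (jF k x) =
  jF k ([:: - omul (omul (oe 1) x) (oe 1); omul (oe 1) x; - omul x (oe 1)]`_k).
Proof.
have rE (l : 'I_3) : row l (jF k x).2 = if l == k then x else 0.
  by apply/rowP => m; rewrite !mxE; case: ifP => //; rewrite mxE.
rewrite /sigma4_fun !rE; congr pair; apply/matrixP => i j; rewrite !mxE /=.
move: k {rE}; apply: I3_ind; case: i => [[|[|[|i]]]] //= hi;
  by rewrite !(omul0r, omul0l) ?oppr0 ?mxE.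
Qed.

Lemma jF_Z k c (x : 'rV[K]_8) : jF k (c *: x) = c *: jF k x.
Proof.
congr pair; apply/matrixP => i j; rewrite !mxE ?mulr0 //.
by case: ifP => _; rewrite ?mxE ?mulr0.
Qed.

Lemma zK_opp z : zK K (Z.opp z) = - zK K z.
Proof.
have -> : Z.opp z = Z.mul (Zneg 1) z by lia.
by rewrite zKM zKN1 mulN1r.
Qed.

Lemma oxor_lt (i j : nat) : (i < 8)%N -> (j < 8)%N -> (oxor i j < 8)%N.
Proof. by move: i j; do 8![case=> //]; do 8![case=> //]. Qed.

Lemma sigma_bJ p : sigma_fun (bJ p) = ev bJ (sJ p).
Proof.
rewrite /sJ; case: Pos.leb_spec0 => hp; last first.
  by rewrite bJ_out; [exact: (linear_0 (@sigma4_fun_linear K))|lia].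
have -> : bJ p = bJn K (Pos.to_nat p).-1 by [].
have hn : ((Pos.to_nat p).-1 < 27)%N by lia.
move: (Pos.to_nat p).-1 hn => n hn {p hp}; rewrite /sJn.
have [n3|n3] := ltnP n 3; first by rewrite bJn_E // sigma_jE ev1 bJ_succ bJn_E.
rewrite bJn_F //; have hj : ((n - 3) %% 8 < 8)%N by rewrite ltn_mod.
have hk : ((n - 3) %/ 8 < 3)%N by rewrite ltn_divLR //; lia.
move: ((n - 3) %% 8)%N ((n - 3) %/ 8)%N hj hk => j k hj hk.
have o1 : (oxor 1 j < 8)%N by apply: oxor_lt.
have o2 : (oxor j 1 < 8)%N by apply: oxor_lt.
have o3 : (oxor (oxor 1 j) 1 < 8)%N by apply: oxor_lt.
rewrite sigma_jF /= inordK //.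
case: k hk => [|[|[|//]]] _ /=; rewrite addr0 bJ_keyF //.
- rewrite zK_opp omul_oe // (linear_Z _ _ (omul_linear_l _)) omul_oe // scalerA.
  by rewrite -scaleNr jF_Z zKM mod0n.
- by rewrite omul_oe // jF_Z.
- by rewrite omul_oe // -scaleNr jF_Z zK_opp.
Qed.

Definition S7 : 'End(freudenthal) := F4_to_E7 (sigma4_F4 K).

Lemma S7E X Y (x y : K^o) : S7 (X, Y, x, y) = (sigma_fun X, sigma_fun Y, x, y).
Proof. by rewrite /S7 F4_to_E7E /F4_to_E7_fun !sigma4_F4E. Qed.

Lemma sigma0 : sigma_fun 0 = 0.
Proof. exact: (linear_0 (@sigma4_fun_linear K)). Qed.

Lemma S7_bF j : S7 (bF j) = ev bF (sF j).
Proof.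
rewrite /sF; case h1 : (Pos.leb j 27).
  rewrite (bF_X _ h1) S7E sigma0 sigma_bJ.
  by rewrite (@ev_cut _ _ _ _ _ _ 27 (sJ j) (@inX_linear K) (@bF_X K) (@bJ_out' K)).
case h2 : (Pos.leb j 54).
  have hj : Pos.leb (Pos.sub j 27) 27.
    by apply/Pos.leb_spec0; move/Pos.leb_spec0: h2; move/negbT/Pos.leb_spec0: h1; lia.
  have ej : j = Pos.add (Pos.sub j 27) 27 by move/negbT/Pos.leb_spec0: h1; lia.
  rewrite {1}ej (bF_Y _ hj) S7E sigma0 sigma_bJ.
  by rewrite (@ev_shift _ _ _ _ _ _ 27 27 _ (@inY_linear K) (@bF_Y K) (@bJ_out' K)).
case h3 : (Pos.leb j 56); last first.
  by rewrite bF_out ?linear0 //; move/negbT/Pos.leb_spec0: h3; lia.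
rewrite ev1 /bF h1 h2; case: ifP => _; first by rewrite S7E sigma0.
by case: ifP => _; [rewrite S7E sigma0|exact: linear0].
Qed.

Lemma S7_ev l : S7 (ev bF l) = ev bF (bind sF l).
Proof. by apply: ev_bind => [|p]; [exact: End_linear|exact: S7_bF]. Qed.

Lemma S7_order4 x : S7 (S7 (S7 (S7 x))) = x.
Proof.
move: x; apply: (spans_ext (@spans_bF K)) => [a u v|a u v|p]; rewrite ?linearP //.
have [hp|hp] := leqP (Pos.to_nat p) 56; last by rewrite bF_out // !linear0.
by rewrite S7_bF !S7_ev (ev_eq _ (all_upto sF_order4 hp)) ev1.
Qed.

(** [S7^-1] is the generic inverse of a linear map; it is a genuine one because order 4 makes [S7]
    injective. *)
Lemma S7_inv : (S7 \o S7^-1)%VF = \1%VF.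
Proof.
apply: lker0_compfV; apply/lker0P => x y e.
by rewrite -(S7_order4 x) e S7_order4.
Qed.

Lemma S7_conj f : (S7 \o ev PK f \o S7^-1)%VF = ev PK (bind sP f).
Proof.
apply: (ev_bind (F := fun F : 'End(freudenthal) => (S7 \o F \o S7^-1)%VF)) => [|k].
  exact: conj_linear.
have [hk|hk] := boolP (Pos.leb k 133); last first.
  rewrite PK_out // comp_lfun0r comp_lfun0l /sP TSE look_tab ifF //.
  by move/Pos.leb_spec0: hk; lia.
have -> : (S7 \o PK k)%VF = (ev PK (sP k) \o S7)%VF.
  apply: (@End_eq K _ _ bF) => [|j]; first exact: spans_bF.
  have [hj|hj] := leqP (Pos.to_nat j) 56; last by rewrite bF_out // !linear0.
  rewrite !comp_lfunE S7_bF PK_bF S7_ev evPK_ev.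
  apply: ev_eq; apply: (all_upto2 sP_check) => //; move/Pos.leb_spec0: hk; lia.
by rewrite -comp_lfunA S7_inv comp_lfun1r.
Qed.

Lemma sigma4E (F : subvs_of (e7 K)) P Q (r s t : K^o) :
  sigma4 ((F, P, Q, r, s, t) : e8) =
  (vsproj (e7 K) (S7 \o vsval F \o S7^-1)%VF, S7 P, S7 Q, r, s, t).
Proof. by []. Qed.

Lemma sigma4_linear : linear (@sigma4 K).
Proof.
have l : linear (fun F : subvs_of (e7 K) => vsproj (e7 K) (S7 \o vsval F \o S7^-1)%VF).
  move=> a F G; rewrite vsval_linear conj_linear; exact: vsproj_is_linear.
move=> a [[[[[F P] Q] r] s] t] [[[[[F' P'] Q'] r'] s'] t'].
rewrite e8Z e8D !sigma4E e8Z e8D.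
by apply: (@L_eq K (subvs_of (e7 K)) freudenthal) => //; [exact: l|exact: End_linear|exact: End_linear].
Qed.

Lemma sigma4_el8 x : sigma4 (el8 K x) = el8 K (sE x).
Proof.
case: x => [[[[[f P] Q] r] s] t]; rewrite /el8 /elC sigma4E val_prj8 S7_conj !S7_ev.
by [].
Qed.

Lemma sigma4_bL p : sigma4 (bL p) = ev bL (sL p).
Proof. by rewrite /sL ev_flatL -sigma4_el8. Qed.

End Sigma.

(** * The Clifford structure in e8 *)

Definition adC (u : positive) (x : sv) : sv := bind (brL u) x.
(* The indices of W, the (-1)-eigenspace of tau. *)
Definition isW (p : positive) : bool :=
  [|| Pos.leb p 16, Pos.leb 63 p && Pos.leb p 78, Pos.leb 90 p && Pos.leb p 105,
      Pos.leb 117 p && Pos.leb p 132, Pos.leb 145 p && Pos.leb p 160,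
      Pos.leb 172 p && Pos.leb p 187, Pos.leb 201 p && Pos.leb p 216
    | Pos.leb 228 p && Pos.leb p 243].
Definition Wlist : seq positive := [seq p <- upto 248 | isW p].
(* The v_i are the combinations vsv of the basis elements cliffU, times 1/2, or i/2 where  *)
(* the square, of sign veps, is negative; w0C spans the line onto which vacC maps W.  *)
Definition cliffU : seq positive := [:: 19; 26; 32; 57; 84; 111; 139; 166; 195; 222]%positive.
Definition w0C : sv := [:: (181, Zpos 1); (183, Zpos 1); (185, Zneg 1); (187, Zpos 1)]%positive.
Definition words (ops : seq positive) : seq sv :=
  foldr (fun o R => R ++ [seq adC o x | x <- R]) [:: w0C] ops.
Definition vsv : seq sv := [:: [:: (19, Zpos 2)]; [:: (26, Zpos 1)]; [:: (32, Zpos 1)]; [:: (57, Zpos 2)];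
  [:: (84, Zpos 1); (111, Zpos 1)]; [:: (84, Zpos 1); (111, Zneg 1)];
  [:: (139, Zpos 4); (222, Zpos 4)]; [:: (139, Zpos 4); (222, Zneg 4)];
  [:: (166, Zpos 4); (195, Zpos 4)]; [:: (166, Zpos 4); (195, Zneg 4)]]%positive.
Definition veps : seq Z := [:: Zneg 1; Zneg 1; Zneg 1; Zpos 1; Zpos 1; Zneg 1; Zneg 1; Zpos 1; Zpos 1; Zneg 1].
(** The rotations of F_1(e_3), ..., F_1(e_7), that is the stabiliser of F_1(e_2) in so(6). All ten
    elements of [cliffU] are built from F_1(e_2), and index 38, the rotation of e_2 and e_3, is the
    s0 used later. *)
Definition so5C : seq positive := [:: 43; 44; 45; 46; 47; 48; 49; 50; 51; 52]%positive.
Definition so6C : seq positive := [:: 38; 39; 40; 41; 42]%positive ++ so5C.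
Definition memP (l : seq positive) (p : positive) : bool := has (Pos.eqb p) l.

(* Up to a factor, the product of commuting projectors built from creation and            *)
(* annihilation operators: a rank one operator in the algebra acting on W.                 *)
Definition factors : seq (Z * seq positive) :=
  [:: (Z0, [:: 84; 111]); (Z0, [:: 139; 222]); (Z0, [:: 166; 195]);
   (Zpos 2304, [:: 57; 19]); (Zpos 884736, [:: 26; 32; 43]);
   (Zpos 884736, [:: 26; 32; 50]); (Zpos 9216, [:: 26; 44])]%positive.
Definition factorC (f : Z * seq positive) (x : sv) : sv := axpy f.1 x (foldr adC x f.2).
Definition vacC (x : sv) : sv := foldr factorC x factors.

(* The dual basis of W for the invariant form, up to the factor 256. *)
Definition dualW (p : positive) : positive * Z :=
  if Pos.leb p 16 then (p, Zneg 2)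
  else if Pos.leb p 78 then (p, Zpos 2)
  else if Pos.leb p 105 then (Pos.add p 27, Zpos 1)
  else if Pos.leb p 132 then (Pos.sub p 27, Zpos 1)
  else if Pos.leb p 160 then (Pos.add p 83, Zneg 16)
  else if Pos.leb p 187 then (Pos.add p 29, Zpos 16)
  else if Pos.leb p 216 then (Pos.sub p 29, Zpos 16)
  else (Pos.sub p 83, Zneg 16).
Definition casC (z : sv) : sv :=
  foldr (fun p s => axpy (dualW p).2 (adC p (adC (dualW p).1 z)) s) [::] Wlist.

(* A multiple of the projection onto the span of the v_i: the part where tau = 1,           *)
(* sigma = -1 and the Casimir operator of so(5) vanishes.                                 *)
Definition projC (x : sv) : sv :=
  let s2 := axpy (Zpos 1) x (bind sL (bind sL x)) in
  let y := axpy (Zpos 1) s2 (axpy (Zneg 1) (bind sL s2) [::]) in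
  axpy (Zpos 147456) y
    (foldr (fun s r => axpy (Zpos 1) (adC s (adC s y)) r) [::] so5C).

Lemma tau_check : all (fun p =>
  eqsv (bind sL (sL p)) [:: (p, if isW p then Zneg 1 else Zpos 1)]) (upto 248).
Proof. by vm_compute. Qed.

Lemma grading_check : all (fun p => all (fun q =>
  all (fun kc => isW kc.1 == (isW p (+) isW q)) (brL p q)) (upto 248)) (upto 248).
Proof. by vm_compute. Qed.

Lemma cliffU_sigma : all (fun u => all (fun p =>
  eqsv (bind sL (brL u p)) (axpy (Zneg 1) (bind (brL u) (sL p)) [::])) (upto 248)) cliffU.
Proof. by vm_compute. Qed.

Lemma cliffU_tau : all (fun u => ~~ isW u && Pos.leb u 248) cliffU.
Proof. by []. Qed.

Definition upto248 : seq positive := Eval vm_compute in upto 248.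

Lemma upto248E : upto 248 = upto248.
Proof. by vm_compute. Qed.

(** The Jacobi identity with one entry in [cliffU]. Pairs with q < p follow by antisymmetry, and
    triples whose brackets all vanish are dismissed at once. *)
Lemma cliffU_der : all (fun u => all (fun p => all (fun q =>
  [|| Pos.ltb q p, [&& nilp (brL u p), nilp (brL p q) & nilp (brL u q)]
    | eqsv (adC u (brL p q)) (axpy (Zpos 1) (bind (fun r => brL r q) (brL u p))
        (bind (brL p) (brL u q)))]) upto248) upto248) cliffU.
Proof. by vm_compute. Qed.

(** The constant is 18432 = 8 * 48^2: the table scales each bracket by 48, and (ad vsv_i)^2 = 4
    veps_i on W. *)
Lemma cliff_check : all (fun i => all (fun j => all (fun p =>
  let x := [:: (p, Zpos 1)] in
  let vi := nth [::] vsv i in let vj := nth [::] vsv j in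
  eqsv (axpy (Zpos 1) (bind2 brL vi (bind2 brL vj x)) (bind2 brL vj (bind2 brL vi x)))
   (if i == j then [:: (p, Z.mul (Zpos 18432) (nth Z0 veps i))] else [::]))
  Wlist) (iota 0 10)) (iota 0 10).
Proof. by vm_compute. Qed.

Lemma cliff_so6 : all (fun u => all (fun u' => all (fun k =>
  eqsv (adC u (brL u' k)) (adC u' (brL u k))) so6C) cliffU) cliffU.
Proof. by vm_compute. Qed.

Lemma cliff_so5 : all (fun u => all (fun s => all (fun p =>
  eqsv (adC s (brL u p)) (adC u (brL s p))) Wlist) so5C) cliffU.
Proof. by vm_compute. Qed.

Lemma cliff_s0 : all (fun u => all (fun p =>
  eqsv (adC 38 (brL u p)) (axpy (Zneg 1) (adC u (brL 38 p)) [::])) Wlist) cliffU.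
Proof. by vm_compute. Qed.

Lemma s0_sqr : eqsv (adC 38 (brL 38 145)) [:: (145, Zneg 9216)]%positive.
Proof. by vm_compute. Qed.

Lemma casimir_check : all (fun p => isW p ||
  eqsv (casC [:: (p, Zpos 1)]) [:: (p, Zpos 589824)]) (upto 248).
Proof. by vm_compute. Qed.

Lemma dualW_odd : all (fun p => isW (dualW p).1) Wlist.
Proof. by vm_compute. Qed.

(** Where tau = 1 and sigma = -1, the algebra so(5) acts by one trivial and one five-dimensional
    representation, each with multiplicity 10. On the latter the sum of squares is - 64, and 147456
    = 64 * 48^2 cancels it. *)
Lemma projC_check : all (fun p =>
  all (fun kc => memP cliffU kc.1) (projC [:: (p, Zpos 1)])) (upto 248).
Proof. by vm_compute. Qed.

Lemma projC_cliffU : all (fun u => eqsv (projC [:: (u, Zpos 1)]) [:: (u, Zpos 589824)]) cliffU.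
Proof. by vm_compute. Qed.

(** [w0C] has coefficient 1 at index 181, so the coefficient there is the multiple of [w0C] that the
    rank one operator returns. *)
Lemma vacC_check : all (fun p =>
  eqsv (vacC [:: (p, Zpos 1)]) (axpy (coef 181 (vacC [:: (p, Zpos 1)])) w0C [::])) Wlist.
Proof. by vm_compute. Qed.

Lemma vacC_w0 : let c := coef 181 (vacC w0C) in
  eqsv (vacC w0C) (axpy c w0C [::]) && ~~ Z.eqb c Z0.
Proof. by vm_compute. Qed.

(* The 2^7 words in five creation operators and two elements of so(5), applied to w0C,     *)
(* span W.                                                                                *)
Lemma words_check :
  let M := echelon 400 (words [:: 111; 222; 195; 57; 26; 43; 46]%positive) in
  all (fun p => if reduce 400 M [:: (p, Zpos 1)] is [::] then true else false) Wlist.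
Proof. by vm_compute. Qed.

Lemma vsv_cliffU : all (all (fun kc => memP cliffU kc.1)) vsv.
Proof. by []. Qed.

Lemma cliffU_vsv : let M := echelon 50 vsv in
  all (fun u => if reduce 50 M [:: (u, Zpos 1)] is [::] then true else false) cliffU.
Proof. by vm_compute. Qed.

(** Outside so(6) every pivot lies in the column of E_1, E_2, F_1(e_0) or F_1(e_1), all killed by a
    derivation in so(6). *)
Lemma so6_dpair : all (fun k => memP so6C k || (match (dpair k).1 with
   1%positive | 2%positive | 4%positive | 5%positive => true | _ => false end)) (upto 52).
Proof. by []. Qed.

Lemma so6_kills : all (fun k => all (fun j => if dC k j is [::] then true else false)
  [:: 1; 2; 3; 4; 5]%positive) so6C.
Proof. by vm_compute. Qed.

(** * From the finite checks to the hypotheses of the abstract theorem *)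

Section E8Verification.
Variables (K : numClosedFieldType) (L : vectType K).
Variables (br : L -> L -> L) (sg : L -> L) (bL : positive -> L).
Hypotheses (br_linear : forall x, linear (br x)) (brN : forall x y, br x y = - br y x).
Hypotheses (sg_linear : linear sg) (spans_bL : spans bL).
Hypothesis br_bL : forall p q, 48 *: br (bL p) (bL q) = ev bL (brL p q).
Hypothesis sigma_bL : forall p, sg (bL p) = ev bL (sL p).
Hypothesis bL_out : forall p, ~~ Pos.leb p 248 -> bL p = 0.
Local Notation zK := (zK K).
Local Notation tau := (square sg).

Let br_linear_l y : linear (fun x => br x y).
Proof. by move=> a u w; rewrite !(brN _ y) br_linear opprD -scalerN. Qed.

Definition linear_closed (V : lmodType K) (P : V -> Prop) : Prop :=
  P 0 /\ forall (a : K) u w, P u -> P w -> P (a *: u + w).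

Lemma closed_ev (P : L -> Prop) l : linear_closed P ->
  (forall kc, List.In kc l -> P (bL kc.1)) -> P (ev bL l).
Proof.
move=> [P0 PL]; elim: l => [|[k c] l IH] h //=.
by apply: PL; [exact: (h (k, c) (or_introl erefl))|apply: IH => kc hkc; apply: h; right].
Qed.

Lemma closed_ext (V : lmodType K) (f g : L -> V) : linear f -> linear g ->
  linear_closed (fun x => f x = g x).
Proof.
move=> lf lg; split; first by rewrite (linear_0 lf) (linear_0 lg).
by move=> a u w hu hw; rewrite lf lg hu hw.
Qed.

Lemma bL_ind (P : L -> Prop) : linear_closed P ->
  (forall p, (Pos.to_nat p <= 248)%N -> P (bL p)) -> forall x, P x.
Proof.
move=> [P0 PL] h; apply: spans_bL => // p.
have [hp|hp] := leqP (Pos.to_nat p) 248; first exact: h.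
by rewrite bL_out //; apply/negP => /Pos.leb_spec0; lia.
Qed.

Let brZr a x y : br x (a *: y) = a *: br x y. Proof. exact: (linear_Z _ _ (br_linear x)). Qed.
Let brZl a x y : br (a *: x) y = a *: br x y. Proof. exact: (linear_Z _ _ (br_linear_l y)). Qed.
Let brNr x y : br x (- y) = - br x y. Proof. by rewrite -scaleN1r brZr scaleN1r. Qed.

Lemma nat48 : (48 : K) != 0. Proof. by rewrite pnatr_eq0. Qed.

Lemma br_evC x y : 48 *: br (ev bL x) (ev bL y) = ev bL (bind2 brL x y).
Proof.
apply: (ev_bind2 (F := fun a b => 48 *: br a b)) => [u a v w|u a v w|p q].
- by rewrite br_linear scalerDr !scalerA mulrC.
- by rewrite br_linear_l scalerDr !scalerA mulrC.
- exact: br_bL.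
Qed.

Lemma br_adC u x : 48 *: br (bL u) (ev bL x) = ev bL (adC u x).
Proof.
rewrite /adC; apply: (ev_bind (F := fun y => 48 *: br (bL u) y)) => [a v w|q].
  by rewrite br_linear scalerDr !scalerA mulrC.
exact: br_bL.
Qed.

Lemma br_adC2 u w x : (48 * 48) *: br (bL u) (br (bL w) (ev bL x)) = ev bL (adC u (adC w x)).
Proof. by rewrite -br_adC -br_adC brZr scalerA. Qed.

Lemma br_bL2 u w k : 48 *: (48 *: br (bL u) (br (bL w) (bL k))) = ev bL (adC u (brL w k)).
Proof. by rewrite -brZr br_bL br_adC. Qed.

Lemma sg_ev l : sg (ev bL l) = ev bL (bind sL l).
Proof. by apply: ev_bind => [|p]; [exact: sg_linear|exact: sigma_bL]. Qed.

Lemma tau_linear : linear tau.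
Proof. by move=> a x y; rewrite /square !sg_linear. Qed.

Lemma ev2 p c : ev bL [:: (p, c)] = zK c *: bL p.
Proof. by rewrite /ev /= addr0. Qed.

Lemma tau_bL p : (Pos.to_nat p <= 248)%N -> tau (bL p) = if isW p then - bL p else bL p.
Proof.
move=> hp; rewrite /square sigma_bL sg_ev (ev_eq _ (all_upto tau_check hp)) ev2.
by case: (isW p); rewrite ?zKN1 ?scaleN1r ?zK1 ?scale1r.
Qed.

Lemma tauK x : tau (tau x) = x.
Proof.
move: x; apply: bL_ind => [|p hp].
  by apply: closed_ext => a u w; rewrite ?tau_linear.
rewrite tau_bL //; case E : (isW p); last by rewrite tau_bL // E.
rewrite -scaleN1r (linear_Z _ _ tau_linear) tau_bL // E scaleN1r opprK //.
Qed.

Lemma odd_ind (P : L -> Prop) : linear_closed P ->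
  (forall p, (Pos.to_nat p <= 248)%N -> isW p -> P (bL p)) ->
  forall x, tau x = - x -> P x.
Proof.
move=> [P0 PL] h x hx; rewrite -(odd_part_odd hx).
move: x {hx}; apply: bL_ind => [|p hp].
  split; first by rewrite (linear_0 (odd_part_linear tau_linear)).
  by move=> a u w hu hw; rewrite (odd_part_linear tau_linear); apply: PL.
case E : (isW p); first by rewrite odd_part_odd ?tau_bL ?E //; apply: h.
by rewrite odd_part_even // tau_bL // E.
Qed.

Lemma even_ind (P : L -> Prop) : linear_closed P ->
  (forall p, (Pos.to_nat p <= 248)%N -> ~~ isW p -> P (bL p)) ->
  forall x, tau x = x -> P x.
Proof.
move=> [P0 PL] h x hx; have -> : x = x - odd_part tau x by rewrite odd_part_even // subr0.
move: x {hx}; apply: bL_ind => [|p hp].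
  split; first by rewrite (linear_0 (odd_part_linear tau_linear)) subr0.
  move=> a u w hu hw; rewrite (odd_part_linear tau_linear).
  have -> : a *: u + w - (a *: odd_part tau u + odd_part tau w) =
    a *: (u - odd_part tau u) + (w - odd_part tau w) by rewrite add_scale_sub.
  exact: PL.
case E : (isW p); first by rewrite odd_part_odd ?tau_bL ?E // subrr.
by rewrite odd_part_even ?subr0 ?tau_bL ?E //; apply: h => //; rewrite E.
Qed.

Lemma bL_key p q kc : (Pos.to_nat p <= 248)%N -> (Pos.to_nat q <= 248)%N ->
  List.In kc (brL p q) -> tau (bL kc.1) = if isW p (+) isW q then - bL kc.1 else bL kc.1.
Proof.
move=> hp hq hin; have := all_upto2 grading_check hp hq => hall.
have /eqP <- := all_In hall hin.
have [hk|hk] := leqP (Pos.to_nat kc.1) 248; first exact: tau_bL.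
rewrite bL_out; last by apply/negP => /Pos.leb_spec0; lia.
by rewrite (linear_0 tau_linear) oppr0 if_same.
Qed.

Lemma tau_br x y : tau (br x y) = br (tau x) (tau y).
Proof.
move: x; apply: bL_ind => [|p hp].
  by apply: closed_ext => a u w; rewrite ?br_linear_l ?tau_linear // br_linear_l.
move: y; apply: bL_ind => [|q hq].
  by apply: closed_ext => a u w; rewrite ?tau_linear br_linear ?tau_linear.
apply: (scalerI nat48); rewrite -(linear_Z _ _ tau_linear) br_bL.
transitivity (if isW p (+) isW q then - ev bL (brL p q) else ev bL (brL p q)).
  have := @bL_key p q; move: (brL p q) (_ (+) _) => l b hk.
  have {hk} hk kc : List.In kc l -> tau (bL kc.1) = if b then - bL kc.1 else bL kc.1.
    exact: hk.
  apply: (@closed_ev (fun z => tau z = if b then - z else z)) => //.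
  split; first by rewrite (linear_0 tau_linear) oppr0 if_same.
  by move=> a u w hu hw; rewrite tau_linear hu hw; case: (b); rewrite ?scalerN ?opprD.
rewrite !tau_bL // -br_bL.
have Nl u w : br (- u) w = - br u w by rewrite -scaleN1r brZl scaleN1r.
by case: (isW p); case: (isW q); rewrite /= ?Nl ?brNr ?opprK ?scalerN.
Qed.

Variable So : L -> Prop.
Hypothesis So_ind : forall P : L -> Prop, linear_closed P ->
  (forall k, List.In k so6C -> P (bL k)) -> forall s, So s -> P s.
Hypothesis So_bL : forall k, List.In k so6C -> So (bL k).
Hypothesis bL145 : bL 145 != 0.

(** Its square is veps_i / 4, the inverse of the square 4 veps_i of ad vsv_i on W. *)
Definition cliff_coef (i : nat) : K := (if Z.eqb (nth Z0 veps i) (Zneg 1) then 'i else 1) / 2.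
Definition cliff_v (i : 'I_10) : L := cliff_coef i *: ev bL (nth [::] vsv i).

Lemma memP_In l p : memP l p -> List.In p l.
Proof. by elim: l => [|q l IH] //= /orP[/Pos.eqb_spec->|/IH]; [left|right]. Qed.

Lemma cliffU_le u : List.In u cliffU -> (Pos.to_nat u <= 248)%N /\ ~~ isW u.
Proof. by move=> /(all_In cliffU_tau)/andP[h /Pos.leb_spec0 h']; split=> //; lia. Qed.

Lemma cliff_ind (P : L -> Prop) : linear_closed P ->
  (forall u, List.In u cliffU -> P (bL u)) -> forall i, P (cliff_v i).
Proof.
move=> hP h i; have [P0 PL] := hP.
rewrite /cliff_v -[_ *: _]addr0; apply: PL => //; apply: closed_ev => // kc hkc.
have : all (fun kc => memP cliffU kc.1) (nth [::] vsv i).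
  by have /(all_nthP [::]) := vsv_cliffU; apply; rewrite ltn_ord.
by move=> hall; apply: h; apply: memP_In (all_In hall hkc).
Qed.

Lemma cliff_v_tau i : tau (cliff_v i) = cliff_v i.
Proof.
apply: (cliff_ind (P := fun z => tau z = z)) => [|u /cliffU_le[hu /negPf e]]; last by rewrite tau_bL // e.
by apply: (closed_ext tau_linear) => a u w.
Qed.

Lemma cliff_v_sg i x : sg (br (cliff_v i) x) = - br (cliff_v i) (sg x).
Proof.
apply: (cliff_ind (P := fun z => sg (br z x) = - br z (sg x))) => [|u hu].
  apply: closed_ext => a u w; rewrite ?br_linear_l ?sg_linear //.
  by rewrite opprD scalerN.
move: x; apply: bL_ind => [|p hp].
  apply: closed_ext => a y w; rewrite ?br_linear ?sg_linear //.
  by rewrite br_linear opprD scalerN.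
apply: (scalerI nat48); rewrite -(linear_Z _ _ sg_linear) br_bL sg_ev scalerN sigma_bL br_adC.
rewrite (ev_eq _ (all_upto (all_In cliffU_sigma hu) hp)) ev_axpy ev_nil addr0 zKN1.
by rewrite scaleN1r.
Qed.

Lemma ev_br1 q l : 48 *: br (ev bL l) (bL q) = ev bL (bind (fun r => brL r q) l).
Proof.
by apply: (ev_bind (F := fun y => 48 *: br y (bL q))) => [a v w|r];
  rewrite ?br_bL // br_linear_l scalerDr !scalerA mulrC.
Qed.

Lemma cliff_v_br i x y :
  br (cliff_v i) (br x y) = br (br (cliff_v i) x) y + br x (br (cliff_v i) y).
Proof.
apply: (cliff_ind (P := fun z => br z (br x y) = br (br z x) y + br x (br z y))) => [|u hu].
  apply: closed_ext => a u w; rewrite !br_linear_l //.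
  by rewrite br_linear scalerDr addrACA.
suff h p q : (Pos.to_nat p <= 248)%N -> (Pos.to_nat q <= 248)%N -> ~~ Pos.ltb q p ->
    br (bL u) (br (bL p) (bL q)) = br (br (bL u) (bL p)) (bL q) + br (bL p) (br (bL u) (bL q)).
  move: x; apply: bL_ind => [|p hp].
    apply: closed_ext => a z w; rewrite ?br_linear_l ?br_linear ?br_linear_l //.
    by rewrite scalerDr addrACA.
  move: y; apply: bL_ind => [|q hq].
    apply: closed_ext => a z w; rewrite ?br_linear //.
    by rewrite scalerDr addrACA.
  case E : (Pos.ltb q p); last by apply: h; rewrite // E.
  rewrite (brN (bL p) (bL q)) brNr h //; last first.
    by apply/negP => /Pos.ltb_spec0; move/Pos.ltb_spec0: E; lia.
  by rewrite opprD addrC (brN (br _ (bL p))) (brN (bL p)).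
move=> hp hq hpq; apply: (scalerI nat48); apply: (scalerI nat48).
rewrite -brZr br_bL br_adC !scalerDr -(brZl 48) br_bL ev_br1 -brZr br_bL br_adC.
have hder := all_In cliffU_der hu; rewrite -upto248E in hder.
have := all_upto2 hder hp hq; rewrite (negPf hpq) orFb.
case/orP=> [/and3P[/nilP e1 /nilP e2 /nilP e3]|e].
  by rewrite /adC e1 e2 e3 ev_nil addr0.
by rewrite (ev_eq _ e) ev_axpy zK1 scale1r.
Qed.

Lemma cliff_so i j s : So s -> br (cliff_v i) (br (cliff_v j) s) = br (cliff_v j) (br (cliff_v i) s).
Proof.
move: s; apply: So_ind => [|k hk].
  by apply: closed_ext => a u w; rewrite !br_linear.
apply: (cliff_ind (P := fun z => br z (br (cliff_v j) (bL k)) = br (cliff_v j) (br z (bL k)))) => [|u hu].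
  by apply: closed_ext => a u w; rewrite br_linear_l // br_linear.
apply: (cliff_ind (P := fun z => br (bL u) (br z (bL k)) = br z (br (bL u) (bL k)))) => [|u' hu'].
  by apply: closed_ext => a w w'; rewrite br_linear_l // br_linear.
apply: (scalerI nat48); apply: (scalerI nat48).
rewrite !br_bL2; exact: (ev_eq _ (all_In (all_In (all_In cliff_so6 hu) hu') hk)).
Qed.

Lemma In_filter (T : Type) (P : pred T) (x : T) (s : seq T) :
  List.In x (seq.filter P s) <-> List.In x s /\ P x.
Proof.
elim: s => [|y s IH] /=; first by split=> [|[]].
case E : (P y) => /=; rewrite IH; split.
- by case=> [<-|[h h']]; [split=> //; left|split=> //; right].
- by case=> -[->|h] h'; [left|right].
- by case=> h h'; split=> //; right.
- by case=> -[<-|h] h' //; rewrite h' in E.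
Qed.

Lemma In_Wlist p : (Pos.to_nat p <= 248)%N -> isW p -> List.In p Wlist.
Proof.
move=> hp hW; apply/In_filter; split=> //.
have : Pos.to_nat p \in iota 1 248 by rewrite mem_iota; have := Pos2Nat.is_pos p; lia.
rewrite /upto; elim: (iota 1 248) => //= m s IH.
by rewrite in_cons => /orP[/eqP <-|/IH]; [left; exact: Pos2Nat.id|right].
Qed.

Lemma Wlist_In p : List.In p Wlist -> (Pos.to_nat p <= 248)%N /\ isW p.
Proof.
rewrite /Wlist => h; have [h1 h2] := (In_filter isW p (upto 248)).1 h; split=> //.
exact: In_upto h1.
Qed.

Lemma cliff_v_cliff i j x : tau x = - x ->
  br (cliff_v i) (br (cliff_v j) x) + br (cliff_v j) (br (cliff_v i) x) = (2 * (i == j)%:R) *: x.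
Proof.
move: x; apply: odd_ind => [|p hp hW].
  apply: closed_ext => a u w; rewrite ?br_linear.
    by rewrite scalerDr addrACA.
  by rewrite scalerDr !scalerA mulrC.
have hi (k : 'I_10) : List.In (val k) (iota 0 10).
  have : val k \in iota 0 10 by rewrite mem_iota ltn_ord.
  by elim: (iota 0 10) => //= m s IH; rewrite in_cons => /orP[/eqP->|/IH]; [left|right].
have := all_In (all_In (all_In cliff_check (hi i)) (hi j)) (In_Wlist hp hW).
rewrite /cliff_v /cliff_coef; move: (nth [::] vsv) => f; rewrite -/(bind2 _) => e.
have {}e := ev_eq bL e; rewrite ev_axpy zK1 scale1r -!br_evC ev1 !brZr !scalerA in e.
rewrite !(brZl, brZr) !scalerA.
set A := br (ev bL (f i)) _ in e *; set B := br (ev bL (f j)) _ in e *.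
have {}e : (48 * 48) *: (A + B) =
    (if i == j then zK (Z.mul (Zpos 18432) (nth Z0 veps i)) else 0) *: bL p.
  by rewrite scalerDr e (inj_eq val_inj); case: (i == j); rewrite ?ev2 // scale0r.
set ci := _ / 2; set cj := _ / 2; rewrite [cj * ci]mulrC -scalerDr.
have n2 : (48 * 48 : K) != 0 by rewrite mulf_neq0 // nat48.
have {}e : A + B = ((48 * 48)^-1 *
    (if i == j then zK (Z.mul (Zpos 18432) (nth Z0 veps i)) else 0)) *: bL p.
  by rewrite -scalerA -e scalerA mulVf // scale1r.
rewrite {}e scalerA; congr (_ *: _); case: eqP => [ij|_]; last by rewrite !mulr0.
rewrite mulr1 zKM; have -> : cj = ci by rewrite /cj /ci ij.
have -> : zK (Zpos 18432) = 8 * (48 * 48) by rewrite -!natrM.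
rewrite [8 * _]mulrC -[_ * 8 * _]mulrA (mulKf n2).
have hv : nth Z0 veps i = Zneg 1 \/ nth Z0 veps i = Zpos 1.
  by case: i {hi ci cj ij A B} => k hk /=; move: k hk; do 10![case; first by auto].
rewrite /ci; case: hv => -> /=; rewrite ?zKN1 ?zK1.
  have -> : 'i / 2 * ('i / 2) = 'i ^+ 2 / 4 :> K by field.
  by rewrite sqrCi; field.
by field.
Qed.

Definition so5 (s : L) : Prop := exists k, List.In k so5C /\ s = bL k.

Lemma so5C_so6C k : List.In k so5C -> List.In k so6C.
Proof. by move=> h; do 5!apply: or_intror. Qed.

Lemma so5_So s : so5 s -> So s.
Proof. by move=> [k [hk ->]]; apply: So_bL; exact: so5C_so6C. Qed.

Lemma so6_le k : List.In k so6C -> (Pos.to_nat k <= 248)%N /\ ~~ isW k.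
Proof.
have h : all (fun k => ~~ isW k && Pos.leb k 248) so6C by [].
by move=> /(all_In h)/andP[h1 /Pos.leb_spec0 h2]; split=> //; lia.
Qed.

Lemma So_tau s : So s -> tau s = s.
Proof.
move: s; apply: So_ind => [|k /so6_le[hk /negPf e]]; last by rewrite tau_bL // e.
by apply: closed_ext => a u w //; rewrite tau_linear.
Qed.

Lemma so5_cliff s i x : so5 s -> tau x = - x -> br s (br (cliff_v i) x) = br (cliff_v i) (br s x).
Proof.
move=> [k [hk ->]]; move: x; apply: odd_ind => [|p hp hW].
  by apply: closed_ext => a u w; rewrite !br_linear.
apply: (cliff_ind (P := fun z => br (bL k) (br z (bL p)) = br z (br (bL k) (bL p)))) => [|u hu].
  by apply: closed_ext => a w w'; rewrite br_linear_l // br_linear.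
apply: (scalerI nat48); apply: (scalerI nat48); rewrite !br_bL2.
exact: (ev_eq _ (all_In (all_In (all_In cliff_so5 hu) hk) (In_Wlist hp hW))).
Qed.

Lemma s0_cliff i x : tau x = - x -> br (bL 38) (br (cliff_v i) x) = - br (cliff_v i) (br (bL 38) x).
Proof.
move: x; apply: odd_ind => [|p hp hW].
  by apply: closed_ext => a u w; rewrite !br_linear // opprD scalerN.
apply: (cliff_ind (P := fun z => br (bL 38) (br z (bL p)) = - br z (br (bL 38) (bL p)))) => [|u hu].
  by apply: closed_ext => a w w'; rewrite br_linear_l ?br_linear // opprD scalerN.
apply: (scalerI nat48); apply: (scalerI nat48); rewrite !scalerN !br_bL2.
rewrite (ev_eq _ (all_In (all_In cliff_s0 hu) (In_Wlist hp hW))) ev_axpy ev_nil addr0 zKN1.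
by rewrite scaleN1r.
Qed.

Lemma s0_neq0 : br (bL 38) (bL 145) != 0.
Proof.
apply: contraNneq bL145 => e; have := br_bL2 38 38 145.
rewrite e (linear_0 (br_linear _)) !scaler0 (ev_eq _ s0_sqr) ev2 => /esym/eqP.
by rewrite scaler_eq0 => /orP[|//]; rewrite zK_eq0.
Qed.

Lemma bL145_odd : tau (bL 145) = - bL 145.
Proof. by rewrite tau_bL. Qed.

Definition cas_a (t : 'I_(size Wlist)) : L :=
  (zK (dualW (nth 1%positive Wlist t)).2 / 256) *: bL (nth 1%positive Wlist t).
Definition cas_b (t : 'I_(size Wlist)) : L := bL (dualW (nth 1%positive Wlist t)).1.

Lemma nth_In (T : Type) (x : T) s i : (i < size s)%N -> List.In (nth x s i) s.
Proof.
by elim: s i => [|y s IH] [|i] //= hi; [left|right; exact: IH].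
Qed.

Lemma cas_a_odd t : tau (cas_a t) = - cas_a t.
Proof.
have [h1 h2] := Wlist_In (nth_In 1%positive (ltn_ord t)).
by rewrite /cas_a (linear_Z _ _ tau_linear) tau_bL // h2 scalerN.
Qed.

Lemma cas_b_odd t : tau (cas_b t) = - cas_b t.
Proof.
have h := all_In dualW_odd (nth_In 1%positive (ltn_ord t)).
rewrite /cas_b; move: (dualW _).1 h => q hq.
have [h2|h2] := leqP (Pos.to_nat q) 248; first by rewrite tau_bL // hq.
rewrite bL_out; last by apply/negP => /Pos.leb_spec0; lia.
by rewrite (linear_0 tau_linear) oppr0.
Qed.

Lemma ev_casC z : ev bL (casC z) = \sum_(p <- Wlist)
  zK (dualW p).2 *: ((48 * 48) *: br (bL p) (br (bL (dualW p).1) (ev bL z))).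
Proof.
rewrite /casC; elim: Wlist => [|p s IH]; first by rewrite big_nil.
by rewrite big_cons -IH [foldr _ _ _]/= ev_axpy br_adC2.
Qed.

Lemma zKcas : zK (Zpos 589824) = 256 * (48 * 48).
Proof.
have -> : Zpos 589824 = Z.mul (Zpos 256) (Z.mul (Zpos 48) (Zpos 48)) by [].
by rewrite !zKM.
Qed.

Lemma casimir z : tau z = z -> z = \sum_t br (cas_a t) (br (cas_b t) z).
Proof.
move: z; apply: even_ind => [|p hp hW].
  apply: closed_ext => [a u w|a u w] //.
  rewrite scaler_sumr -big_split; apply: eq_bigr => t _ /=.
  by rewrite !br_linear.
have := all_upto casimir_check hp; rewrite (negPf hW) orFb => /(ev_eq bL).
rewrite ev_casC ev1 ev2 zKcas => e.
have n1 : 256 * (48 * 48) != 0 :> K by rewrite -!natrM pnatr_eq0.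
apply: (scalerI n1); rewrite -[LHS]e (big_nth 1%positive) big_mkord scaler_sumr.
apply: eq_bigr => t _; rewrite /cas_a /cas_b brZl !scalerA; congr (_ *: _).
by move: (zK _) => c; field.
Qed.

Definition in_cliff_span (y : L) : Prop := exists u : 'rV[K]_10, y = \sum_j u 0 j *: cliff_v j.

Lemma cliff_span_closed : linear_closed in_cliff_span.
Proof.
split=> [|a y z [u ->] [w ->]].
  by exists 0; rewrite big1 // => j _; rewrite mxE scale0r.
exists (a *: u + w); rewrite scaler_sumr -big_split; apply: eq_bigr => j _ /=.
by rewrite !mxE scalerDl scalerA.
Qed.

Lemma cliff_coef_neq0 i : cliff_coef i != 0.
Proof.
rewrite /cliff_coef mulf_neq0 ?invr_eq0 ?pnatr_eq0 //.
by case: ifP => _; [exact: neq0Ci|exact: oner_neq0].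
Qed.

Lemma cliffU_span u : List.In u cliffU -> in_cliff_span (bL u).
Proof.
move=> hu; rewrite -(ev1 bL); have [P0 PL] := cliff_span_closed.
have hu' : reduce 50 (echelon 50 vsv) [:: (u, Zpos 1)] = [::].
  by have := all_In cliffU_vsv hu; case: (reduce _ _ _).
apply: (echelon_sound P0 PL _ hu') => row /(In_nth [::])[i [hi <-]].
have hi' : (i < 10)%N by [].
have -> : ev bL (nth [::] vsv i) = (cliff_coef i)^-1 *: cliff_v (Ordinal hi').
  by rewrite /cliff_v scalerA mulVf ?cliff_coef_neq0 // scale1r.
exists ((cliff_coef i)^-1 *: delta_mx 0 (Ordinal hi')).
rewrite (bigD1 (Ordinal hi')) //= big1 => [|j /negPf ne]; rewrite !mxE ?eqxx ?ne ?mulr0 ?scale0r //.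
by rewrite addr0 mulr1.
Qed.

(** The operator of [projC] expressed by the bracket, sigma and so(5) alone, which is why every
    automorphism of the group commutes with it. *)
Definition span_proj (x : L) : L :=
  let y := (x + tau x) - sg (x + tau x) in
  zK (Zpos 147456) *: y + (48 * 48) *: \sum_(k <- so5C) br (bL k) (br (bL k) y).

Lemma span_proj_ev x : span_proj (ev bL x) = ev bL (projC x).
Proof.
rewrite /span_proj /projC; set s2 := axpy _ x _.
have e2 : ev bL x + tau (ev bL x) = ev bL s2.
  by rewrite /s2 ev_axpy zK1 scale1r /square !sg_ev.
rewrite e2 sg_ev; clear e2; clearbody s2; set y := axpy _ s2 _.
have ey : ev bL s2 - ev bL (bind sL s2) = ev bL y.
  by rewrite /y !ev_axpy ev_nil addr0 zK1 zKN1 scale1r scaleN1r.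
rewrite ey; clear ey; clearbody y; rewrite [RHS]ev_axpy; congr (_ + _).
elim: so5C => [|k l IH]; first by rewrite big_nil scaler0.
by rewrite big_cons scalerDr IH [foldr _ _ _]/= ev_axpy zK1 scale1r br_adC2.
Qed.

Lemma span_proj_linear : linear span_proj.
Proof.
move=> a x z; rewrite /span_proj.
have -> : a *: x + z + tau (a *: x + z) = a *: (x + tau x) + (z + tau z).
  by rewrite tau_linear add_scale_pair.
rewrite sg_linear add_scale_sub; move: (_ - _) (_ - _) => y' y.
have -> : \sum_(k <- so5C) br (bL k) (br (bL k) (a *: y + y')) =
    a *: \sum_(k <- so5C) br (bL k) (br (bL k) y) + \sum_(k <- so5C) br (bL k) (br (bL k) y').
  by rewrite scaler_sumr -big_split; apply: eq_bigr => k _ /=; rewrite !br_linear.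
by rewrite !scalerDr !scalerA ![_ * a]mulrC addrACA.
Qed.

Lemma span_proj_span x : in_cliff_span (span_proj x).
Proof.
move: x; apply: bL_ind => [|p hp].
  have [P0 PL] := cliff_span_closed.
  split; first by rewrite (linear_0 span_proj_linear).
  by move=> a u w hu hw; rewrite span_proj_linear; apply: PL.
rewrite -(ev1 bL) span_proj_ev; apply: closed_ev cliff_span_closed _ => kc hkc.
by apply: cliffU_span; apply: memP_In; exact: all_In (all_upto projC_check hp) hkc.
Qed.

Lemma span_proj_v i : span_proj (cliff_v i) = zK (Zpos 589824) *: cliff_v i.
Proof.
apply: (cliff_ind (P := fun z => span_proj z = zK (Zpos 589824) *: z)) => [|u hu].
  apply: closed_ext => [|a y z]; first exact: span_proj_linear.
  by rewrite scalerDr !scalerA mulrC.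
by rewrite -{1}(ev1 bL) span_proj_ev (ev_eq _ (all_In projC_cliffU hu)) ev2.
Qed.

(** [span_proj] commutes with [al], takes values in the span of the v_i, and acts on that span as a
    non-zero scalar. *)
Lemma aut_cliff_v (al : 'End(L)) : graded_aut br sg So al -> forall i,
  exists u : 'rV[K]_10, al (cliff_v i) = \sum_j u 0 j *: cliff_v j.
Proof.
move=> [_ hsg hSo] i; have n1 : zK (Zpos 589824) != 0 by rewrite zK_eq0.
have hproj x : span_proj (al x) = al (span_proj x).
  rewrite /span_proj /square !hsg -linearD hsg -linearB [RHS]linearD !linearZ /=.
  congr (_ + _ *: _); rewrite linear_sum.
  have : forall k, List.In k so5C -> So (bL k) by move=> k hk; apply: so5_So; exists k.
  elim: so5C => [|k l IH] h; first by rewrite !big_nil.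
  rewrite !big_cons IH => [|k' hk']; last by apply: h; right.
  by rewrite !(hSo _ (h k (or_introl erefl))).
have [u hu] := span_proj_span (al (cliff_v i)).
exists ((zK (Zpos 589824))^-1 *: u); apply: (scalerI n1).
have -> : zK (Zpos 589824) *: al (cliff_v i) = span_proj (al (cliff_v i)).
  by rewrite hproj span_proj_v [RHS]linearZZ.
rewrite hu scaler_sumr; apply: eq_bigr => j _.
by rewrite mxE; move: (cliff_v j) => w; rewrite scalerA mulrA mulfV // mul1r.
Qed.

Definition ops7 : seq positive := [:: 111; 222; 195; 57; 26; 43; 46]%positive.

Lemma ops7_mem : all (fun u => memP cliffU u || memP so5C u) ops7.
Proof. by []. Qed.

Lemma words_ind (P : sv -> Prop) ops : P w0C ->
  (forall o y, List.In o ops -> P y -> P (adC o y)) -> forall row, List.In row (words ops) -> P row.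
Proof.
move=> h0; elim: ops => [|o l IH] h row; first by case=> [<-|].
have -> : words (o :: l) = words l ++ [seq adC o x | x <- words l] by [].
have {}IH := IH (fun o' y ho => h o' y (or_intror ho)).
move=> hin; case: (In_cat hin) => [|h2]; first exact: IH.
have [y [<- hy]] := In_map h2.
by apply: h; [left|exact: IH].
Qed.

Section Irreducible.
Variable T : 'End(L).
Hypothesis T_v : forall i x, tau x = - x -> T (br (cliff_v i) x) = br (cliff_v i) (T x).
Hypothesis T_so5 : forall s x, so5 s -> tau x = - x -> T (br s x) = br s (T x).
Hypothesis T_odd : forall x, tau x = - x -> tau (T x) = - T x.

Definition inter (u : positive) : Prop :=
  [/\ (Pos.to_nat u <= 248)%N, ~~ isW u
    & forall x, tau x = - x -> T (br (bL u) x) = br (bL u) (T x)].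

Lemma inter_cliffU u : List.In u cliffU -> inter u.
Proof.
move=> hu; have [h1 h2] := cliffU_le hu; split=> // x hx.
have [w ->] := cliffU_span hu.
have l z : linear (fun y => br y z) := br_linear_l z.
rewrite (linear_lincomb _ _ _ (l x)) (linear_lincomb _ _ _ (l (T x))) linear_sum.
by apply: eq_bigr => j _; rewrite linearZ /= T_v.
Qed.

Lemma inter_so5 u : List.In u so5C -> inter u.
Proof.
move=> hu; have [h1 h2] := so6_le (so5C_so6C hu); split=> // x hx; apply: T_so5 => //.
by exists u.
Qed.

Definition ad48 (u : positive) (x : L) : L := 48 *: br (bL u) x.

Lemma inter_ad u x : inter u -> tau x = - x -> tau (ad48 u x) = - ad48 u x /\ T (ad48 u x) = ad48 u (T x).
Proof.
move=> [h1 /negPf h2 h3] hx; rewrite /ad48; split; last by rewrite linearZ /= h3.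
by rewrite (linear_Z _ _ tau_linear) tau_br tau_bL // h2 hx brNr scalerN.
Qed.

Definition factorL (f : Z * seq positive) (x : L) : L := zK f.1 *: x + foldr ad48 x f.2.
Definition vacL (x : L) : L := foldr factorL x factors.

Lemma factors_inter : forall f, List.In f factors -> forall u, List.In u f.2 -> inter u.
Proof.
have h : all (fun f => all (fun u => memP cliffU u || memP so5C u) f.2) factors by [].
move=> f /(all_In h) hf u /(all_In hf)/orP[] /memP_In.
  exact: inter_cliffU.
exact: inter_so5.
Qed.

Lemma vacL_T x : tau x = - x -> T (vacL x) = vacL (T x).
Proof.
move=> hx; have hw l y : (forall u, List.In u l -> inter u) -> tau y = - y ->
    tau (foldr ad48 y l) = - foldr ad48 y l /\ T (foldr ad48 y l) = foldr ad48 (T y) l.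
  elim: l => [|u l IH] hl hy //=.
  have [h1 h2] := IH (fun w hw => hl w (or_intror hw)) hy.
  have [h3 h4] := inter_ad (hl u (or_introl erefl)) h1.
  by rewrite h3 h4 h2.
have TP a u v : T (a *: u + v) = a *: T u + T v by rewrite linearP.
have eF f z : factorL f z = zK f.1 *: z + foldr ad48 z f.2 by [].
have := factors_inter; rewrite /vacL; elim: factors => [|f l IH] hf //=.
suff : tau (foldr factorL x l) = - foldr factorL x l /\ T (foldr factorL x l) = foldr factorL (T x) l.
  move=> [h1 h2]; have [h3 h4] := hw f.2 _ (hf f (or_introl erefl)) h1.
  by rewrite !eF TP h4 h2.
move: {IH} (fun g hg => hf g (or_intror hg)); elim: l {hf} => [|k l IH] hl //=.
have [h1 h2] := IH (fun g hg => hl g (or_intror hg)).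
have [h3 h4] := hw k.2 _ (hl k (or_introl erefl)) h1.
rewrite !eF tau_linear h1 h3 TP h4 h2; split=> //.
by rewrite scalerN opprD.
Qed.

Lemma vacL_ev x : vacL (ev bL x) = ev bL (vacC x).
Proof.
have hw y l : foldr ad48 (ev bL y) l = ev bL (foldr adC y l).
  by elim: l => [|u l IH] //=; rewrite IH /ad48 br_adC.
rewrite /vacL /vacC; elim: factors => [|f l IH] //.
by rewrite [LHS]/= IH [foldr factorC _ _]/= /factorL /factorC hw ev_axpy.
Qed.

Lemma vacL_linear : linear vacL.
Proof.
have hw l : linear (fun x => foldr ad48 x l).
  elim: l => [|u l IH] a x y //=.
  by rewrite IH /ad48 br_linear scalerDr !scalerA mulrC.
rewrite /vacL; elim: factors => [|f l IH] a x y //=.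
by rewrite IH /factorL hw scalerDr !scalerA [_ * a]mulrC -scalerA add_scale_pair.
Qed.

Lemma vac_line x : tau x = - x -> exists c, vacL x = c *: ev bL w0C.
Proof.
move: x; apply: odd_ind => [|p hp hW].
  split; first by exists 0; rewrite (linear_0 vacL_linear) scale0r.
  move=> a u w [c hc] [c' hc']; exists (a * c + c').
  by rewrite vacL_linear hc hc' scalerDl scalerA.
rewrite -(ev1 bL) vacL_ev (ev_eq _ (all_In vacC_check (In_Wlist hp hW))) ev_axpy ev_nil addr0.
by eexists.
Qed.

Lemma w0_odd : tau (ev bL w0C) = - ev bL w0C.
Proof.
have h : all (fun kc => isW kc.1 && Pos.leb kc.1 248) w0C by [].
apply: (@closed_ev (fun z => tau z = - z)) => [|kc hkc].
  by apply: closed_ext => a u w; rewrite ?tau_linear // opprD scalerN.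
have /andP[h1 /Pos.leb_spec0 h2] := all_In h hkc.
by rewrite tau_bL ?h1 //; lia.
Qed.

(** Schur's lemma by a cyclic vector. [T] commutes with the rank one operator [vacL], hence
    preserves its image, the line of [w0C]; the words applied to [w0C] span W and carry the
    eigenvalue everywhere. *)
Lemma cliff_irr : exists c, forall x, tau x = - x -> T x = c *: x.
Proof.
have := vacC_w0; move: (coef 181 _) => m /andP[e n0].
have m0 : zK m != 0 by rewrite zK_eq0.
have em : vacL (ev bL w0C) = zK m *: ev bL w0C.
  by rewrite vacL_ev (ev_eq _ e) ev_axpy ev_nil addr0.
clear e n0; have [c hc] := vac_line (T_odd w0_odd).
(* From m T w0 = T (vac w0) = vac (T w0) = c w0, where m is the non-zero eigenvalue of [vacL] at
   w0. *)
have hT : T (ev bL w0C) = (c / zK m) *: ev bL w0C.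
  apply: (scalerI m0); rewrite scalerA mulrC divfK // -hc -(vacL_T w0_odd) em.
  by rewrite linearZ.
move: (c / zK m) hT => {c hc} c hT; exists c.
have hops o : List.In o ops7 -> inter o.
  move=> /(all_In ops7_mem)/orP[] /memP_In; [exact: inter_cliffU|exact: inter_so5].
pose P z := tau z = - z /\ T z = c *: z.
have cP : linear_closed P.
  split; first by rewrite /P (linear_0 tau_linear) oppr0 linear0 scaler0.
  move=> a u w [h1 h2] [h3 h4]; split; first by rewrite tau_linear h1 h3 opprD scalerN.
  by rewrite linearP /= h2 h4 scalerDr !scalerA mulrC.
have hrows : forall row, List.In row (words ops7) -> P (ev bL row).
  apply: (words_ind (P := fun y => P (ev bL y))) => [|o y ho [h1 h2]]; first by split; [exact: w0_odd|].
  have [h3 h4] := inter_ad (hops o ho) h1; rewrite -br_adC; split=> //.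
  by rewrite -/(ad48 _ _) h4 h2 /ad48 brZr !scalerA mulrC.
apply: odd_ind => [|p hp hW].
  split; first by rewrite linear0 scaler0.
  by move=> a u w h1 h2; rewrite linearP /= h1 h2 scalerDr !scalerA mulrC.
have [P0 PL] := cP.
rewrite -(ev1 bL); have [] // : P (ev bL [:: (p, Zpos 1)]).
apply: (echelon_sound P0 PL hrows (fuel := 400)).
by have := all_In words_check (In_Wlist hp hW); case: (reduce _ _ _).
Qed.

End Irreducible.

Lemma cliff_isog : topgroup_isog (fun al be : 'End(L) => (al \o be)%VF) (@cliff_mul K 10)
  [set al | graded_aut br sg So al] (@Spin K 10).
Proof.
apply: (@spin_isog K L br sg So so5 (bL 38) 9 cliff_v (size Wlist) cas_a cas_b
  br_linear brN sg_linear tauK tau_br isT cliff_v_br cliff_v_sg cliff_v_tau cliff_v_cliff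
  So_tau cliff_so cas_a_odd cas_b_odd casimir aut_cliff_v so5_So so5_cliff _ s0_cliff
  (bL 145) bL145_odd s0_neq0 cliff_irr).
by apply: So_bL; left.
Qed.

End E8Verification.

(** * The subalgebra so(6) and the conclusion *)

Section So6.
Variable K : numClosedFieldType.
Local Notation e8 := (e8 K).
Local Notation bL := (bL K).
Local Notation bJ := (bJ K).

Definition so6_part (s : e8) : Prop := exists D : 'End(jordan K), in_so6 D /\ s = R_of D.

Lemma R_ofE (D : 'End(jordan K)) : R_of D = inP1 (PhiD D).
Proof. by []. Qed.

Lemma R_of_linear : linear (@R_of K).
Proof. by move=> a D D'; rewrite !R_ofE PhiD_linear inP1_linear. Qed.

Lemma R_of_dK k : Pos.leb k 52 -> R_of (dK K k) = bL k.
Proof.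
move=> hk; rewrite R_ofE -PK_dK // bL_1 //.
by apply/Pos.leb_spec0; move/Pos.leb_spec0: hk; lia.
Qed.

Lemma in_so6P (D : 'End(jordan K)) : in_so6 D <->
  in_f4 D /\ forall j, List.In j [:: 1; 2; 3; 4; 5]%positive -> D (bJ j) = 0.
Proof.
have eF0 : jF 0 (oe K 0) = bJ 4 by exact: (@bJ_F K 0 0).
have eF1 : jF 0 (oe K 1) = bJ 5 by exact: (@bJ_F K 0 1).
split=> [[h1 h2 h3 h4]|[h1 h2]].
  split=> // j [<-|[<-|[<-|[<-|[<-|[]]]]]].
  - by have := h2 0; rewrite bJ_E.
  - by have := h2 1; rewrite bJ_E.
  - by have := h2 2; rewrite bJ_E.
  - by rewrite -eF0.
  - by rewrite -eF1.
split=> //; last 2 first.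
- by rewrite eF0 h2 //; do 3!right; left.
- by rewrite eF1 h2 //; do 4!right; left.
move=> i; rewrite bJ_E h2 //.
by case: i => -[|[|[|//]]] hi; [left|right; left|right; right; left].
Qed.

Lemma so6_dK k : List.In k so6C -> in_so6 (dK K k).
Proof.
move=> hk; apply/in_so6P; split=> [|j hj]; first exact: in_f4_dK.
rewrite dK_bJ; have := all_In (all_In so6_kills hk) hj.
by case: (dC k j) => // _; rewrite ev_nil.
Qed.

Lemma so6C_leb k : List.In k so6C -> Pos.leb k 52.
Proof.
have h : all (fun k => Pos.leb k 52) so6C by [].
exact: all_In h.
Qed.

Lemma so6_part_bL k : List.In k so6C -> so6_part (bL k).
Proof.
by move=> hk; exists (dK K k); rewrite R_of_dK ?so6C_leb //; split=> //; exact: so6_dK.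
Qed.

(** The expansion of [f4_span] has coefficient 0 at each pivot column that the derivation kills; by
    [so6_dpair] only the indices of so(6) survive. *)
Lemma so6_part_ind (P : e8 -> Prop) : linear_closed P ->
  (forall k, List.In k so6C -> P (bL k)) -> forall s, so6_part s -> P s.
Proof.
move=> [P0 PL] h _ [D [/in_so6P[hD h0] ->]].
have [c [hc ->]] := f4_span hD.
have hz k : List.In k (upto 52) -> c k = 0 \/ List.In k so6C.
  move=> hk; case/orP: (all_In so6_dpair hk) => [/memP_In|hj]; [by right|left].
  apply: hc; apply: h0; move: hj.
  by case: (dpair k).1 => [[q|[q|q|]|]|[q|[q|q|]|]|] //= _; auto 10.
elim: (upto 52) hz => [|k l IH] hz; first by rewrite big_nil (linear_0 R_of_linear).
have hs := IH (fun j hj => hz j (or_intror hj)).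
rewrite big_cons; case: (hz k (or_introl erefl)) => [->|hk].
  by rewrite scale0r add0r.
by rewrite R_of_linear R_of_dK ?so6C_leb //; apply: PL => //; exact: h.
Qed.

(** Index 145 = 133 + 12 is F_2(e_0) in the first component of the first copy of the Freudenthal
    space. *)
Lemma bL145_neq0 : bL 145 != 0.
Proof.
have -> : 145%positive = Pos.add 12 133 by [].
rewrite bL_2 // bF_X //; apply/eqP => /(congr1 (fun x : e8 => x.1.1.1.1.2.1.1.1)) /= e.
have : cJ 12 (bJ 12) = 0 by rewrite e (linear_0 (cJ_linear 12)).
by rewrite cJ_bJ ?eqxx //; move/eqP; rewrite oner_eq0.
Qed.

End So6.

Theorem theorem6p3 (R : realType) :
  topgroup_isog (fun alpha beta : 'End(e8 R[i]) => (alpha \o beta)%VF)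
    (@cliff_mul R[i] 10) (@E8_sigma4_so6 R[i]) (@Spin R[i] 10).
Proof.
(* The same conditions, quantified over the elements R_D of e8 instead of the derivations D. *)
have -> : @E8_sigma4_so6 R[i] =
    graded_aut (@e8_bracket R[i]) (@sigma4 R[i]) (@so6_part R[i]).
  apply/funext => al; apply/propext; split=> -[h1 h2 h3]; split=> //.
  - by move=> s [D [hD ->]] x; exact: h3.
  - by move=> D hD x; apply: h3; exists D.
exact: (@cliff_isog R[i] (e8 R[i]) (@e8_bracket R[i]) (@sigma4 R[i]) (bL R[i])
  (@br_linear _) (@brN _) (@sigma4_linear _) (@spans_bL _) (@br_bL _) (@sigma4_bL _)
  (@bL_out _) (@so6_part R[i]) (@so6_part_ind _) (@so6_part_bL _) (@bL145_neq0 _)).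
Qed.
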